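(* Let $\mathcal{F}$ be a class of functions $\mathcal{X}\times\mathcal{A}\to[0,1]$, $\mathcal{G}$ a class of functions $\mathcal{X}\to[0,1]$, and $\Pi$ a class of policies $\mathcal{X}\to\Delta(\mathcal{A})$. Assume realizability and completeness of $(\mathcal{F},\mathcal{G},\Pi)$ (as defined in the context). Let $\pi^\dagger$ denote the policy learned by CODA+PSPI (defined in the context) from the datasets $D_{\mathrm{dyn}}$ and $D_{\mathrm{goal}}$. Then with probability at least $1-\delta$, for any $\pi\in\Pi$, $$J(\pi)-J(\pi^\dagger)\;\lesssim\;\mathfrak{C}_{\mathrm{dyn}}(\pi)\left(\sqrt{\frac{\square}{|D_{\mathrm{dyn}}|}}+\sqrt{\frac{\square}{|D_{\mathrm{goal}}|}}\right)+\mathfrak{C}_{\mathrm{goal}}(\pi)\sqrt{\frac{\log\frac{\mathcal{N}_\infty(\mathcal{G},1/|D_{\mathrm{goal}}|)}{\delta}}{|D_{\mathrm{goal}}|}},$$ where $$\square=\log\left(\frac{\mathcal{N}_\infty(\mathcal{F},1/|D_{\mathrm{goal}}||D_{\mathrm{dyn}}|)\,\mathcal{N}_\infty(\mathcal{G},1/|D_{\mathrm{goal}}||D_{\mathrm{dyn}}|)\,\mathcal{N}_{\infty,1}(\Pi,1/|D_{\mathrm{goal}}||D_{\mathrm{dyn}}|)}{\delta}\right)$$ and $\mathfrak{C}_{\mathrm{dyn}}(\pi)$, $\mathfrak{C}_{\mathrm{goal}}(\pi)$ are the concentrability coefficients defined in the context.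
   Context: **CGO problem.** A contextual goal-oriented (CGO) problem has a state space $\mathcal{S}$, action space $\mathcal{A}$, context space $\mathcal{C}$, transition kernel $P:\mathcal{S}\times\mathcal{A}\to\Delta(\mathcal{S})$ (independent of the context), discount $\gamma\in[0,1)$, an initial distribution $d_0$ over pairs $(s_0,c)$, and for each $c\in\mathcal{C}$ a goal set $G_c\subset\mathcal{S}$. $\Delta(\cdot)$ denotes the space of distributions. Let $\mathcal{X}=\mathcal{S}\times\mathcal{C}$ and $G=\{(s,c)\in\mathcal{X}: s\in G_c\}$. Let $s^+\notin\mathcal{S}$ be a fictitious absorbing state, $\bar{\mathcal{S}}=\mathcal{S}\cup\{s^+\}$, $\bar{\mathcal{X}}=\bar{\mathcal{S}}\times\mathcal{C}$, $\mathcal{X}^+=\{(s^+,c):c\in\mathcal{C}\}$. The reward is $R(x)=\mathbb{1}(x\in G)$ (zero on $\mathcal{X}^+$). **Original MDP.** Contexts never change. From $x=(s,c)$ with $s\in G_c$ or $s=s^+$, every action leads to $(s^+,c)$; otherwise, under action $a$, the next state is $(s',c)$ with $s'\sim P(\cdot|s,a)$. For $\pi:\mathcal{X}\to\Delta(\mathcal{A})$ (actions on $\mathcal{X}^+$ are irrelevant), $Q^\pi(x,a)=\mathbb{E}_{\pi,P}[\sum_{t\ge0}\gamma^tR(x_t)\mid x_0=x,a_0=a]$ and $J(\pi)=\mathbb{E}_{x_0\sim d_0}\mathbb{E}_{a\sim\pi(\cdot|x_0)}[Q^\pi(x_0,a)]$. For any $f$, write $f(x,\pi)=\mathbb{E}_{a\sim\pi(\cdot|x)}[f(x,a)]$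 and $f(d_0,\pi)=\mathbb{E}_{x_0\sim d_0}[f(x_0,\pi)]$. **Data.** $D_{\mathrm{dyn}}=\{(s_i,a_i,s_i')\}$ consists of i.i.d. samples from $\mu_{\mathrm{dyn}}(s,a,s')$, with $\mu_{\mathrm{dyn}}(s'|s,a)=P(s'|s,a)$. $D_{\mathrm{goal}}=\{(s_j,c_j)\}$ consists of i.i.d. samples from $\mu_{\mathrm{goal}}(s,c)$, which satisfies $\mu_{\mathrm{goal}}(s|c)>0\Rightarrow s\in G_c$. **Assumptions.** Let $\mathcal{T}^\pi f(x,a)=\gamma\,\mathbb{E}_{x'\sim P_0(\cdot|x,a)}[f(x',\pi)]$, where $P_0(x'|x,a)=P(s'|s,a)\mathbb{1}(c'=c)$. *Realizability*: for all $\pi\in\Pi$, $Q^\pi\in\mathcal{F}$, and $R\in\mathcal{G}$. *Completeness*: for all $f\in\mathcal{F}$, $g\in\mathcal{G}$, $\pi\in\Pi$, the function $(x,a)\mapsto\max(g(x),f(x,\pi))$ is in $\mathcal{F}$, and $\mathcal{T}^\pi f\in\mathcal{F}$. **Covering numbers.** $\mathcal{N}_\infty(\mathcal{F},\epsilon)$ and $\mathcal{N}_\infty(\mathcal{G},\epsilon)$ are the $\epsilon$-covering numbers in the $L_\infty$ metric; $\mathcal{N}_{\infty,1}(\Pi,\epsilon)$ is the $\epsilon$-covering number of $\Pi$ in the metric $\|\pi_1-\pi_2\|_{\infty,1}=\sup_{x\in\mathcal{X}}\|\pi_1(\cdot|x)-\pi_2(\cdot|x)\|_1$. The notation $1/|D_{\mathrm{goal}}||D_{\mathrm{dyn}}|$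 means $1/(|D_{\mathrm{goal}}||D_{\mathrm{dyn}}|)$. **Concentrability.** $\|h\|_\mu^2=\mathbb{E}_\mu[h^2]$ (also for unnormalized $\mu$), and $$\mathfrak{C}_{\mathrm{dyn}}(\pi)=\max_{f,f'\in\mathcal{F}}\frac{\|f-\mathcal{T}^\pi f'\|^2_{\rho^\pi_{\notin G}}}{\|f-\mathcal{T}^\pi f'\|^2_{\mu_{\mathrm{dyn}}}},\qquad \mathfrak{C}_{\mathrm{goal}}(\pi)=\max_{g\in\mathcal{G}}\frac{\|g-R\|^2_{\rho^\pi_{\in G}}}{\|g-R\|^2_{\mu_{\mathrm{goal}}}},$$ where $\rho^\pi_{\notin G}(x,a)=\mathbb{E}_{\pi,P}[\sum_{t=0}^{T-1}\gamma^t\mathbb{1}(x_t=x,a_t=a)]$, $\rho^\pi_{\in G}(x)=\mathbb{E}_{\pi,P}[\gamma^T\mathbb{1}(x_T=x)]$, trajectories start from $d_0$, and $T$ is the first time the agent enters $G$ ($\gamma^T=0$ if $T=\infty$). In the norm on functions of $(x,a)=((s,c),a)$, $\mu_{\mathrm{dyn}}$ means the product $\mu_{\mathrm{dyn}}(s,a)\mu_{\mathrm{goal}}(c)$. **CODA+PSPI.** Build $\bar D_{\mathrm{dyn}}=\{((s_i,c_j),a_i,0,(s_i',c_j)): (s_i,a_i,s_i')\in D_{\mathrm{dyn}},(\cdot,c_j)\in D_{\mathrm{goal}}\}$ and $\bar D_{\mathrm{goal}}=\{((s_n,c_n),a^+,1,(s^+,c_n)):(s_n,c_n)\in D_{\mathrm{goal}}\}$,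 with $a^+\notin\mathcal{A}$ a fictitious action. For $f\in\mathcal{F},g\in\mathcal{G}$ let $\bar f_g$ be the function on $\bar{\mathcal{X}}\times(\mathcal{A}\cup\{a^+\})$ equal to $0$ on $\mathcal{X}^+$, to $g(x)$ if $a=a^+$, $x\notin\mathcal{X}^+$, and to $f(x,a)$ otherwise; let $\bar{\mathcal{F}}$ be the set of all such $\bar f_g$. The extension $\bar\pi$ of $\pi$ plays $\pi(\cdot|x)$ for $x\notin G$ and $a^+$ for $x\in G$. Define $$\ell_{\mathrm{dyn}}(\bar f_g,\bar f'_{g'};\bar\pi)=\frac1{|\bar D_{\mathrm{dyn}}|}\sum_{(x,a,r,x')\in\bar D_{\mathrm{dyn}}}\bigl(f(x,a)-\gamma\max(g'(x'),f'(x',\pi))\bigr)^2,\quad \ell_{\mathrm{goal}}(\bar f_g)=\frac1{|\bar D_{\mathrm{goal}}|}\sum_{(x,a,r,x')\in\bar D_{\mathrm{goal}}}(g(x)-1)^2.$$ The learned policy $\pi^\dagger$ is the solution of $$\max_{\pi\in\Pi}\ \min_{\bar f_g\in\bar{\mathcal{F}}}\ \bar f_g(d_0,\bar\pi)\quad\text{s.t.}\quad \ell_{\mathrm{dyn}}(\bar f_g,\bar f_g;\bar\pi)-\min_{\bar f'_{g'}\in\bar{\mathcal{F}}}\ell_{\mathrm{dyn}}(\bar f'_{g'},\bar f_g;\bar\pi)\le\epsilon_{\mathrm{dyn}},\quad \ell_{\mathrm{goal}}(\bar f_g)\le0,$$ where $\epsilon_{\mathrm{dyn}}$ equals $\bigl(\sqrt{\square/|D_{\mathrm{dyn}}|}+\sqrt{\square/|D_{\mathrm{goal}}|}\bigr)^2$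 times a sufficiently large absolute constant, with $\square$ as in the claim. (When $d_0$ puts no mass on $G$, $\bar f_g(d_0,\bar\pi)=f(d_0,\pi)$.) $\lesssim$ hides a multiplicative constant not depending on the dataset sizes, the classes $\mathcal{F},\mathcal{G},\Pi$, $\delta$, or $\pi$.
   Formalization: The constants are uniform only for δ in (0, δ0], for each δ0 < 1 (uniformity as δ tends to 1 fails), and in the concentrability coefficients 0/0, which always occurs (f = T^π f', g = R), is read as 1, so that both coefficients are at least 1. *)

(* Defs.v *)
From HB Require Import structures.
From mathcomp Require Export all_boot all_order all_algebra.
From mathcomp Require Export all_classical all_reals all_analysis.

Set Implicit Arguments.
Unset Strict Implicit.
Unset Printing Implicit Defensive.

Export Order.TTheory GRing.Theory Num.Theory.
Export numFieldNormedType.Exports.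

#[global] Open Scope classical_set_scope.
#[global] Open Scope ring_scope.

(* Smallest size of a subset of [F] whose closed [eps]-balls cover [F]; [+oo]
   when there is no finite one. *)
Definition covering_number (R : realType) (T : Type) (dist : T -> T -> \bar R)
    (F : set T) (eps : R) : \bar R :=
  ereal_inf [set k%:R%:E | k in
    [set k : nat | exists c : 'I_k -> T, (forall i, F (c i)) /\
       forall f, F f -> exists i, (dist (c i) f <= eps%:E)%E]].

Definition dist_sup (R : realType) (T : Type) (f g : T -> R) : \bar R :=
  ereal_sup [set `|f x - g x|%:E | x in [set: T]].

(* ||p - q||_1, i.e. the total mass of |p - q|: the supremum over finite
   measurable partitions, which is sum_a |p(a) - q(a)| on a countable discrete
   space. *)
Definition dist_l1 (R : realType) d (T : measurableType d)
    (p q : set T -> \bar R) : \bar R :=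
  ereal_sup [set x | exists (k : nat) (B : 'I_k -> set T),
    [/\ forall i, measurable (B i), trivIset [set: 'I_k] B,
        \bigcup_(i in [set: 'I_k]) B i = [set: T] &
        x = (\sum_(i < k) `|p (B i) - q (B i)|)%E]].

(* ||pi_1 - pi_2||_{oo,1} *)
Definition dist_policy (R : realType) dX dA (X : measurableType dX)
    (A : measurableType dA) (pi1 pi2 : R.-pker X ~> A) : \bar R :=
  ereal_sup [set dist_l1 (pi1 x) (pi2 x) | x in [set: X]].

Record cgo (R : realType) dS dA dC (S : measurableType dS)
    (A : measurableType dA) (C : measurableType dC) := CGO {
  trans : R.-pker (S * A) ~> S ;
  init : probability (S * C)%type R ;
  goal_of : C -> set S ;
  measurable_goal : measurable [set x : S * C | goal_of x.2 x.1] }.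

Section CODA.
Context (R : realType) (dS dA dC : measure_display) (S : measurableType dS)
  (A : measurableType dA) (C : measurableType dC).

Let X : measurableType _ := (S * C)%type.
(* [None] is the fictitious absorbing state s^+ *)
Let Xb := (option S * C)%type.
(* [None] is the fictitious action a^+ *)
Let Ab := option A.
Let policy := R.-pker (S * C) ~> A.

Context (M : cgo R S A C) (gamma : R).

Let emb (x : X) : Xb := (Some x.1, x.2).

Definition goal : set X := [set x | goal_of M x.2 x.1].

Definition goal_bar : set Xb :=
  [set x | if x.1 is Some s then goal (s, x.2) else False].

Definition reward : X -> R := \1_goal.

Definition reward_bar : Xb -> R := \1_goal_bar.

Definition expect_next (x : Xb) (a : A) (phi : Xb -> \bar R) : \bar R :=
  if x.1 is Some s then
    if (s, x.2) \in goal then phi (None, x.2)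
    else (\int[trans M (s, a)]_s' phi (Some s', x.2))%E
  else phi (None, x.2).

(* The action played on X^+ is irrelevant; [point] is an arbitrary one. *)
Definition expect_act (pi : policy) (x : Xb) (phi : A -> \bar R) : \bar R :=
  if x.1 is Some s then (\int[pi (s, x.2)]_a phi a)%E else phi point.

(* E_{pi,P}[ Phi (x_0,a_0), ..., (x_t,a_t) | x_0 = x, a_0 = a ], the iterated
   integral that defines the finite-dimensional laws of the trajectory; [Phi]
   takes the history as a sequence of length t+1. *)
Fixpoint expect_from (pi : policy) (t : nat) (x : Xb) (a : A)
    (Phi : seq (Xb * A) -> \bar R) : \bar R :=
  if t is t'.+1 then
    expect_next x a (fun x' => expect_act pi x' (fun a' =>
      expect_from pi t' x' a' (fun h => Phi ((x, a) :: h))))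
  else Phi [:: (x, a)].

(* the same with x_0 ~ d_0 and a_0 ~ pi(.|x_0) *)
Definition expect_traj (pi : policy) (t : nat)
    (Phi : seq (Xb * A) -> \bar R) : \bar R :=
  (\int[init M]_x \int[pi x]_a expect_from pi t (emb x) a Phi)%E.

(* x_t and (x_t, a_t) for a history [h] of length t+1; [dflt] is never used *)
Let dflt (c : C) : Xb * A := ((None, c), point).
Let now (h : seq (Xb * A)) : Xb * A := last (dflt point) h.

Definition Qfun (pi : policy) (x : X) (a : A) : \bar R :=
  (\sum_(0 <= t <oo) (gamma ^+ t)%:E *
     expect_from pi t (emb x) a (fun h => (reward_bar (now h).1)%:E))%E.

Definition Jval (pi : policy) : \bar R :=
  (\int[init M]_x \int[pi x]_a Qfun pi x a)%E.

(* T, the first time in [G]; [find] returns t+1 when the history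
   (x_0,a_0), ..., (x_t,a_t) has not entered [G]. *)
Definition entry_time (h : seq (Xb * A)) : nat :=
  find (fun z : Xb * A => z.1 \in goal_bar) h.

(* Integral of [phi >= 0] against rho^pi_{not in G}, that is
   E[ sum_{t < T} gamma^t phi(x_t, a_t) ]. *)
Definition int_occ_notG (pi : policy) (phi : X * A -> R) : \bar R :=
  (\sum_(0 <= t <oo) (gamma ^+ t)%:E * expect_traj pi t (fun h =>
     if (t < entry_time h)%N then
       if (now h).1 is (Some s, c) then (phi ((s, c), (now h).2))%:E else 0
     else 0))%E.

(* Integral of [phi >= 0] against rho^pi_{in G}, that is
   E[ gamma^T phi(x_T) ] with gamma^T = 0 when T = oo. *)
Definition int_occ_G (pi : policy) (phi : X -> R) : \bar R :=
  (\sum_(0 <= t <oo) (gamma ^+ t)%:E * expect_traj pi t (fun h =>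
     if entry_time h == t then
       if (now h).1 is (Some s, c) then (phi (s, c))%:E else 0
     else 0))%E.

(* f(x, pi) *)
Definition at_policy (f : X * A -> R) (pi : policy) (x : X) : R :=
  (\int[pi x]_a f (x, a))%R.

Definition bellman (pi : policy) (f : X * A -> R) : X * A -> R :=
  fun z => gamma *
    (\int[trans M (z.1.1, z.2)]_s' at_policy f pi (s', z.1.2))%R.

Definition class01 d (T : measurableType d) (H : set (T -> R)) : Prop :=
  forall h, H h -> measurable_fun [set: T] h /\ (forall x, 0 <= h x <= 1).

Definition realizability (F : set (X * A -> R)) (G : set (X -> R))
    (Pi : set policy) : Prop :=
  (forall pi, Pi pi -> exists2 q, F q &
     forall x a, Qfun pi x a = (q (x, a))%:E) /\ G reward.

Definition completeness (F : set (X * A -> R)) (G : set (X -> R))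
    (Pi : set policy) : Prop :=
  forall f g pi, F f -> G g -> Pi pi ->
    F (fun z => Num.max (g z.1) (at_policy f pi z.1)) /\ F (bellman pi f).

(* mu_dyn(s' | s, a) = P(s' | s, a) *)
Definition dyn_law (mu : probability (S * A * S)%type R) : Prop :=
  forall (B : set (S * A)) (B' : set S), measurable B -> measurable B' ->
    mu (B `*` B') = (\int[mu]_(z in fst @^-1` B) trans M z.1 B')%E.

(* Goal examples are almost surely in [G]; on discrete spaces this is
   mu_goal(s|c) > 0 => s \in G_c. *)
Definition goal_law (mu : probability (S * C)%type R) : Prop :=
  mu (~` goal) = 0%E.

(* The joint law of the two datasets is the product law: each one is i.i.d.,
   and they are independent of each other. *)
Definition iid_data dO (Om : measurableType dO) (Pr : probability Om R)
    (mudyn : probability (S * A * S)%type R) (mugoal : probability (S * C)%type R)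
    (n m : nat) (Ddyn : 'I_n -> {RV Pr >-> (S * A * S)%type})
    (Dgoal : 'I_m -> {RV Pr >-> (S * C)%type}) : Prop :=
  forall (U : 'I_n -> set (S * A * S)) (V : 'I_m -> set (S * C)),
    (forall i, measurable (U i)) -> (forall j, measurable (V j)) ->
    Pr ((\bigcap_(i in [set: 'I_n]) (Ddyn i @^-1` U i)) `&`
        (\bigcap_(j in [set: 'I_m]) (Dgoal j @^-1` V j))) =
    ((\prod_(i < n) mudyn (U i)) * (\prod_(j < m) mugoal (V j)))%E.

(* mu_dyn(s, a) mu_goal(c): [h] reads only (s, a) from the first sample and c
   from the second, so integrating against the joint laws is integrating against
   the product of their marginals. *)
Definition sqnorm_dyn (mudyn : probability (S * A * S)%type R)
    (mugoal : probability (S * C)%type R) (h : X * A -> R) : \bar R :=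
  (\int[mudyn]_z \int[mugoal]_y ((h ((z.1.1, y.2), z.1.2)) ^+ 2)%:E)%E.

Definition sqnorm_goal (mugoal : probability (S * C)%type R)
    (h : X -> R) : \bar R :=
  (\int[mugoal]_y ((h y) ^+ 2)%:E)%E.

(* Ratio of nonnegative extended reals with 0 / 0 = 1 and x / 0 = +oo for
   x > 0. The classes of interest always contain degenerate pairs
   (f = T^pi f', g = R), so 0 / 0 does occur; with the value 1, meaning that the
   two norms agree, the concentrability coefficients are at least 1. *)
Definition ratio (x y : \bar R) : \bar R :=
  (if (x == 0) && (y == 0) then 1 else x / y)%E.

Definition Cdyn (F : set (X * A -> R)) (mudyn : probability (S * A * S)%type R)
    (mugoal : probability (S * C)%type R) (pi : policy) : \bar R :=
  ereal_sup [set ratio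
      (int_occ_notG pi (fun z => (p.1 z - bellman pi p.2 z) ^+ 2))
      (sqnorm_dyn mudyn mugoal (fun z => p.1 z - bellman pi p.2 z))
    | p in F `*` F].

Definition Cgoal (G : set (X -> R)) (mugoal : probability (S * C)%type R)
    (pi : policy) : \bar R :=
  ereal_sup [set ratio
      (int_occ_G pi (fun x => (g x - reward x) ^+ 2))
      (sqnorm_goal mugoal (fun x => g x - reward x))
    | g in G].

(* \bar D_dyn, listing (x, a, r, x'), as a multiset of |D_dyn| |D_goal| tuples *)
Definition aug_dyn (Dd : seq (S * A * S)) (Dg : seq (S * C)) :
    seq (X * A * R * X) :=
  [seq ((d.1.1, y.2), d.1.2, 0, (d.2, y.2)) | d <- Dd, y <- Dg].

Definition aug_goal (Dg : seq (S * C)) : seq (X * Ab * R * Xb) :=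
  [seq (y, None, 1, (None, y.2)) | y <- Dg].

(* \bar f_g is represented by the pair [p = (f, g)], which it determines. *)
Let pairFG := ((X * A -> R) * (X -> R))%type.

Definition fbar (p : pairFG) (x : Xb) (a : Ab) : R :=
  match x.1, a with
  | None, _ => 0
  | Some s, None => p.2 (s, x.2)
  | Some s, Some a => p.1 ((s, x.2), a)
  end.

(* expectation under \bar pi(.|x), x outside X^+ *)
Definition expect_pibar (pi : policy) (x : X) (phi : Ab -> \bar R) : \bar R :=
  (if x \in goal then phi None else \int[pi x]_a phi (Some a))%E.

(* \bar f_g(d_0, \bar pi) *)
Definition objective (pi : policy) (p : pairFG) : \bar R :=
  (\int[init M]_x expect_pibar pi x (fun a => (fbar p (emb x) a)%:E))%E.

(* l_dyn(\bar f_g, \bar f'_g'; \bar pi) with p = (f, g) and p' = (f', g') *)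
Definition loss_dyn (D : seq (X * A * R * X)) (pi : policy)
    (p p' : pairFG) : R :=
  (size D)%:R^-1 * \sum_(z <- D) (let: (x, a, r, x') := z in
     (p.1 (x, a) - gamma * Num.max (p'.2 x') (at_policy p'.1 pi x')) ^+ 2).

Definition loss_goal (D : seq (X * Ab * R * Xb)) (p : pairFG) : R :=
  (size D)%:R^-1 * \sum_(z <- D) (let: (x, a, r, x') := z in
     (p.2 x - 1) ^+ 2).

Definition feasible (F : set (X * A -> R)) (G : set (X -> R))
    (Dd : seq (S * A * S)) (Dg : seq (S * C)) (eps_dyn : \bar R)
    (pi : policy) : set pairFG :=
  [set p | [/\ (F `*` G) p,
    ((loss_dyn (aug_dyn Dd Dg) pi p p -
      inf [set loss_dyn (aug_dyn Dd Dg) pi p' p | p' in F `*` G])%:E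
        <= eps_dyn)%E &
    loss_goal (aug_goal Dg) p <= 0]].

(* [ereal_inf set0 = +oo]: the minimum over an empty feasible set is +oo. *)
Definition pess_value (F : set (X * A -> R)) (G : set (X -> R))
    (Dd : seq (S * A * S)) (Dg : seq (S * C)) (eps_dyn : \bar R)
    (pi : policy) : \bar R :=
  ereal_inf [set objective pi p | p in feasible F G Dd Dg eps_dyn pi].

Definition coda_pspi (F : set (X * A -> R)) (G : set (X -> R))
    (Pi : set policy) (Dd : seq (S * A * S)) (Dg : seq (S * C))
    (eps_dyn : \bar R) (pid : policy) : Prop :=
  Pi pid /\ forall pi, Pi pi ->
    (pess_value F G Dd Dg eps_dyn pi <= pess_value F G Dd Dg eps_dyn pid)%E.

(* log (N_oo(F) N_oo(G) N_{oo,1}(Pi) / delta), all at scale 1 / (n m) *)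
Definition logcov (F : set (X * A -> R)) (G : set (X -> R)) (Pi : set policy)
    (n m : nat) (delta : R) : \bar R :=
  let eps : R := (n * m)%:R^-1 in
  lne (covering_number (@dist_sup R _) F eps *
       covering_number (@dist_sup R _) G eps *
       covering_number (@dist_policy R _ _ _ _) Pi eps * (delta^-1)%:E)%E.

Definition rate_dyn (F : set (X * A -> R)) (G : set (X -> R)) (Pi : set policy)
    (n m : nat) (delta : R) : \bar R :=
  (sqrte (logcov F G Pi n m delta * (n%:R^-1)%:E) +
   sqrte (logcov F G Pi n m delta * (m%:R^-1)%:E))%E.

Definition rate_goal (G : set (X -> R)) (m : nat) (delta : R) : \bar R :=
  sqrte (lne (covering_number (@dist_sup R _) G m%:R^-1 * (delta^-1)%:E) *
         (m%:R^-1)%:E)%E.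

End CODA.

(* Main.v *)
(* Concentration. The squared-loss excess w = (f' - y)^2 - (tau - y)^2 of f'
   over the regression function tau satisfies E[w^2] <= 9 E[w], so the empirical
   mean of w over all pairs (dynamics sample, context) dominates a fixed fraction
   of its expectation up to a 1/n error. The pairs are not independent, but
   averaging over the contexts inside the exponential (Jensen) and integrating
   out the dynamics samples one at a time bounds the exponential moment; a second
   application, to the contexts alone, replaces the context average by its mean.
   Covers of F, G and Pi make this uniform, so that feasible pairs (f, g) have
   small Bellman error on mu_dyn x mu_goal and small goal error on mu_goal.

   Pessimism. For the learned policy, the Bellman backup of x |-> max (R x) (Q (x, pi)),
   paired with R, is feasible, and its objective is the true value J. For a
   comparator, unrolling
     f = h + gamma E[max (g, f(., pi))]
   until the first visit to the goal and using - h <= h^2 / (4 c) + c bounds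
   J - objective by the occupancy integrals of the two squared errors, which
   concentrability transfers to the data distributions; c is the rate itself. *)

From HB Require Import structures.
Require Import Defs.
From mathcomp Require Import measurable_realfun zify ring lra.

Set Implicit Arguments.
Unset Strict Implicit.
Unset Printing Implicit Defensive.

(** The witness of feasibility is a Bellman backup and not Q itself because the dynamics in
    [bellman] do not stop in the goal, whereas Q is 1 there: at goal states Q need not equal its own
    regression function. A backup reads its argument f only through max (R, f(., pi)), which is 1 on
    the goal for every f in [F]; as the backup agrees with Q elsewhere, it is a fixed point.

    Splitting the errors by - h <= h^2 / (4 c) + c avoids square roots of occupancy integrals and
    gives a bound linear in the concentrability coefficients. The price is a bare c / (1 - gamma),
    which is charged to these coefficients because they are at least 1.

    The restriction delta <= delta0 < 1 keeps ln (N / delta) above - ln delta0 > 0 even when every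
    cover has a single element. The radius of the covers, the numerical constants of the union bound
    and the positivity of c all rest on this margin, so [kappa0] depends on delta0.

    Discounted sums stay nonnegative extended reals, so monotone convergence replaces every
    summability argument. *)

Section bounded_measurable.
Context d (T : measurableType d) (R : realType).

(** The class on which real-valued integrals are manipulated: against a probability measure such
    functions are integrable, so linearity and monotonicity carry no further side condition. *)
Definition bmeas (f : T -> R) : Prop :=
  measurable_fun [set: T] f /\ exists M, forall x, `|f x| <= M.

Lemma bmeas_cst c : bmeas (cst c).
Proof. by split; [exact: measurable_cst|exists `|c|]. Qed.

Lemma bmeas01 (f : T -> R) : measurable_fun [set: T] f ->
  (forall x, 0 <= f x <= 1) -> bmeas f.
Proof.
move=> mf f01; split => //; exists 1 => x.
by rewrite ger0_norm; case/andP: (f01 x).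
Qed.

Lemma bmeasD f g : bmeas f -> bmeas g -> bmeas (fun x => f x + g x).
Proof.
move=> [mf [a fa]] [mg [b gb]]; split; first exact: measurable_funD.
by exists (a + b) => x; rewrite (le_trans (ler_normD _ _))// lerD.
Qed.

Lemma bmeasM f g : bmeas f -> bmeas g -> bmeas (fun x => f x * g x).
Proof.
move=> [mf [a fa]] [mg [b gb]]; split; first exact: measurable_funM.
by exists (a * b) => x; rewrite normrM ler_pM.
Qed.

Lemma bmeasZ c f : bmeas f -> bmeas (fun x => c * f x).
Proof. by move=> bf; apply: bmeasM => //; exact: bmeas_cst. Qed.

Lemma bmeasN f : bmeas f -> bmeas (fun x => - f x).
Proof.
move=> bf; rewrite (_ : (fun x => _) = fun x => -1 * f x); first exact: bmeasZ.
by apply/funext => x; rewrite mulN1r.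
Qed.

Lemma bmeasB f g : bmeas f -> bmeas g -> bmeas (fun x => f x - g x).
Proof. by move=> bf bg; apply: bmeasD => //; exact: bmeasN. Qed.

Lemma bmeasX n f : bmeas f -> bmeas (fun x => f x ^+ n).
Proof.
move=> bf; elim: n => [|n ih].
  by rewrite (_ : (fun x => _) = cst 1)//; exact: bmeas_cst.
rewrite (_ : (fun x => _) = fun x => f x * f x ^+ n); first exact: bmeasM.
by apply/funext => x; rewrite exprS.
Qed.

Lemma bmeas_max f g : bmeas f -> bmeas g -> bmeas (fun x => Num.max (f x) (g x)).
Proof.
move=> [mf [a fa]] [mg [b gb]]; split; first exact: measurable_maxr.
exists (Num.max a b) => x; rewrite le_max.
by rewrite /Num.max; case: ifPn => _; rewrite ?fa ?gb ?orbT.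
Qed.

Lemma bmeas_sum (I : Type) (s : seq I) (f : I -> T -> R) :
  (forall i, bmeas (f i)) -> bmeas (fun x => \sum_(i <- s) f i x).
Proof.
move=> bf; elim: s => [|i s ih].
  rewrite (_ : (fun x => _) = cst 0); first exact: bmeas_cst.
  by apply/funext => x; rewrite big_nil.
rewrite (_ : (fun x => _) = fun x => f i x + \sum_(j <- s) f j x).
  exact: bmeasD.
by apply/funext => x; rewrite big_cons.
Qed.

Lemma bmeas_expR f : bmeas f -> bmeas (fun x => expR (f x)).
Proof.
move=> [mf [a fa]]; split; first exact: measurableT_comp.
exists (expR a) => x; rewrite ger0_norm ?expR_ge0// ler_expR.
by rewrite (le_trans _ (fa x))// ler_norm.
Qed.

End bounded_measurable.

Lemma bmeas_comp d1 d2 (T1 : measurableType d1) (T2 : measurableType d2)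
    (R : realType) (f : T2 -> R) (h : T1 -> T2) :
  measurable_fun [set: T1] h -> bmeas f -> bmeas (fun x => f (h x)).
Proof.
move=> mh [mf [a fa]]; split; last by exists a.
by apply: (measurableT_comp mf).
Qed.

Section bounded_integral.
Context d (T : measurableType d) (R : realType) (mu : {measure set T -> \bar R}).
Hypothesis mu1 : mu [set: T] = 1%E.
Implicit Types f g : T -> R.

Lemma bmeas_integrable f : bmeas f -> mu.-integrable [set: T] (EFin \o f).
Proof.
move=> [mf [a fa]]; apply: measurable_bounded_integrable => //.
  by rewrite mu1 ltry.
exists a; split; rewrite ?num_real// => b ab x _ /=.
by apply: le_trans (fa x) _; exact: ltW.
Qed.

Lemma integral_bmeas f : bmeas f ->
  (\int[mu]_x (f x)%:E = (\int[mu]_x f x)%R%:E)%E.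
Proof.
by move=> bf; rewrite /Rintegral fineK// integrable_fin_num//; exact: bmeas_integrable.
Qed.

Lemma bRintegralD f g : bmeas f -> bmeas g ->
  (\int[mu]_x (f x + g x) = \int[mu]_x f x + \int[mu]_x g x)%R.
Proof. by move=> bf bg; rewrite RintegralD//; exact: bmeas_integrable. Qed.

Lemma bRintegralB f g : bmeas f -> bmeas g ->
  (\int[mu]_x (f x - g x) = \int[mu]_x f x - \int[mu]_x g x)%R.
Proof. by move=> bf bg; rewrite RintegralB//; exact: bmeas_integrable. Qed.

Lemma bRintegralZ c f : bmeas f ->
  (\int[mu]_x (c * f x) = c * \int[mu]_x f x)%R.
Proof. by move=> bf; rewrite RintegralZl//; exact: bmeas_integrable. Qed.

Lemma bRintegral_cst c : (\int[mu]_x c = c)%R.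
Proof. by rewrite Rintegral_cst// mu1/= mulr1. Qed.

Lemma bRintegral_sum (I : Type) (s : seq I) (f : I -> T -> R) :
  (forall i, bmeas (f i)) ->
  (\int[mu]_x (\sum_(i <- s) f i x) = \sum_(i <- s) \int[mu]_x f i x)%R.
Proof.
move=> bf; elim: s => [|i s ih].
  by rewrite big_nil; under eq_Rintegral do rewrite big_nil; rewrite bRintegral_cst.
rewrite big_cons -ih -bRintegralD//; last exact: bmeas_sum.
by apply: eq_Rintegral => x _; rewrite big_cons.
Qed.

Lemma le_bRintegral f g : bmeas f -> bmeas g -> (forall x, f x <= g x) ->
  (\int[mu]_x f x <= \int[mu]_x g x)%R.
Proof. by move=> bf bg fg; apply: le_Rintegral => //; exact: bmeas_integrable. Qed.

Lemma bRintegral01 f : measurable_fun [set: T] f ->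
  (forall x, 0 <= f x <= 1) -> 0 <= (\int[mu]_x f x)%R <= 1.
Proof.
move=> mf f01; apply/andP; split.
  by apply: Rintegral_ge0 => x _; case/andP: (f01 x).
rewrite -[leRHS]bRintegral_cst; apply: le_bRintegral.
- exact: bmeas01.
- exact: bmeas_cst.
- by move=> x; case/andP: (f01 x).
Qed.

Lemma bRintegral_dist f g e : bmeas f -> bmeas g ->
  (forall x, `|f x - g x| <= e) ->
  `|(\int[mu]_x f x)%R - (\int[mu]_x g x)%R| <= e.
Proof.
move=> bf bg fg; have e1 := bRintegral_cst e.
rewrite ler_distl; apply/andP; split.
  rewrite lerBlDr -[in leRHS]e1 -bRintegralD//; last exact: bmeas_cst.
  apply: le_bRintegral => //; first exact: (bmeasD bf (bmeas_cst _ _)).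
  by move=> x; move: (fg x); rewrite ler_distlC => /andP[]; lra.
rewrite -[in leRHS]e1 -bRintegralD//; last exact: bmeas_cst.
apply: le_bRintegral => //; first exact: (bmeasD bg (bmeas_cst _ _)).
by move=> x; move: (fg x); rewrite ler_distl => /andP[]; lra.
Qed.

End bounded_integral.

(** * Integrals against kernels, and disintegration of a joint law *)

Section kernel_pullback.
Context d1 d2 d3 (Z : measurableType d1) (X : measurableType d2)
  (Y : measurableType d3) (R : realType) (k : R.-pker X ~> Y) (h : Z -> X).
Hypothesis mh : measurable_fun [set: Z] h.

(** The proof of measurability is an argument so that it is part of the term, where the kernel
    instances below recover it. *)
Definition kpull of measurable_fun [set: Z] h : Z -> {measure set Y -> \bar R} :=
  fun z => k (h z).

Let mkpull U : measurable U -> measurable_fun [set: Z] (kpull mh ^~ U).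
Proof. by move=> mU; apply: (measurableT_comp (measurable_kernel k U mU)). Qed.

HB.instance Definition _ := isKernel.Build _ _ _ _ _ (kpull mh) mkpull.

Let kpull1 z : kpull mh z [set: Y] = 1%E.
Proof. exact: prob_kernel. Qed.

HB.instance Definition _ := Kernel_isProbability.Build _ _ _ _ _ (kpull mh) kpull1.

Lemma measurable_integral_pull (l : Z * Y -> \bar R) :
  (forall t, 0 <= l t)%E -> measurable_fun [set: Z * Y] l ->
  measurable_fun [set: Z] (fun z => \int[k (h z)]_y l (z, y))%E.
Proof. exact: (measurable_fun_integral_finite_kernel l (kpull mh)). Qed.

End kernel_pullback.

Lemma measurable_Rintegral_pull d1 d2 d3 (Z : measurableType d1)
    (X : measurableType d2) (Y : measurableType d3) (R : realType)
    (k : R.-pker X ~> Y) (h : Z -> X) (l : Z * Y -> R) :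
  measurable_fun [set: Z] h -> measurable_fun [set: Z * Y] l ->
  (forall t, 0 <= l t) ->
  measurable_fun [set: Z] (fun z => (\int[k (h z)]_y l (z, y))%R).
Proof.
move=> mh ml l0; apply: (measurableT_comp (f := fine)) => //.
apply: (@measurable_integral_pull _ _ _ _ _ _ _ k h mh (EFin \o l)) => //.
exact/measurable_EFinP.
Qed.

(** Adding the bound of [l] reduces measurability to a nonnegative integrand; the shift subtracts
    out because the kernel has mass one. *)
Lemma bmeas_Rintegral_pull d1 d2 d3 (Z : measurableType d1)
    (X : measurableType d2) (Y : measurableType d3) (R : realType)
    (k : R.-pker X ~> Y) (h : Z -> X) (l : Z * Y -> R) :
  measurable_fun [set: Z] h -> bmeas l ->
  bmeas (fun z => (\int[k (h z)]_y l (z, y))%R).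
Proof.
move=> mh [ml [M lM]].
have bl z : bmeas (fun y => l (z, y)).
  split; last by exists M.
  exact: (measurableT_comp ml (pair1_measurable z)).
have M1 z := bRintegral_cst (@prob_kernel _ _ _ _ _ k (h z)).
split.
  rewrite (_ : (fun z => _) =
    fun z => (\int[k (h z)]_y (l (z, y) + M))%R - M); last first.
    apply/funext => z; rewrite bRintegralD ?prob_kernel//; last exact: bmeas_cst.
    by rewrite M1 addrK.
  apply: measurable_funB => //.
  apply: (@measurable_Rintegral_pull _ _ _ _ _ _ _ k h (fun t => l t + M)) => //.
    exact: measurable_funD.
  by move=> t; have := lM t; rewrite ler_norml => /andP[]; lra.
exists M => z; rewrite -[X in `|X|]subr0 -[X in _ - X](M1 z 0).
apply: bRintegral_dist; rewrite ?prob_kernel//; first exact: bmeas_cst.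
by move=> y; rewrite subr0.
Qed.

Lemma bmeas_Rintegral_snd d1 d2 (Z : measurableType d1) (Y : measurableType d2)
    (R : realType) (mu : probability Y R) (l : Z * Y -> R) :
  bmeas l -> bmeas (fun z => (\int[mu]_y l (z, y))%R).
Proof.
move=> bl.
pose k : R.-pker unit ~> Y := kprobability (measurable_cst (mu : pprobability Y R)).
exact: (@bmeas_Rintegral_pull _ _ _ Z unit Y R k (cst tt) l).
Qed.

Section disintegration.
Context d1 d2 (T1 : measurableType d1) (T2 : measurableType d2) (R : realType)
  (k : R.-pker T1 ~> T2).

(** The law of the pair (x, y) with y drawn from [k x]. The [unit] factor gives the source that
    [kcomp] expects after a kernel out of [unit]. *)
Definition kgraph (x : unit * T1) : {measure set (T1 * T2) -> \bar R} :=
  measure_function_pushforward__canonical__measure_function_Measure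
    (k x.2) (pair1_measurable x.2).

Let mkgraph U : measurable U -> measurable_fun [set: unit * T1] (kgraph ^~ U).
Proof.
move=> mU; rewrite (_ : (fun x => _) = (fun x => k x (xsection U x)) \o snd).
  apply: measurableT_comp => //.
  by apply: measurable_fun_xsection_finite_kernel; rewrite inE.
apply/funext => x; rewrite /kgraph /pushforward/=; congr (k _ _).
by apply/seteqP; split=> y /=; rewrite /xsection/= inE.
Qed.

HB.instance Definition _ := isKernel.Build _ _ _ _ _ kgraph mkgraph.

Let kgraph1 x : kgraph x [set: T1 * T2] = 1%E.
Proof. exact: prob_kernel. Qed.

HB.instance Definition _ := Kernel_isProbability.Build _ _ _ _ _ kgraph kgraph1.

(** [nu] and the composition of [mu] with [kgraph] agree on rectangles, which generate the product
    sigma-algebra and are closed under intersection, so they are equal. The iterated integral is the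
    integral against that composition. *)
Lemma integral_disintegration (mu : probability T1 R)
    (nu : {measure set (T1 * T2) -> \bar R}) :
  (forall B B', measurable B -> measurable B' ->
     nu (B `*` B') = (\int[mu]_(x in B) k x B')%E) ->
  forall psi : T1 * T2 -> \bar R, (forall z, 0 <= psi z)%E ->
  measurable_fun [set: T1 * T2] psi ->
  (\int[nu]_z psi z = \int[mu]_x \int[k x]_y psi (x, y))%E.
Proof.
move=> nuE psi psi0 mpsi.
pose l : R.-pker unit ~> T1 := kprobability (measurable_cst (mu : pprobability T1 R)).
transitivity (\int[kcomp l kgraph tt]_z psi z)%E; last first.
  rewrite (integral_kcomp l kgraph) //; apply: eq_integral => x _.
  rewrite /kgraph ge0_integral_pushforward//.
apply: eq_measure_integral => U mU _.
apply: (measure_unique [set A `*` B | A in measurable & B in measurable]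
         (fun=> setT)) => //.
- by rewrite -measurable_prod_measurableType.
- move=> _ _ [A1 mA1 [B1 mB1 <-]] [A2 mA2 [B2 mB2 <-]].
  exists (A1 `&` A2); first exact: measurableI.
  by exists (B1 `&` B2); [exact: measurableI|rewrite setXI].
- by move=> i; exists setT => //; exists setT => //; rewrite setXTT.
- exact: bigcup_const.
- move=> _ [A mA [B mB <-]]; rewrite nuE//= /kcomp [LHS]integral_mkcond.
  apply: (@eq_integral _ _ _ mu) => x _; rewrite /kgraph /pushforward patchE.
  case: ifPn => xA.
    by congr (k x _); apply/seteqP; split=> y //=; [split => //; rewrite inE in xA|case].
  rewrite -[LHS](measure0 (k x)); congr (k x _).
  apply/seteqP; split=> y //= -[/= xA'].
  by rewrite notin_setE in xA.
- move=> _; rewrite -setXTT nuE// (eq_integral (cst 1%E)).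
    by rewrite integral_cst// mul1e (le_lt_trans (probability_le1 mu _)) ?ltry.
  by move=> x _; rewrite prob_kernel.
Qed.

End disintegration.

#[local] Hint Extern 0 (_ [set: _] = 1%E) => exact: prob_kernel : core.
#[local] Hint Extern 0 (_ [set: _] = 1%E) => exact: probability_setT : core.

(** * Independence from a sigma-algebra, and exponential inequalities *)

Section sub_sigma_algebra_independence.
Context d d1 (Om : measurableType d) (T : measurableType d1) (R : realType)
  (Pr : probability Om R) (mu : probability T R) (X : {mfun Om >-> T})
  (G : set (set Om)).
Hypotheses (Gm : G `<=` measurable) (GI : setI_closed G) (GT : G [set: Om]).
Hypothesis indep : forall U B, measurable U -> G B ->
  Pr (B `&` X @^-1` U) = (mu U * Pr B)%E.

Let Om' := g_sigma_algebraType G.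

(** For fixed [U] both sides are finite measures in [B] that agree on the intersection-stable family
    [G], hence on the sigma-algebra it generates. *)
Let indep_sigma U (B : set Om) : measurable U -> <<s G >> B ->
  Pr (B `&` X @^-1` U) = (mu U * Pr B)%E.
Proof.
move=> mU GB.
have mXU : measurable (X @^-1` U) by rewrite -[X in measurable X]setTI; exact: measurable_funP.
have mu0 : 0 <= fine (mu U) by rewrite fine_ge0.
have muE : mu U = (fine (mu U))%:E by rewrite fineK// fin_num_measure.
rewrite muE.
have cT : \bigcup_(k : nat) [set: Om] = [set: Om] by exact: bigcup_const.
apply: (@g_sigma_algebra_measure_unique _ _ _ G Gm _ (fun=> GT) cT
  (mrestr Pr mXU) (mscale (NngNum mu0) Pr) GI) => //.
- by move=> A GA; rewrite -[RHS]/(_ * Pr A)%E /= -muE; exact: indep.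
- move=> _; rewrite /mrestr/= (le_lt_trans (probability_le1 Pr _)) ?ltry//.
  by rewrite setTI.
Qed.

(** The identity onto the coarser measurable space, bundled as a measurable function so that its law
    is the restriction of [Pr] to the generated sigma-algebra. *)
Let idm : Om -> Om' := id.

Let midm : measurable_fun [set: Om] idm.
Proof.
move=> _ B mB; rewrite setTI.
exact: (smallest_sub (@sigma_algebra_measurable _ Om) Gm).
Qed.

HB.instance Definition _ := isMeasurableFun.Build _ _ _ _ idm midm.

(** The joint law of [idm] and [X] is a product measure, that is, it disintegrates along the
    constant kernel [mu]. Whatever is measurable for the sigma-algebra of [G] can thus be frozen
    while [X] is averaged. *)
Lemma integral_indep (psi : g_sigma_algebraType G * T -> \bar R) :
  (forall z, 0 <= psi z)%E ->
  measurable_fun [set: g_sigma_algebraType G * T] psi ->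
  (\int[Pr]_w psi (w, X w) = \int[Pr]_w \int[mu]_x psi (w, x))%E.
Proof.
move=> psi0 mpsi.
pose P' : probability Om' R := distribution Pr idm.
pose k : R.-pker Om' ~> T := kprobability (measurable_cst (mu : pprobability T R)).
pose J w : Om' * T := (idm w, X w).
have mJ : measurable_fun [set: Om] J by exact: measurable_fun_pair.
pose nu := measure_function_pushforward__canonical__measure_function_Measure Pr mJ.
transitivity (\int[nu]_z psi z)%E; first by rewrite ge0_integral_pushforward.
rewrite (@integral_disintegration _ _ _ _ _ k P')//.
  rewrite ge0_integral_distribution//.
    exact: (measurable_fun_integral_finite_kernel psi k).
  by move=> w; exact: integral_ge0.
move=> B U mB mU; rewrite /nu/= /pushforward.
transitivity (Pr (B `&` X @^-1` U)); first by congr (Pr _).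
rewrite indep_sigma//.
rewrite (eq_integral (cst (mu U))) ?integral_cst//.
Qed.

End sub_sigma_algebra_independence.

(** Compare after multiplication by 1 - u > 0: the left side becomes at most 1 because 1 - u <= expR
    (- u), and the right side becomes 1 + u^2 (1 - 2 u) >= 1. *)
Lemma expR_le_quadratic (R : realType) (u : R) : `|u| <= 1 / 2 ->
  expR u <= 1 + u + 2 * u ^+ 2.
Proof.
rewrite ler_norml => /andP[u1 u2].
have e0 := expR_gt0 u.
have e1 : expR u * (1 - u) <= 1.
  rewrite -[leRHS](expRxMexpNx_1 u) ler_pM2l//.
  by have := expR_ge1Dx (- u); lra.
have : 1 <= (1 + u + 2 * u ^+ 2) * (1 - u).
  rewrite (_ : _ * _ = 1 + u ^+ 2 * (1 - 2 * u)); last by ring.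
  by rewrite lerDl mulr_ge0 ?sqr_ge0//; lra.
move=> /(le_trans e1); rewrite ler_pM2r//; lra.
Qed.

(** Jensen's inequality, by averaging the tangent line of the exponential at the mean [b]. *)
Lemma expR_mean_le (R : realType) (m : nat) (a : 'I_m -> R) : (0 < m)%N ->
  expR (m%:R^-1 * \sum_(j < m) a j) <= m%:R^-1 * \sum_(j < m) expR (a j).
Proof.
move=> m0; set b := m%:R^-1 * \sum_(j < m) a j.
have m0' : (m%:R : R) != 0 by rewrite pnatr_eq0 -lt0n.
have sb : \sum_(j < m) a j = m%:R * b by rewrite /b mulrA divff// mul1r.
have tangent j : expR b * (1 + (a j - b)) <= expR (a j).
  rewrite [in leRHS](_ : a j = b + (a j - b)); last by rewrite addrC subrK.
  rewrite expRD ler_pM2l ?expR_gt0//.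
  exact: expR_ge1Dx.
rewrite ler_pdivlMl ?ltr0n//.
apply: le_trans (ler_sum _ (fun j _ => tangent j)).
rewrite -mulr_sumr big_split/= sumrB sb !sumr_const card_ord.
by rewrite -[b *+ m]mulr_natl subrr addr0 mulrC.
Qed.

(** * Concentration of the average over all pairs of two independent samples *)

Section two_samples.
Context d d1 d2 (Om : measurableType d) (T : measurableType d1)
  (U : measurableType d2) (R : realType) (Pr : probability Om R)
  (mu : probability T R) (nu : probability U R) (n m : nat)
  (X : 'I_n -> {mfun Om >-> T}) (Y : 'I_m -> {mfun Om >-> U}).
Hypothesis XY_indep : forall (A : 'I_n -> set T) (B : 'I_m -> set U),
  (forall i, measurable (A i)) -> (forall j, measurable (B j)) ->
  Pr ((\bigcap_(i in [set: 'I_n]) (X i @^-1` A i)) `&`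
      (\bigcap_(j in [set: 'I_m]) (Y j @^-1` B j))) =
  ((\prod_(i < n) mu (A i)) * (\prod_(j < m) nu (B j)))%E.

Let box (A : 'I_n -> set T) (B : 'I_m -> set U) : set Om :=
  (\bigcap_(i in [set: 'I_n]) (X i @^-1` A i)) `&`
  (\bigcap_(j in [set: 'I_m]) (Y j @^-1` B j)).

(* They generate a sigma-algebra that is independent of [X k] and for which all
   the other samples are measurable. *)
Definition other_boxes (k : 'I_n) : set (set Om) :=
  [set D | exists (A : 'I_n -> set T) (B : 'I_m -> set U),
    [/\ forall i, measurable (A i), forall j, measurable (B j), A k = setT &
        D = box A B]].

Let mpreX i A : measurable A -> measurable (X i @^-1` A).
Proof. by move=> mA; rewrite -[X in measurable X]setTI; exact: measurable_funP. Qed.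

Let mpreY j A : measurable A -> measurable (Y j @^-1` A).
Proof. by move=> mA; rewrite -[X in measurable X]setTI; exact: measurable_funP. Qed.

Let other_boxes_measurable k : other_boxes k `<=` measurable.
Proof.
move=> _ [A [B [mA mB _ ->]]]; apply: measurableI.
  by apply: fin_bigcap_measurable => // i _; exact: mpreX.
by apply: fin_bigcap_measurable => // i _; exact: mpreY.
Qed.

Let other_boxesI k : setI_closed (other_boxes k).
Proof.
move=> _ _ [A [B [mA mB Ak ->]]] [A' [B' [mA' mB' Ak' ->]]].
exists (fun i => A i `&` A' i), (fun j => B j `&` B' j); split.
- by move=> i; exact: measurableI.
- by move=> j; exact: measurableI.
- by rewrite Ak Ak' setTI.
- apply/seteqP; split => w /=.
    by move=> [[a b] [a' b']]; split=> i _; (split; [exact: a|exact: a'] || (split; [exact: b|exact: b'])).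
  move=> [a b]; split; split => i _.
  - by have [] := a i I.
  - by have [] := b i I.
  - by have [] := a i I.
  - by have [] := b i I.
Qed.

Let other_boxesT k : other_boxes k setT.
Proof.
exists (fun=> setT), (fun=> setT); split => //.
by apply/seteqP; split.
Qed.

Let other_boxes_indep k W D : measurable W -> other_boxes k D ->
  Pr (D `&` X k @^-1` W) = (mu W * Pr D)%E.
Proof.
move=> mW [A [B [mA mB Ak ->]]].
pose A' i := if i == k then W else A i.
have mA' i : measurable (A' i) by rewrite /A'; case: ifP.
rewrite (_ : _ `&` _ = box A' B); last first.
  apply/seteqP; split => w /=.
    move=> [[a b] Xw]; split => // i _; rewrite /A' /preimage/=.
    by case: eqP => [->|_] //; exact: a.
  move=> [a b]; split; last by have := a k I; rewrite /A' /preimage/= eqxx.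
  split => // i _; have := a i I; rewrite /A' /preimage/=.
  by case: eqP => [->|//]; rewrite Ak.
rewrite /box !XY_indep// muleA; congr (_ * _)%E.
rewrite (bigD1 k)//= [in RHS](bigD1 k)//= Ak probability_setT mul1e /A' eqxx.
by congr (_ * _)%E; apply: eq_bigr => i /negPf ->.
Qed.

Let Xother k i : i != k ->
  measurable_fun [set: g_sigma_algebraType (other_boxes k)] (X i).
Proof.
move=> ik _ A mA; rewrite setTI; apply: sub_sigma_algebra.
exists (fun i' => if i' == i then A else setT), (fun=> setT); split => //.
- by move=> i'; case: ifP.
- by rewrite eq_sym (negPf ik).
- apply/seteqP; split => w /=.
    by move=> Aw; split => // i' _; rewrite /preimage/=; case: eqP => [->|].
  by move=> [a _]; have := a i I; rewrite /preimage/= eqxx.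
Qed.

Let Yother k j : measurable_fun [set: g_sigma_algebraType (other_boxes k)] (Y j).
Proof.
move=> _ B mB; rewrite setTI; apply: sub_sigma_algebra.
exists (fun=> setT), (fun j' => if j' == j then B else setT); split => //.
- by move=> i'; case: ifP.
- apply/seteqP; split => w /=.
    by move=> Aw; split => // i' _; rewrite /preimage/=; case: eqP => [->|].
  by move=> [_ a]; have := a j I; rewrite /preimage/= eqxx.
Qed.

Section exponential_moment.
Variable e : T * U -> R.
Hypotheses (be : bmeas e) (e0 : forall z, 0 <= e z).
Hypothesis e1 : forall y, (\int[mu]_x e (x, y))%R <= 1.

Let phi x w := m%:R^-1 * \sum_(j < m) e (x, Y j w).

Let phi0 x w : 0 <= phi x w.
Proof. by rewrite mulr_ge0 ?invr_ge0// sumr_ge0. Qed.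

Let be_l y : bmeas (fun x => e (x, y)).
Proof. by apply: (bmeas_comp (f := e)) be; exact: pair2_measurable. Qed.

Let bphiw w : bmeas (phi^~ w).
Proof. by apply: bmeasZ; apply: bmeas_sum => j; exact: be_l. Qed.

Let bphi k : bmeas (fun z : g_sigma_algebraType (other_boxes k) * T => phi z.2 z.1).
Proof.
apply: bmeasZ; apply: bmeas_sum => j; apply: (bmeas_comp (f := e)) be.
apply: measurable_fun_pair => //.
exact: (measurableT_comp (@Yother k j) measurable_fst).
Qed.

(** The factors share the sample [Y] and are not independent. Peeling off [X k] still works: the
    remaining product is measurable for the boxes that leave [X k] free, so [X k] can be integrated
    alone, and the mean of [phi] is at most 1 whatever the values of [Y]. *)
Lemma prod_moment_le1 (s : seq 'I_n) : uniq s ->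
  (\int[Pr]_w (\prod_(i <- s) phi (X i w) w)%:E <= 1)%E.
Proof.
elim: s => [_|k s ih /= /andP[ks us]].
  rewrite (eq_integral (cst 1%E)); last by move=> w _; rewrite big_nil.
  by rewrite integral_cst// mul1e probability_le1.
have PrH := ih us.
pose H w := \prod_(i <- s) phi (X i w) w.
have H0 w : 0 <= H w by apply: prodr_ge0.
(* Measurability for the coarser sigma-algebra, which holds because [k] does not occur in [s]. *)
have bH : bmeas (H : g_sigma_algebraType (other_boxes k) -> R).
  rewrite /H; elim: s ks {ih us PrH H H0} => [_|i s ih /=].
    rewrite (_ : (fun w => _) = cst 1); first exact: bmeas_cst.
    by apply/funext => w; rewrite big_nil.
  rewrite inE negb_or eq_sym => /andP[ik ks].
  rewrite (_ : (fun w => _) = fun w => phi (X i w) w * \prod_(i <- s) phi (X i w) w).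
    apply: bmeasM; last exact: ih.
    apply: (@bmeas_comp _ _ (g_sigma_algebraType (other_boxes k))
      (g_sigma_algebraType (other_boxes k) * T)%type R
      (fun z => phi z.2 z.1) (fun w => (w, X i w))); last exact: bphi.
    by apply: measurable_fun_pair => //; exact: Xother.
  by apply/funext => w; rewrite big_cons.
pose psi (z : g_sigma_algebraType (other_boxes k) * T) := (phi z.2 z.1 * H z.1)%:E.
have bpsi : bmeas (fun z : g_sigma_algebraType (other_boxes k) * T =>
    phi z.2 z.1 * H z.1).
  apply: bmeasM; first exact: bphi.
  by apply: (@bmeas_comp _ _ (g_sigma_algebraType (other_boxes k) * T)%type
      (g_sigma_algebraType (other_boxes k)) R H fst).
rewrite (eq_integral (fun w => psi (w, X k w))); last first.
  by move=> w _; rewrite big_cons.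
rewrite (@integral_indep _ _ _ _ _ Pr mu (X k) (other_boxes k))//; first last.
- by apply/measurable_EFinP; case: bpsi.
- by move=> z; rewrite lee_fin mulr_ge0.
- exact: other_boxes_indep.
apply: le_trans PrH.
apply: ge0_le_integral => //.
- by move=> w _; apply: integral_ge0 => x _; rewrite lee_fin mulr_ge0.
- have [] := bmeas_Rintegral_snd mu bpsi.
  move=> mI _.
  rewrite (_ : (fun w => _) = fun w => (\int[mu]_x (phi x w * H w))%R%:E).
    apply/measurable_EFinP.
    move=> _ A mA; rewrite setTI.
    apply: (smallest_sub (@sigma_algebra_measurable _ Om) (@other_boxes_measurable k)).
    by rewrite -[X in <<s _ >> X]setTI; exact: mI.
  apply/funext => w; rewrite /psi/= integral_bmeas//.
  exact: bmeasM (bphiw w) (bmeas_cst _ (H w)).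
- apply/measurable_EFinP; case: bH => mH _.
  move=> _ A mA; rewrite setTI.
  apply: (smallest_sub (@sigma_algebra_measurable _ Om) (@other_boxes_measurable k)).
  by rewrite -[X in <<s _ >> X]setTI; exact: mH.
- move=> w _; rewrite /psi/= integral_bmeas//; last first.
    exact: bmeasM (bphiw w) (bmeas_cst _ (H w)).
  rewrite lee_fin; under eq_Rintegral do rewrite mulrC.
  rewrite bRintegralZ// ler_piMr//.
  rewrite bRintegralZ//; last first.
    by apply: bmeas_sum => j; exact: be_l.
  suff h : (\int[mu]_x \sum_(j < m) e (x, Y j w))%R <= m%:R.
    have [m0|m0] := posnP m; first by rewrite [X in X%:R^-1]m0 invr0 mul0r.
    by rewrite ler_pdivrMl ?mulr1// ltr0n.
  rewrite bRintegral_sum//; apply: (@le_trans _ _ (\sum_(j < m) 1)).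
    by apply: ler_sum => j _.
  by rewrite sumr_const card_ord.
Qed.

End exponential_moment.

(* Chernoff bound with parameter 1/36: the variance condition makes the moment
   of [exp ((E w / 2 - w) / 36)] at most 1. *)
Lemma two_sample_tail (w : T * U -> R) (L : R) :
  (0 < n)%N -> (0 < m)%N ->
  measurable_fun [set: T * U] w -> (forall z, `|w z| <= 3) ->
  (forall y, (\int[mu]_x (w (x, y) ^+ 2))%R <= 9 * (\int[mu]_x w (x, y))%R) ->
  exists2 D : set Om, measurable D /\ (Pr D <= (expR (- L))%:E)%E &
    forall om, ~ D om ->
      m%:R^-1 * \sum_(j < m) ((\int[mu]_x w (x, Y j om))%R / 2) - 36 * L / n%:R <=
      (n * m)%:R^-1 * \sum_(i < n) \sum_(j < m) w (X i om, Y j om).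
Proof.
move=> n0 m0 mw w3 wvar.
have bw : bmeas w by split => //; exists 3.
pose wb y := (\int[mu]_x w (x, y))%R.
pose w' (z : U * T) := w (z.2, z.1).
have bw' : bmeas w'.
  by apply: (bmeas_comp (f := w)) bw; exact: measurable_fun_pair.
have bwb : bmeas wb by exact: (bmeas_Rintegral_snd mu bw').
pose e (z : T * U) := expR (36^-1 * (wb z.2 / 2 - w z)).
have be : bmeas e.
  apply: bmeas_expR; apply: bmeasZ; apply: bmeasB => //.
  under eq_fun do rewrite mulrC; apply: bmeasZ.
  exact: (bmeas_comp (f := wb)).
have e0 z : 0 <= e z by exact: expR_ge0.
have bwy y : bmeas (fun x => w (x, y)).
  by apply: (bmeas_comp (f := w)) bw; exact: pair2_measurable.
have e1 y : (\int[mu]_x e (x, y))%R <= 1.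
  (* Since |w| / 36 <= 1 / 12, the quadratic bound applies; with the variance hypothesis it bounds
     the mean of expR (- w / 36) by 1 - wb / 36 + 9 * 2 / 36^2 * wb = 1 - wb / 72, which is at most
     expR (- wb / 72), the inverse of [c]. *)
  pose c := expR (wb y / 72).
  have bq : bmeas (fun x => 1 - 36^-1 * w (x, y) + (2 / 36 ^+ 2) * w (x, y) ^+ 2).
    apply: bmeasD; last by apply: bmeasZ; exact: bmeasX.
    by apply: bmeasB; [exact: bmeas_cst|exact: bmeasZ].
  apply: (@le_trans _ _ (\int[mu]_x (c * (1 - 36^-1 * w (x, y) +
      (2 / 36 ^+ 2) * w (x, y) ^+ 2)))%R).
    apply: le_bRintegral => //.
    - by apply: (bmeas_comp (f := e)) be; exact: pair2_measurable.
    - exact: bmeasZ.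
    move=> x; rewrite /e/= (_ : 36^-1 * _ = wb y / 72 + (- (36^-1 * w (x, y)))); last by field.
    rewrite expRD ler_pM2l ?expR_gt0//.
    apply: le_trans (expR_le_quadratic _) _; last by lra.
    by have := w3 (x, y); rewrite !ler_norml => /andP[]; lra.
  rewrite bRintegralZ// bRintegralD//; last 2 first.
    by apply: bmeasB; [exact: bmeas_cst|exact: bmeasZ].
    by apply: bmeasZ; exact: bmeasX.
  rewrite bRintegralB//; [|exact: bmeas_cst|exact: bmeasZ].
  rewrite bRintegral_cst// !bRintegralZ//; last exact: bmeasX.
  rewrite -[leRHS](expRxMexpNx_1 (wb y / 72)) ler_pM2l ?expR_gt0//.
  apply: le_trans (expR_ge1Dx _).
  by have := wvar y; rewrite -/(wb y); lra.
pose P om := \prod_(i < n) (m%:R^-1 * \sum_(j < m) e (X i om, Y j om)).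
have P0 om : 0 <= P om.
  by apply: prodr_ge0 => i _; rewrite mulr_ge0 ?invr_ge0// sumr_ge0.
have bP : bmeas P.
  rewrite /P; elim: (index_enum _) => [|i s ih].
    rewrite (_ : (fun om => _) = cst 1); first exact: bmeas_cst.
    by apply/funext => om; rewrite big_nil.
  under eq_fun do rewrite big_cons.
  apply: bmeasM => //; apply: bmeasZ; apply: bmeas_sum => j.
  apply: (bmeas_comp (f := e)) be; apply: measurable_fun_pair; exact: measurable_funP.
have intP : (\int[Pr]_om (P om)%:E <= 1)%E.
  have := prod_moment_le1 be e0 e1 (enum_uniq 'I_n).
  by under eq_integral do rewrite big_enum.
(* Markov's inequality: [P] has mean at most 1. *)
pose D := [set om | expR L <= P om].
exists D.
  have mD : measurable D.
    rewrite -[X in measurable X]setTI; case: bP => mP _.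
    by rewrite /D -preimage_itvcy; exact: mP.
  split => //.
  have DE : ((expR L)%:E * Pr D <= 1)%E.
    apply: le_trans intP.
    rewrite -[X in Pr X]setIT -integral_indic//.
    rewrite -ge0_integralZl//; last exact/measurable_EFinP/measurable_indicP.
    apply: ge0_le_integral => //.
    - by apply: measurable_funeM; exact/measurable_EFinP/measurable_indicP.
    - by apply/measurable_EFinP; case: bP.
    - move=> om _; rewrite -EFinM lee_fin indicE.
      case: (boolP (om \in D)) => [|_]; last by rewrite mulr0.
      by rewrite mulr1 inE.
  move: DE; rewrite -(fineK (fin_num_measure Pr _ mD)) -EFinM !lee_fin => DE.
  by rewrite expRN -(ler_pM2l (expR_gt0 L)) divff// gt_eqF// expR_gt0.
move=> om /negP; rewrite -ltNge => PL.
have nm : (n * m)%:R^-1 = n%:R^-1 * m%:R^-1 :> R by rewrite natrM invfM.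
have n0' : (0 : R) < n%:R by rewrite ltr0n.
have m0' : (0 : R) < m%:R by rewrite ltr0n.
(* The exponents averaged over the second sample. Jensen compares their exponential with the factor
   of [P], so off [D] their sum stays below [L]. *)
pose a i := m%:R^-1 * \sum_(j < m) (36^-1 * (wb (Y j om) / 2 - w (X i om, Y j om))).
have aP : expR (\sum_(i < n) a i) <= P om.
  rewrite expR_sum; apply: ler_prod => i _; rewrite expR_ge0/=.
  exact: expR_mean_le.
have {aP} : \sum_(i < n) a i < L.
  by rewrite -ltr_expR; exact: le_lt_trans aP PL.
rewrite /a -mulr_sumr.
under eq_bigr do rewrite -mulr_sumr sumrB.
rewrite -mulr_sumr sumrB sumr_const card_ord nm.
set A := \sum_(j < m) _; set B := \sum_(i < n) _.
rewrite -[A *+ n]mulr_natl => h.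
rewrite lerBlDr -(ler_pM2l n0') mulrDr.
rewrite [36 * _ / _]mulrC !mulrA divff ?gt_eqF// !mul1r.
by move: h; set v := m%:R^-1; set u := n%:R => h; lra.
Qed.

End two_samples.

(** * Trajectories, stopping at the goal, and discounted occupancy *)

Section state_action_mean.
Context (R : realType) dX dA (X : measurableType dX) (A : measurableType dA)
  (pi : R.-pker X ~> A).
Local Open Scope ereal_scope.
Implicit Types (phi psi : X * A -> \bar R).

(** Nonnegative instead of bounded, so that discounted series can be exchanged with integrals
    without any finiteness. *)
Definition nnmeas phi : Prop :=
  measurable_fun [set: X * A] phi /\ forall z, 0 <= phi z.

Lemma nnmeasD phi psi : nnmeas phi -> nnmeas psi -> nnmeas (phi \+ psi).
Proof.
move=> [mp p0] [mq q0]; split; first exact: emeasurable_funD.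
by move=> z; exact: adde_ge0.
Qed.

Lemma nnmeasZ (r : R) phi : (0 <= r)%R -> nnmeas phi ->
  nnmeas (fun z => r%:E * phi z).
Proof.
move=> r0 [mp p0]; split; first exact: measurable_funeM.
by move=> z; exact: mule_ge0.
Qed.

Lemma nnmeas_cst (r : R) : (0 <= r)%R -> nnmeas (cst r%:E).
Proof. by move=> r0; split; [exact: measurable_cst|move=> z; rewrite lee_fin]. Qed.

Lemma nnmeas_series (f : nat -> X * A -> \bar R) : (forall t, nnmeas (f t)) ->
  nnmeas (fun z => \sum_(t <oo) f t z).
Proof.
move=> nf; split; last by move=> z; apply: nneseries_ge0 => t _ _; exact: (nf t).2.
apply: (@ge0_emeasurable_sum _ _ _ _ f xpredT).
  by move=> t z _ _; exact: (nf t).2.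
by move=> t _; exact: (nf t).1.
Qed.

Definition act_mean phi (x : X) : \bar R := \int[pi x]_a phi (x, a).

Lemma measurable_act_mean phi : nnmeas phi -> measurable_fun [set: X] (act_mean phi).
Proof. by move=> [mp p0]; exact: (@measurable_integral_pull _ _ _ X X A R pi id). Qed.

Lemma act_mean_ge0 phi x : nnmeas phi -> 0 <= act_mean phi x.
Proof. by move=> [mp p0]; exact: integral_ge0. Qed.

Let mslice phi x : nnmeas phi -> measurable_fun [set: A] (fun a => phi (x, a)).
Proof. by move=> [mp p0]; exact: (measurableT_comp mp (pair1_measurable x)). Qed.

Variable nu : {measure set X -> \bar R}.

Definition xa_mean phi : \bar R := \int[nu]_x act_mean phi x.

Lemma xa_mean_ge0 phi : nnmeas phi -> 0 <= xa_mean phi.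
Proof. by move=> np; apply: integral_ge0 => x _; exact: act_mean_ge0. Qed.

Lemma le_xa_mean phi psi : nnmeas phi -> nnmeas psi -> (forall z, phi z <= psi z) ->
  xa_mean phi <= xa_mean psi.
Proof.
move=> np nq pq; apply: ge0_le_integral => //.
- by move=> x _; exact: act_mean_ge0.
- exact: measurable_act_mean.
- exact: measurable_act_mean.
- move=> x _; apply: ge0_le_integral => //.
  + by move=> a _; exact: np.2.
  + exact: mslice.
  + exact: mslice.
Qed.

Lemma xa_meanD phi psi : nnmeas phi -> nnmeas psi ->
  xa_mean (phi \+ psi) = xa_mean phi + xa_mean psi.
Proof.
move=> np nq; rewrite -ge0_integralD//; last 4 first.
- by move=> x _; exact: act_mean_ge0.
- exact: measurable_act_mean.
- by move=> x _; exact: act_mean_ge0.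
- exact: measurable_act_mean.
apply: eq_integral => x _; rewrite /act_mean ge0_integralD//.
- by move=> a _; exact: np.2.
- exact: mslice.
- by move=> a _; exact: nq.2.
- exact: mslice.
Qed.

Lemma xa_meanZ (r : R) phi : (0 <= r)%R -> nnmeas phi ->
  xa_mean (fun z => r%:E * phi z) = r%:E * xa_mean phi.
Proof.
move=> r0 np; rewrite -ge0_integralZl//; last 2 first.
- exact: measurable_act_mean.
- by move=> x _; exact: act_mean_ge0.
apply: eq_integral => x _; rewrite /act_mean ge0_integralZl//.
- exact: mslice.
- by move=> a _; exact: np.2.
Qed.

Lemma xa_mean_cst (r : R) : nu [set: X] = 1 -> xa_mean (cst r%:E) = r%:E.
Proof.
move=> nu1; rewrite /xa_mean (eq_integral (cst r%:E)).
  by rewrite integral_cst// nu1 mule1.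
by move=> x _; rewrite /act_mean integral_cst// prob_kernel mule1.
Qed.

Lemma xa_mean_series (f : nat -> X * A -> \bar R) : (forall t, nnmeas (f t)) ->
  xa_mean (fun z => \sum_(t <oo) f t z) = \sum_(t <oo) xa_mean (f t).
Proof.
move=> nf; rewrite /xa_mean -integral_nneseries//; last 2 first.
- by move=> t; exact: measurable_act_mean.
- by move=> t x _; exact: act_mean_ge0.
apply: eq_integral => x _; rewrite /act_mean integral_nneseries//.
- by move=> t; exact: mslice.
- by move=> t a _; exact: (nf t).2.
Qed.

End state_action_mean.

Section trajectories.
Context (R : realType) (dS dA dC : measure_display) (S : measurableType dS)
  (A : measurableType dA) (C : measurableType dC).
Let X : measurableType _ := (S * C)%type.
Context (M : cgo R S A C) (gamma : R) (gamma01 : 0 <= gamma < 1)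
  (pi : R.-pker (S * C) ~> A).
Local Open Scope ereal_scope.
Implicit Types (phi psi : X * A -> \bar R).

Lemma measurable_goal_set : measurable (goal M).
Proof. exact: measurable_goal. Qed.

Lemma measurable_in_goal :
  measurable_fun [set: X * A] (fun z => z.1 \in goal M).
Proof.
apply: (@measurable_fun_bool _ _ _ _ true); rewrite setTI.
rewrite (_ : _ @^-1` _ = fst @^-1` goal M); last first.
  apply/seteqP; split => z /=; first by move/eqP; rewrite eqb_id inE.
  by move=> h; apply/eqP; rewrite eqb_id inE.
by rewrite -[X in measurable X]setTI; exact: measurable_fst measurable_goal_set.
Qed.

Let mpair2 (c : C) : measurable_fun [set: S] (pair^~ c).
Proof. exact: pair2_measurable. Qed.

(** The kernel P_0 behind [bellman]: the context is kept and the goal is not absorbing. Stopping is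
    imposed separately, in [until_goal]. *)
Definition next_law (z : X * A) : {measure set X -> \bar R} :=
  measure_function_pushforward__canonical__measure_function_Measure
    (trans M (z.1.1, z.2)) (mpair2 z.1.2).

Definition next_mean phi z := xa_mean pi (next_law z) phi.

Lemma next_meanE phi z : nnmeas phi ->
  next_mean phi z =
  \int[trans M (z.1.1, z.2)]_s' \int[pi (s', z.1.2)]_a phi ((s', z.1.2), a).
Proof.
move=> np; rewrite /next_mean /xa_mean /next_law ge0_integral_pushforward//.
  exact: measurable_act_mean.
by move=> x _; exact: act_mean_ge0.
Qed.

Lemma nnmeas_next_mean phi : nnmeas phi -> nnmeas (next_mean phi).
Proof.
move=> np; split; last by move=> z; exact: xa_mean_ge0.
rewrite (funext (fun z => next_meanE z np)).
apply: (@measurable_integral_pull _ _ _ (X * A)%type (S * A)%type S R (trans M)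
  (fun z => (z.1.1, z.2)) _ (fun t => act_mean pi phi (t.2, t.1.1.2))) => //.
- apply: measurable_fun_pair => //.
  by apply: (measurableT_comp measurable_fst).
- by move=> t; exact: act_mean_ge0.
- apply: (measurableT_comp (measurable_act_mean pi np)).
  apply: measurable_fun_pair => //.
  apply: (measurableT_comp measurable_snd).
  by apply: (measurableT_comp measurable_fst).
Qed.

(** The mean of [phi] at time [t] over the trajectories that avoid the goal strictly before [t]; the
    state at time [t] itself is unrestricted. *)
Fixpoint until_goal phi (t : nat) : X * A -> \bar R :=
  if t is t'.+1 then
    fun z => if z.1 \in goal M then 0 else next_mean (until_goal phi t') z
  else phi.

Lemma nnmeas_until_goal phi t : nnmeas phi -> nnmeas (until_goal phi t).
Proof.
move=> np; elim: t => [//|t ih] /=; have [mn n0] := nnmeas_next_mean ih; split.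
  by apply: measurable_fun_ifT => //; exact: measurable_in_goal.
by move=> z; case: ifP.
Qed.

Definition discounted phi z := \sum_(t <oo) (gamma ^+ t)%:E * until_goal phi t z.

Let g0 t : (0 <= gamma ^+ t)%R.
Proof. by rewrite exprn_ge0//; case/andP: gamma01. Qed.

Let nnmeas_term phi t : nnmeas phi ->
  nnmeas (fun z => (gamma ^+ t)%:E * until_goal phi t z).
Proof. by move=> np; apply: nnmeasZ => //; exact: nnmeas_until_goal. Qed.

Lemma nnmeas_discounted phi : nnmeas phi -> nnmeas (discounted phi).
Proof. by move=> np; apply: nnmeas_series => t; exact: nnmeas_term. Qed.

Lemma discounted_rec phi z : nnmeas phi ->
  discounted phi z = phi z +
    (if z.1 \in goal M then 0 else gamma%:E * next_mean (discounted phi) z).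
Proof.
move=> np; rewrite /discounted nneseries_recl//; last first.
  by move=> t _; exact: (nnmeas_term t np).2.
rewrite expr0 mul1e; congr (_ + _).
rewrite -nneseries_addn; last by move=> t; exact: (nnmeas_term _ np).2.
case: ifPn => zG.
  by rewrite eseries0// => t _ _; rewrite addn1/= zG mule0.
rewrite /next_mean xa_mean_series; last by move=> t; exact: nnmeas_term.
rewrite -nneseriesZl; last first.
  by move=> t _; apply: xa_mean_ge0; exact: nnmeas_term.
apply: eq_eseriesr => t _; rewrite addn1/= (negPf zG) exprS EFinM -muleA.
by rewrite xa_meanZ//; exact: nnmeas_until_goal.
Qed.

Lemma eq_expect_from t x a (Phi Psi : seq ((option S * C) * A) -> \bar R) :
  (forall h, size h = t.+1 -> Phi h = Psi h) ->
  expect_from M pi t x a Phi = expect_from M pi t x a Psi.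
Proof.
elim: t x a Phi Psi => [|t ih] x a Phi Psi PP /=; first exact: PP.
congr expect_next; apply/funext => x'; congr expect_act; apply/funext => a'.
by apply: ih => h sh; apply: PP => /=; rewrite sh.
Qed.

Lemma expect_from0 t x a : expect_from M pi t x a (fun=> 0) = 0.
Proof.
elim: t x a => [//|t ih] x a /=.
rewrite (_ : (fun x' => _) = fun=> 0).
  by rewrite /expect_next; case: x.1 => // s; case: ifP => // _; rewrite integral0.
apply/funext => x'; rewrite /expect_act; case: x'.1 => // s.
rewrite (eq_integral (cst 0)) ?integral0// => a' _; exact: ih.
Qed.

Lemma last_history (d d' : (option S * C) * A) h t : size h = t.+1 ->
  last d h = last d' h.
Proof. by case: h. Qed.

(** Bridge from functionals of the history to a recursion on the current state. The hypotheses say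
    that [Phi] has mean zero once a goal state has been left, and that it forgets a first state
    outside the goal. The reward and both occupancy integrands have these properties. *)
Lemma expect_fromE (Phi : nat -> seq ((option S * C) * A) -> \bar R) phi :
  nnmeas phi ->
  (forall x a, Phi 0%N [:: ((Some x.1, x.2), a)] = phi (x, a)) ->
  (forall t x a a', x \in goal M ->
     expect_from M pi t (None, x.2) a' (fun h => Phi t.+1 (((Some x.1, x.2), a) :: h)) = 0) ->
  (forall t x a h, x \notin goal M -> size h = t.+1 ->
     Phi t.+1 (((Some x.1, x.2), a) :: h) = Phi t h) ->
  forall t x a, expect_from M pi t (Some x.1, x.2) a (Phi t) = until_goal phi t (x, a).
Proof.
move=> np P0 PG PN; elim=> [|t ih] x a; first exact: P0.
rewrite /= /expect_next /= -surjective_pairing; case: ifPn => xG.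
  by rewrite /expect_act/= PG.
rewrite next_meanE/=; last exact: nnmeas_until_goal.
apply: eq_integral => s' _; rewrite /expect_act/=; apply: eq_integral => a' _.
rewrite -ih; apply: eq_expect_from => h sh /=.
exact: PN.
Qed.

Lemma goal_barE s c : ((Some s, c) \in goal_bar M) = ((s, c) \in goal M).
Proof. by apply/idP/idP; rewrite !inE. Qed.

Lemma expect_from_absorbed t c a d :
  expect_from M pi t (None, c) a
    (fun h => (reward_bar M (last d h).1)%:E) = 0.
Proof.
elim: t a => [|t ih] a /=.
  by rewrite /reward_bar indicE (_ : _ \in _ = false)//; apply/negbTE; rewrite notin_setE.
rewrite /expect_next/= /expect_act/=.
rewrite -[RHS](ih point); apply: eq_expect_from => h sh.
by rewrite (last_history _ d sh).
Qed.

Lemma nnmeas_reward : nnmeas (fun z : X * A => (reward M z.1)%:E).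
Proof.
split; last by move=> z; rewrite lee_fin.
apply/measurable_EFinP; apply: (measurableT_comp _ measurable_fst).
by apply: (measurable_indicP R (goal M)).1; exact: measurable_goal_set.
Qed.

Lemma Qfun_discounted x a :
  Qfun M gamma pi x a = discounted (fun z => (reward M z.1)%:E) (x, a).
Proof.
apply: eq_eseriesr => t _; congr (_ * _).
apply: (expect_fromE (Phi := fun _ h => (reward_bar M (last _ h).1)%:E)).
- exact: nnmeas_reward.
- by move=> [s c] a' /=; rewrite /reward_bar /reward !indicE goal_barE.
- move=> t' y b b' yG; rewrite -[RHS](expect_from_absorbed t' y.2 b' ((None, point), point)).
  apply: eq_expect_from => h sh; congr (_ %:E).
  by rewrite /= (last_history _ ((None, point), point) sh).
- move=> t' y b h yG sh.
  by rewrite /= (last_history _ ((None, point), point) sh).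
Qed.

Lemma Qfun_rec x a : Qfun M gamma pi x a =
  if x \in goal M then 1
  else gamma%:E * next_mean (fun z => Qfun M gamma pi z.1 z.2) (x, a).
Proof.
rewrite (_ : (fun z => _) = discounted (fun z => (reward M z.1)%:E)).
  rewrite Qfun_discounted discounted_rec/=; last exact: nnmeas_reward.
  by rewrite /reward indicE; case: ifP => _; rewrite ?adde0 ?add0e.
by apply/funext => -[y b]; exact: Qfun_discounted.
Qed.

Lemma expect_traj_until (Phi : nat -> seq ((option S * C) * A) -> \bar R) phi :
  nnmeas phi ->
  (forall t x a, expect_from M pi t (Some x.1, x.2) a (Phi t) = until_goal phi t (x, a)) ->
  \sum_(0 <= t <oo) (gamma ^+ t)%:E * expect_traj M pi t (Phi t) =
  xa_mean pi (init M) (discounted phi).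
Proof.
move=> np PE; rewrite /discounted xa_mean_series; last by move=> t; exact: nnmeas_term.
apply: eq_eseriesr => t _; rewrite (xa_meanZ pi (init M) (g0 t) (nnmeas_until_goal t np)).
congr (_ * _); apply: eq_integral => x _; apply: eq_integral => a _.
exact: PE.
Qed.

Definition off_goal (phi : X * A -> R) z : \bar R :=
  if z.1 \in goal M then 0 else (phi z)%:E.

Definition on_goal (phi : X -> R) (z : X * A) : \bar R :=
  if z.1 \in goal M then (phi z.1)%:E else 0.

Lemma nnmeas_off_goal (phi : X * A -> R) : measurable_fun [set: X * A] phi ->
  (forall z, 0 <= phi z)%R -> nnmeas (off_goal phi).
Proof.
move=> mp p0; split.
  by apply: measurable_fun_ifT; [exact: measurable_in_goal| |exact/measurable_EFinP].
by move=> z; rewrite /off_goal; case: ifP => _; rewrite ?lee_fin.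
Qed.

Lemma nnmeas_on_goal (phi : X -> R) : measurable_fun [set: X] phi ->
  (forall x, 0 <= phi x)%R -> nnmeas (on_goal phi).
Proof.
move=> mp p0; split.
  apply: measurable_fun_ifT; [exact: measurable_in_goal| |exact: measurable_cst].
  by apply/measurable_EFinP; exact: (measurableT_comp mp measurable_fst).
by move=> z; rewrite /on_goal; case: ifP => _; rewrite ?lee_fin.
Qed.

Lemma int_occ_notGE (phi : X * A -> R) : measurable_fun [set: X * A] phi ->
  (forall z, 0 <= phi z)%R ->
  int_occ_notG M gamma pi phi = xa_mean pi (init M) (discounted (off_goal phi)).
Proof.
move=> mp p0; have np := nnmeas_off_goal mp p0.
apply: (expect_traj_until (Phi := fun t h =>
  if (t < entry_time M h)%N then
    if (last _ h).1 is (Some s, c) then (phi ((s, c), (last _ h).2))%:E else 0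
  else 0)) => //.
apply: expect_fromE => //.
- move=> [s c] a /=; rewrite /entry_time/= goal_barE /off_goal/=.
  by case: (_ \in _).
(* A history that starts in the goal has [entry_time] 0, so the integrand vanishes at every later
   time. *)
- move=> t [s c] a a' xG.
  rewrite -[RHS](expect_from0 t (None, c) a').
  by apply: eq_expect_from => h sh; rewrite /entry_time/= goal_barE xG.
- move=> t [s c] a h xG sh.
  rewrite /entry_time/= goal_barE (negPf xG) ltnS.
  by rewrite /= (last_history _ ((None, point), point) sh).
Qed.

Lemma int_occ_GE (phi : X -> R) : measurable_fun [set: X] phi ->
  (forall x, 0 <= phi x)%R ->
  int_occ_G M gamma pi phi = xa_mean pi (init M) (discounted (on_goal phi)).
Proof.
move=> mp p0; have np := nnmeas_on_goal mp p0.
apply: (expect_traj_until (Phi := fun t h =>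
  if entry_time M h == t then
    if (last _ h).1 is (Some s, c) then (phi (s, c))%:E else 0
  else 0)) => //.
apply: expect_fromE => //.
- move=> [s c] a /=; rewrite /entry_time/= goal_barE /on_goal/=.
  by case: (_ \in _).
- move=> t [s c] a a' xG.
  rewrite -[RHS](expect_from0 t (None, c) a').
  by apply: eq_expect_from => h sh; rewrite /entry_time/= goal_barE xG.
- move=> t [s c] a h xG sh.
  rewrite /entry_time/= goal_barE (negPf xG) eqSS.
  by rewrite /= (last_history _ ((None, point), point) sh).
Qed.

End trajectories.

(** The arithmetic of one unrolling step in [Qfun_le_upper]. As [m2] and [m3] may be infinite,
    products are distributed over nonnegative sums only, and the finite part is compared in the
    reals. *)
Lemma discounted_affine_le (R : realType) (ga al be r1 r2 u : R)
    (m1 m2 m3 : \bar R) :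
  0 <= ga -> 0 <= al -> 0 <= be -> 0 <= u -> r1 <= r2 + al * u ->
  (0 <= m1 -> 0 <= m2 -> 0 <= m3 -> ga%:E * m1 = r1%:E ->
  ga%:E * (m1 + (al%:E * m2 + be%:E * m3)) <=
  r2%:E + (al%:E * (u%:E + ga%:E * m2) + be%:E * (ga%:E * m3)))%E.
Proof.
move=> ga0 al0 be0 u0 r12 m10 m20 m30 e1.
rewrite ge0_muleDr ?adde_ge0 ?mule_ge0 ?lee_fin// e1//.
rewrite ge0_muleDr ?mule_ge0 ?lee_fin//.
rewrite muleCA [X in (_ + (_ + X))%E]muleCA.
rewrite [X in (_ <= _ + (X + _))%E]ge0_muleDr ?mule_ge0 ?lee_fin ?u0//.
by rewrite -addeA [leRHS]addeA -EFinM -EFinD leeD// lee_fin.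
Qed.

(** * The gap between the true value and the objective of a pair (f, g) *)

Section value_gap.
Context (R : realType) (dS dA dC : measure_display) (S : measurableType dS)
  (A : measurableType dA) (C : measurableType dC).
Let X : measurableType _ := (S * C)%type.
Context (M : cgo R S A C) (gamma : R) (gamma01 : 0 <= gamma < 1)
  (pi : R.-pker (S * C) ~> A).
Implicit Types (f : X * A -> R) (g : X -> R).

Let gamma0 : 0 <= gamma. Proof. by case/andP: gamma01. Qed.
Let gamma1 : gamma < 1. Proof. by case/andP: gamma01. Qed.

Lemma bmeas_act f x : bmeas f -> bmeas (fun a => f (x, a)).
Proof. by move=> bf; apply: (bmeas_comp (f := f)) bf; exact: pair1_measurable. Qed.

Lemma bmeas_at_policy f : bmeas f -> bmeas (at_policy f pi).
Proof. by move=> bf; exact: (@bmeas_Rintegral_pull _ _ _ X X A R pi id). Qed.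

Lemma bmeas_bellman f : bmeas f -> bmeas (bellman M gamma pi f).
Proof.
move=> bf; apply: bmeasZ.
apply: (@bmeas_Rintegral_pull _ _ _ (X * A)%type (S * A)%type S R (trans M)
  (fun z => (z.1.1, z.2)) (fun t => at_policy f pi (t.2, t.1.1.2))).
  apply: measurable_fun_pair => //.
  by apply: (measurableT_comp measurable_fst).
apply: (bmeas_comp (f := at_policy f pi)); last exact: bmeas_at_policy.
apply: measurable_fun_pair => //.
apply: (measurableT_comp measurable_snd).
by apply: (measurableT_comp measurable_fst).
Qed.

Lemma at_policy01 f x : measurable_fun [set: X * A] f ->
  (forall z, 0 <= f z <= 1) -> 0 <= at_policy f pi x <= 1.
Proof.
move=> mf f01; apply: bRintegral01 => //.
exact: (measurableT_comp mf (pair1_measurable x)).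
Qed.

Lemma bmeas_state (v : X -> R) (c : C) : bmeas v -> bmeas (fun s => v (s, c)).
Proof. by move=> bv; apply: (bmeas_comp (f := v)) bv; exact: pair2_measurable. Qed.

Lemma le_bellman f f' z : bmeas f -> bmeas f' ->
  (forall x, at_policy f pi x <= at_policy f' pi x) ->
  bellman M gamma pi f z <= bellman M gamma pi f' z.
Proof.
move=> bf bf' ff'; rewrite ler_wpM2l//; apply: le_bRintegral => //.
- by apply: bmeas_state; exact: bmeas_at_policy.
- by apply: bmeas_state; exact: bmeas_at_policy.
Qed.

Lemma at_policy_cst (v : X -> R) x : at_policy (fun z => v z.1) pi x = v x.
Proof. by rewrite /at_policy/= bRintegral_cst. Qed.

Lemma at_policy_max f g x :
  at_policy (fun z => Num.max (g z.1) (at_policy f pi z.1)) pi x =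
  Num.max (g x) (at_policy f pi x).
Proof. exact: (at_policy_cst (fun x => Num.max (g x) (at_policy f pi x))). Qed.

Lemma bellmanD_cst f c z : bmeas f ->
  bellman M gamma pi (fun z => f z + c) z = bellman M gamma pi f z + gamma * c.
Proof.
move=> bf; rewrite /bellman -mulrDr; congr (_ * _).
rewrite -[X in _ = _ + X](bRintegral_cst (prob_kernel (s := trans M) (z.1.1, z.2)) c).
rewrite -bRintegralD//; last 2 first.
  by apply: bmeas_state; exact: bmeas_at_policy.
  exact: bmeas_cst.
apply: eq_Rintegral => s' _; rewrite /at_policy bRintegralD//; last 2 first.
  exact: bmeas_act.
  exact: bmeas_cst.
by rewrite bRintegral_cst.
Qed.

Lemma next_mean_bellman f z : bmeas f -> (forall z, 0 <= f z) ->
  (gamma%:E * next_mean M pi (fun z => (f z)%:E) z)%E = (bellman M gamma pi f z)%:E.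
Proof.
move=> bf f0; rewrite next_meanE; last first.
  by split => [|t]; [apply/measurable_EFinP; case: bf|rewrite lee_fin].
rewrite EFinM; congr (_ * _)%E.
rewrite -integral_bmeas//; last by apply: bmeas_state; exact: bmeas_at_policy.
by apply: eq_integral => s' _; rewrite integral_bmeas//; exact: bmeas_act.
Qed.

(** The regression function of [loss_dyn]. Written as T^pi of a function of (x, a), constant in a,
    so that completeness and [Cdyn] apply to it directly. *)
Definition backup f g : X * A -> R :=
  bellman M gamma pi (fun z => Num.max (g z.1) (at_policy f pi z.1)).

Let nn (phi : X * A -> R) : bmeas phi -> (forall z, 0 <= phi z) ->
  nnmeas (fun z => (phi z)%:E).
Proof.
by move=> [mp _] p0; split => [|z]; [exact/measurable_EFinP|rewrite lee_fin].
Qed.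

Section gap.
Variables (q f : X * A -> R) (g : X -> R) (c2 c4 : R).
Hypotheses (mq : measurable_fun [set: X * A] q) (q01 : forall z, 0 <= q z <= 1).
Hypotheses (mf : measurable_fun [set: X * A] f) (f01 : forall z, 0 <= f z <= 1).
Hypotheses (mg : measurable_fun [set: X] g) (g01 : forall x, 0 <= g x <= 1).
Hypothesis Qq : forall x a, Qfun M gamma pi x a = (q (x, a))%:E.
Hypotheses (c2_gt0 : 0 < c2) (c4_gt0 : 0 < c4).

Let bq : bmeas q. Proof. exact: bmeas01. Qed.
Let bf : bmeas f. Proof. exact: bmeas01. Qed.
Let bg : bmeas g. Proof. exact: bmeas01. Qed.
Let q0 z : 0 <= q z. Proof. by case/andP: (q01 z). Qed.

(** The value that \bar f_g takes on the actions chosen by \bar pi. *)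
Let w z := if z.1 \in goal M then g z.1 else f z.
Let w0 z : 0 <= w z.
Proof. by rewrite /w; case: ifP => _; [case/andP: (g01 z.1)|case/andP: (f01 z)]. Qed.

Let bw : bmeas w.
Proof.
split.
  apply: measurable_fun_ifT => //; first exact: measurable_in_goal.
  exact: (measurableT_comp mg measurable_fst).
exists 1 => z; rewrite ger0_norm// /w.
by case: ifP => _; [case/andP: (g01 z.1)|case/andP: (f01 z)].
Qed.

Let h z := f z - backup f g z.
Let k x := g x - reward M x.

Let bmx : bmeas (fun z : X * A => Num.max (g z.1) (at_policy f pi z.1)).
Proof.
have bm : bmeas (fun x => Num.max (g x) (at_policy f pi x)).
  by apply: bmeas_max => //; exact: bmeas_at_policy.
by apply: (bmeas_comp (f := fun x => Num.max (g x) (at_policy f pi x))) bm.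
Qed.

Let bh2 : bmeas (fun z => h z ^+ 2).
Proof. by apply: bmeasX; apply: bmeasB => //; exact: bmeas_bellman. Qed.

Let mk2 : measurable_fun [set: X] (fun x => k x ^+ 2).
Proof.
have [] // : bmeas (fun x => k x ^+ 2); apply: bmeasX; apply: bmeasB => //.
apply: bmeas01.
  by apply: (measurable_indicP R (goal M)).1; exact: measurable_goal_set.
by move=> x; rewrite /reward indicE; case: (_ \in _); rewrite lexx ler01.
Qed.

Let h20 z : 0 <= h z ^+ 2. Proof. exact: sqr_ge0. Qed.
Let k20 x : 0 <= k x ^+ 2. Proof. exact: sqr_ge0. Qed.

Let UN := discounted M gamma pi (off_goal M (fun z => h z ^+ 2)).
Let UG := discounted M gamma pi (on_goal M (fun x => k x ^+ 2)).

Let nnN : nnmeas (off_goal M (fun z => h z ^+ 2)).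
Proof. by apply: nnmeas_off_goal => //; case: bh2. Qed.
Let nnG : nnmeas (on_goal (A := A) M (fun x => k x ^+ 2)).
Proof. exact: nnmeas_on_goal. Qed.
Let nUN : nnmeas UN. Proof. exact: nnmeas_discounted. Qed.
Let nUG : nnmeas UG. Proof. exact: nnmeas_discounted. Qed.

Let al := (4 * c2)^-1.
Let be := (4 * c4)^-1.
(** Each step loses at most c2 + c4 beyond the squared errors; [cc] is the sum of the geometric
    series of these losses. *)
Let cc := (c2 + c4) / (1 - gamma).
Let al0 : 0 <= al. Proof. by rewrite invr_ge0 mulr_ge0// ltW. Qed.
Let be0 : 0 <= be. Proof. by rewrite invr_ge0 mulr_ge0// ltW. Qed.
Let cc0 : 0 <= cc.
Proof. by rewrite divr_ge0 ?subr_ge0 ?addr_ge0 ?ltW. Qed.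
Let ccE : cc = c2 + c4 + gamma * cc.
Proof.
have g1 : 1 - gamma != 0 by rewrite subr_eq0 gt_eqF.
by rewrite /cc; field.
Qed.

(** The bound after [n] unrolled steps. The term [gamma ^+ n] stands for the part of the trajectory
    not yet unrolled, where only q <= 1 is known. *)
Let upper n : X * A -> \bar R := fun z =>
  ((w z + (cc + gamma ^+ n))%:E + (al%:E * UN z + be%:E * UG z))%E.

Let nw n : nnmeas (fun z => (w z + (cc + gamma ^+ n))%:E).
Proof.
apply: nn; first exact: bmeasD bw (bmeas_cst _ _).
by move=> z; rewrite !addr_ge0// exprn_ge0.
Qed.

Let nupper n : nnmeas (upper n).
Proof. by apply: nnmeasD; [exact: nw|apply: nnmeasD; exact: nnmeasZ]. Qed.

Let upper_mean (nu : {measure set X -> \bar R}) n : xa_mean pi nu (upper n) =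
  (xa_mean pi nu (fun z => (w z + (cc + gamma ^+ n))%:E) +
   (al%:E * xa_mean pi nu UN + be%:E * xa_mean pi nu UG))%E.
Proof.
pose u1 z := (al%:E * UN z)%E; pose u2 z := (be%:E * UG z)%E.
have n1 : nnmeas u1 by exact: nnmeasZ.
have n2 : nnmeas u2 by exact: nnmeasZ.
have := xa_meanD pi nu (nw n) (nnmeasD n1 n2).
by rewrite (xa_meanD pi nu n1 n2) (xa_meanZ pi nu al0 nUN) (xa_meanZ pi nu be0 nUG).
Qed.

Let amgm (c t : R) : 0 < c -> - t <= (4 * c)^-1 * t ^+ 2 + c.
Proof.
move=> c0; rewrite -subr_ge0.
have -> : (4 * c)^-1 * t ^+ 2 + c - - t = (4 * c)^-1 * (t + 2 * c) ^+ 2.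
  by field; rewrite gt_eqF.
by rewrite mulr_ge0 ?sqr_ge0// invr_ge0 mulr_ge0// ltW.
Qed.

(** Averaged over [pi], [w] equals g x on the goal and f(x, pi) elsewhere, and the maximum dominates
    both. *)
Let backup_ge z : bellman M gamma pi w z <= backup f g z.
Proof.
apply: le_bellman => // x; rewrite at_policy_max le_max.
case: (boolP (x \in goal M)) => xG; apply/orP.
  left; rewrite -[leRHS](at_policy_cst g); apply: le_bRintegral => //.
  - exact: bmeas_act.
  - exact: (bmeas_cst _ (g x)).
  - by move=> a; rewrite /w/= xG.
right; apply: le_bRintegral => //; try exact: bmeas_act.
by move=> a; rewrite /w/= (negPf xG).
Qed.

Lemma Qfun_le_upper n z : ((q z)%:E <= upper n z)%E.
Proof.
elim: n z => [z|n ih z].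
  apply: (@le_trans _ _ 1%E); first by rewrite lee_fin; case/andP: (q01 z).
  rewrite /upper expr0 -[leLHS]adde0; apply: leeD.
    by rewrite lee_fin; have := w0 z; have := cc0; lra.
  by rewrite adde_ge0// mule_ge0 ?lee_fin//; [exact: nUN.2|exact: nUG.2].
have UNE := discounted_rec M gamma01 pi z nnN; rewrite -/UN in UNE.
have UGE := discounted_rec M gamma01 pi z nnG; rewrite -/UG in UGE.
rewrite /upper UNE UGE; case: z {UNE UGE} => x a.
have QE := Qfun_rec M gamma01 pi x a; rewrite Qq in QE.
rewrite QE {QE} /off_goal /on_goal /w; cbn [fst].
(* On the goal q = 1 = g - k, and [amgm] with [c4] pays for - k. *)
case xG : (x \in goal M).
  rewrite add0e mule0 add0e adde0 -EFinM -EFinD lee_fin.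
  have := amgm (k x) c4_gt0; rewrite /be /k /reward indicE xG/=.
  have : 0 <= gamma ^+ n.+1 by rewrite exprn_ge0.
  have := ccE; have : 0 <= gamma * cc by rewrite mulr_ge0.
  by move: c2_gt0 c4_gt0; lra.
rewrite add0e.
have le1 : (gamma%:E * next_mean M pi (fun z => Qfun M gamma pi z.1 z.2) (x, a) <=
    gamma%:E * next_mean M pi (upper n) (x, a))%E.
  apply: lee_wpmul2l; first by rewrite lee_fin.
  apply: le_xa_mean => //.
    by rewrite (_ : (fun z => _) = fun z => (q z)%:E);
      [exact: nn|apply/funext => -[y b]; exact: Qq].
    exact: nupper.
  by move=> [y b]; rewrite Qq; exact: ih.
apply: le_trans le1 _.
rewrite /next_mean upper_mean -/(next_mean M pi UN (x, a)) -/(next_mean M pi UG (x, a)).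
have n2 := (nnmeas_next_mean M pi nUN).2 (x, a).
have n3 := (nnmeas_next_mean M pi nUG).2 (x, a).
have m1E : (gamma%:E * xa_mean pi (next_law M (x, a))
      (fun z => (w z + (cc + gamma ^+ n))%:E) =
    (bellman M gamma pi w (x, a) + gamma * (cc + gamma ^+ n))%:E)%E.
  rewrite -[xa_mean _ _ _]/(next_mean M pi (fun z => (w z + (cc + gamma ^+ n))%:E) (x, a)).
  rewrite next_mean_bellman ?bellmanD_cst//.
    exact: bmeasD bw (bmeas_cst _ _).
  by move=> z; rewrite !addr_ge0// exprn_ge0.
(* The discounted mean of [w] is at most the backup, which is f - h, and [amgm] with [c2] pays for -
   h; the constants close up by [ccE]. *)
have key : bellman M gamma pi w (x, a) + gamma * (cc + gamma ^+ n) <=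
    f (x, a) + (cc + gamma ^+ n.+1) + al * h (x, a) ^+ 2.
  have bg1 := backup_ge (x, a); have am := amgm (h (x, a)) c2_gt0.
  have hE : h (x, a) = f (x, a) - backup f g (x, a) by [].
  rewrite -/al in am; rewrite exprS mulrDr; move: am hE bg1 ccE c4_gt0.
  generalize (al * h (x, a) ^+ 2) => v.
  lra.
apply: (discounted_affine_le gamma0 al0 be0 (h20 _) key _ n2 n3 m1E).
by apply: xa_mean_ge0; exact: nw.
Qed.

Lemma value_gap :
  (Jval M gamma pi <= objective M pi (f, g) +
    (al%:E * int_occ_notG M gamma pi (fun z => h z ^+ 2)%R +
     be%:E * int_occ_G M gamma pi (fun x => k x ^+ 2)%R) + cc%:E)%E.
Proof.
rewrite int_occ_notGE//; last by case: bh2.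
rewrite int_occ_GE//.
have JE : Jval M gamma pi = xa_mean pi (init M) (fun z => (q z)%:E).
  by apply: eq_integral => x _; apply: eq_integral => a _; exact: Qq.
have OE : objective M pi (f, g) = xa_mean pi (init M) (fun z => (w z)%:E).
  apply: eq_integral => -[s c] _; rewrite /expect_pibar /act_mean /w /fbar; cbn [fst snd].
  case xG : ((s, c) \in goal M) => //.
  by rewrite integral_cst// prob_kernel mule1.
rewrite JE OE.
have nwz : nnmeas (fun z => (w z)%:E) by exact: nn.
have step n : (xa_mean pi (init M) (fun z => (q z)%:E) <=
   xa_mean pi (init M) (fun z => (w z)%:E) +
    (al%:E * xa_mean pi (init M) UN + be%:E * xa_mean pi (init M) UG) + cc%:E +
    (gamma ^+ n)%:E)%E.
  apply: (@le_trans _ _ (xa_mean pi (init M) (upper n))).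
    exact: (le_xa_mean pi (init M) (nn bq q0) (nupper n) (Qfun_le_upper n)).
  rewrite upper_mean.
  have -> : (fun z => (w z + (cc + gamma ^+ n))%:E) =
    ((fun z => (w z)%:E) \+ cst (cc + gamma ^+ n)%:E)%E.
    by apply/funext => z; rewrite EFinD.
  rewrite xa_meanD//; last by apply: nnmeas_cst; rewrite addr_ge0// exprn_ge0.
  rewrite xa_mean_cst// EFinD.
  by rewrite addeAC -!addeA.
apply/lee_addgt0Pr => e e0.
have [n gn] : exists n, gamma ^+ n <= e.
  have ng : `|gamma| < 1 by rewrite ger0_norm.
  have /cvgrPdist_le/(_ _ e0)[N _ /(_ N (leqnn N))] := cvg_expr ng.
  by rewrite sub0r normrN => gN; exists N; rewrite (le_trans _ gN)// ler_norm.
by apply: le_trans (step n) _; rewrite leeD2l// lee_fin.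
Qed.

End gap.

End value_gap.

(** * Total variation, union bound and covers *)

Section total_variation.
Context d (T : measurableType d) (R : realType) (p q : {measure set T -> \bar R}).
Hypotheses (p1 : p [set: T] = 1%E) (q1 : q [set: T] = 1%E).

Lemma dist_l1_set E : measurable E -> (`|p E - q E| <= dist_l1 p q)%E.
Proof.
move=> mE; pose B (i : 'I_2) := if i == ord0 then E else ~` E.
apply: (@le_trans _ _ (\sum_(i < 2) `|p (B i) - q (B i)|)%E).
  by rewrite big_ord_recl /B eqxx leeDl// big_ord_recl big_ord0 adde0 abse_ge0.
apply: ereal_sup_ubound; exists 2%N, B; split => //.
- by move=> i; rewrite /B; case: ifP => // _; exact: measurableC.
- move=> i j _ _; rewrite /B.
  case: (eqVneq i ord0) => i0; case: (eqVneq j ord0) => j0 [x []] => //.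
  + by rewrite i0 j0.
  + by move=> ? ?; apply/val_inj => /=; move: i j i0 j0 => [[|[|]]//?] [[|[|]]//?].
- apply/seteqP; split => // x _.
  have [Ex|Ex] := pselect (E x); first by exists ord0.
  by exists ord_max.
Qed.

(** The sum counts the integers between 1 and K that are at most [y], that is, it is the integer
    part of [y]. *)
Lemma count_le_floor K (y : R) : 0 <= y <= K%:R ->
  (\sum_(i < K) (i.+1%:R <= y)%R)%:R <= y <= (\sum_(i < K) (i.+1%:R <= y)%R)%:R + 1.
Proof.
elim: K y => [|K ih] y /andP[y0 yK]; first by rewrite big_ord0 y0 add0r; lra.
rewrite big_ord_recr/=; have [yK1|yK1] := leP K.+1%:R y.
  have -> : (\sum_(i < K) (i.+1%:R <= y)%R = K)%N.
    rewrite -[RHS]card_ord -sum1_card; apply: eq_bigr => i _.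
    by rewrite (le_trans _ yK1)// ler_nat; have := ltn_ord i; lia.
  by rewrite addn1; apply/andP; split => //; lra.
rewrite addn0; have [yK2|yK2] := leP y K%:R; first by apply: ih; rewrite y0.
have -> : (\sum_(i < K) (i.+1%:R <= y)%R = K)%N.
  rewrite -[RHS]card_ord -sum1_card; apply: eq_bigr => i _.
  by rewrite (le_trans _ (ltW yK2))// ler_nat.
by rewrite -natr1 in yK1; apply/andP; split; lra.
Qed.

(** A discrete layer-cake argument: [f] is within 1 / K of the average of the indicators of its
    level sets {f >= i / K}, and the two integrals of each indicator differ by at most [e]. Letting
    K grow removes the discretisation error. *)
Lemma Rintegral_dist_l1 (f : T -> R) (e : R) : measurable_fun [set: T] f ->
  (forall x, 0 <= f x <= 1) -> (dist_l1 p q <= e%:E)%E ->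
  `|(\int[p]_x f x)%R - (\int[q]_x f x)%R| <= e.
Proof.
move=> mf f01 pqe.
have key K : (0 < K)%N -> `|(\int[p]_x f x)%R - (\int[q]_x f x)%R| <= e + 2 / K%:R.
  move=> K0; have K0' : (0 : R) < K%:R by rewrite ltr0n.
  pose E (i : 'I_K) : set T := [set x | i.+1%:R <= f x * K%:R].
  have mE i : measurable (E i).
    rewrite -[X in measurable X]setTI /E -preimage_itvcy.
    have mfK : measurable_fun [set: T] (fun x => f x * K%:R) by exact: measurable_funM.
    exact: mfK.
  pose fK x : R := K%:R^-1 * \sum_(i < K) \1_(E i) x.
  have b1 i : bmeas (\1_(E i) : T -> R).
    apply: bmeas01; first exact: (measurable_indicP R (E i)).1.
    by move=> x; rewrite indicE; case: (_ \in _); rewrite lexx ler01.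
  have bfK : bmeas fK by apply: bmeasZ; exact: bmeas_sum.
  have ffK x : `|f x - fK x| <= K%:R^-1.
    have /andP[f0 f1] := f01 x.
    have : 0 <= f x * K%:R <= K%:R by rewrite mulr_ge0//= ler_piMl.
    move=> /count_le_floor; rewrite natr_sum.
    rewrite (_ : \sum_(i < K) _ = \sum_(i < K) \1_(E i) x); last first.
      apply: eq_bigr => i _; rewrite indicE; congr (nat_of_bool _)%:R.
      by apply/idP/idP; rewrite inE.
    set s := \sum_(i < K) _ => /andP[s1 s2].
    have -> : f x - fK x = K%:R^-1 * (f x * K%:R - s).
      by rewrite /fK -/s; field; rewrite gt_eqF.
    rewrite normrM ger0_norm ?invr_ge0// ler_piMr ?invr_ge0//.
    by rewrite ger0_norm; lra.
  have IE (mu : {measure set T -> \bar R}) i : mu [set: T] = 1%E ->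
      (\int[mu]_x \1_(E i) x)%R%:E = mu (E i).
    by move=> mu1; rewrite -integral_bmeas// integral_indic// setIT.
  have pq i : `|(\int[p]_x \1_(E i) x)%R - (\int[q]_x \1_(E i) x)%R| <= e.
    by rewrite -lee_fin; apply: le_trans pqe; rewrite -abse_EFin EFinB !IE// dist_l1_set.
  have fKpq : `|(\int[p]_x fK x)%R - (\int[q]_x fK x)%R| <= e.
    rewrite !bRintegralZ//; try exact: bmeas_sum.
    rewrite !bRintegral_sum// -mulrBr -sumrB normrM ger0_norm ?invr_ge0//.
    rewrite ler_pdivrMl//; apply: le_trans (ler_norm_sum _ _ _) _.
    apply: le_trans (ler_sum _ (fun i _ => pq i)) _.
    by rewrite sumr_const card_ord mulr_natl.
  have bf : bmeas f by exact: bmeas01.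
  have := bRintegral_dist p1 bf bfK ffK; have := bRintegral_dist q1 bf bfK ffK.
  move: fKpq; rewrite !ler_norml.
  set a := (\int[p]_x f x)%R; set b := (\int[q]_x f x)%R.
  set c := (\int[p]_x fK x)%R; set c' := (\int[q]_x fK x)%R.
  by move=> /andP[? ?] /andP[? ?] /andP[? ?]; apply/andP; split; lra.
apply/ler_addgt0Pr => u u0.
pose K := (Num.truncn (2 / u)).+1.
apply: le_trans (key K isT) _; rewrite lerD2l ler_pdivrMr ?ltr0n//.
rewrite mulrC -ler_pdivrMr//.
by have /andP[_ /ltW] := truncn_itv (divr_ge0 (ler0n R 2) (ltW u0)).
Qed.

End total_variation.

Lemma union_bound d (T : measurableType d) (R : realType) (P : probability T R)
    (I : finType) (D : I -> set T) (e : R) :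
  (forall i, measurable (D i) /\ (P (D i) <= e%:E)%E) ->
  exists2 B : set T, measurable B /\ (P B <= (#|I|%:R * e)%:E)%E &
    forall x, ~ B x -> forall i, ~ D i x.
Proof.
move=> mD.
suff [B [mB PB BD]] : exists B : set T, [/\ measurable B,
    (P B <= ((size (enum I))%:R * e)%:E)%E &
    forall x, ~ B x -> forall i, i \in enum I -> ~ D i x].
  exists B; first by rewrite cardE.
  by move=> x Bx i; apply: BD => //; rewrite mem_enum.
elim: (enum I) => [|i s [B [mB PB BD]]].
  by exists set0; split => //; rewrite measure0 mul0r.
exists (D i `|` B); split.
- by apply: measurableU => //; case: (mD i).
- apply: le_trans (measureU2 _ (mD i).1 mB) _.
  by rewrite /= -natr1 mulrDl mul1r addrC EFinD leeD//; case: (mD i).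
- move=> x /not_orP[Dx Bx] j; rewrite inE => /predU1P[->//|].
  exact: BD.
Qed.

(** A nonempty set of naturals has a least element, so a finite infimum is attained. The centres lie
    in [F] and therefore share the bounds and the measurability of the class. *)
Lemma covering_numberP (R : realType) (T : Type) (dist : T -> T -> \bar R)
    (F : set T) (eps : R) :
  (covering_number dist F eps < +oo)%E ->
  exists k (c : 'I_k -> T), [/\ covering_number dist F eps = k%:R%:E,
    forall i, F (c i) & forall f, F f -> exists i, (dist (c i) f <= eps%:E)%E].
Proof.
pose Q := [set k : nat | exists c : 'I_k -> T, (forall i, F (c i)) /\
  forall f, F f -> exists i, (dist (c i) f <= eps%:E)%E].
move=> fin.
have exQ : exists k, `[< Q k >].
  apply: contrapT => /forallNP nQ; move: fin; rewrite /covering_number.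
  rewrite (_ : [set _ | _ in _] = set0) ?ereal_inf0 ?ltxx//.
  apply/seteqP; split => [y [k Qk _]|//].
  by apply: (nQ k); apply/asboolP.
have [k0 /asboolP Qk0 k0min] := ex_minnP exQ.
have [c [Fc cc]] := Qk0.
exists k0, c; split => //; apply/eqP; rewrite eq_le; apply/andP; split.
  by apply: ereal_inf_lbound; exists k0.
apply: le_ereal_inf_tmp => _ [k' Qk' <-]; rewrite lee_fin ler_nat; apply: k0min.
exact/asboolP.
Qed.

(** * Regression: the backup as a conditional mean *)

Section regression.
Context (R : realType) (dS dA dC : measure_display) (S : measurableType dS)
  (A : measurableType dA) (C : measurableType dC).
Let X : measurableType _ := (S * C)%type.
Let Z : measurableType _ := (S * A * S)%type.
Context (M : cgo R S A C) (gamma : R) (gamma01 : 0 <= gamma < 1)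
  (mudyn : probability (S * A * S)%type R) (mugoal : probability (S * C)%type R).
Hypothesis mudyn_law : dyn_law M mudyn.

Let gamma0 : 0 <= gamma. Proof. by case/andP: gamma01. Qed.

Let sa : Z -> (S * A)%type := fst.

Let msa : measurable_fun [set: Z] sa. Proof. exact: measurable_fst. Qed.

HB.instance Definition _ := isMeasurableFun.Build _ _ _ _ sa msa.

(** [dyn_law] gives [mudyn] on rectangles by an integral over [mudyn] itself; pushing it to the
    marginal of (s, a) puts it into the form that disintegration requires. The shift by [B] makes
    the integrand nonnegative. *)
Lemma Rintegral_dyn_law (l : Z -> R) : bmeas l ->
  (\int[mudyn]_z l z = \int[mudyn]_z \int[trans M z.1]_s' l (z.1, s'))%R.
Proof.
move=> bl; have [ml [B lB]] := bl.
pose l' z := (l z + B)%:E.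
have l0 z : (0 <= l' z)%E.
  by rewrite lee_fin; have := lB z; rewrite ler_norml => /andP[]; lra.
have bl' : bmeas (fun z => l z + B) by apply: bmeasD => //; exact: bmeas_cst.
have ml' : measurable_fun [set: Z] l' by apply/measurable_EFinP; case: bl'.
pose marg := distribution mudyn sa.
have bslice z (u : Z -> R) : bmeas u -> bmeas (fun s' => u (z, s')).
  by move=> bu; apply: (bmeas_comp (f := u)) bu; exact: pair1_measurable.
have margE B1 B2 : measurable B1 -> measurable B2 ->
    mudyn (B1 `*` B2) = (\int[marg]_(x in B1) trans M x B2)%E.
  move=> mB1 mB2; rewrite (mudyn_law mB1 mB2) /marg /distribution.
  rewrite ge0_integral_pushforward//.
  exact: measurable_funTS (measurable_kernel (trans M) _ mB2).
have bI : bmeas (fun z : Z => (\int[trans M z.1]_s' l (z.1, s'))%R).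
  apply: (@bmeas_Rintegral_pull _ _ _ Z (S * A)%type S R (trans M) fst
    (fun t => l (t.1.1, t.2))) => //.
  apply: (bmeas_comp (f := l)) bl.
  apply: measurable_fun_pair => //.
  by apply: (measurableT_comp measurable_fst).
have := integral_disintegration margE l0 ml'.
rewrite ge0_integral_distribution//; last 2 first.
- exact: (@measurable_integral_pull _ _ _ _ _ _ _ (trans M) id).
- by move=> x; exact: integral_ge0.
rewrite {1}/l' integral_bmeas//.
rewrite [X in _ = X -> _](_ : _ =
    (\int[mudyn]_z ((\int[trans M z.1]_s' l (z.1, s') + B)%R)%:E)%E); last first.
  apply: eq_integral => z _.
  rewrite /comp /l' integral_bmeas//; last by apply: bmeasD; [exact: bslice|exact: bmeas_cst].
  by rewrite bRintegralD//; [rewrite bRintegral_cst|exact: bslice|exact: bmeas_cst].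
rewrite integral_bmeas//; last by apply: bmeasD => //; exact: bmeas_cst.
rewrite !bRintegralD//; try exact: bmeas_cst.
by rewrite !bRintegral_cst// => -[]/addIr.
Qed.

Section one_regression.
Variables (pi : R.-pker (S * C) ~> A) (f' f : X * A -> R) (g : X -> R).
Hypotheses (mf' : measurable_fun [set: X * A] f') (f'01 : forall z, 0 <= f' z <= 1).
Hypotheses (mf : measurable_fun [set: X * A] f) (f01 : forall z, 0 <= f z <= 1).
Hypotheses (mg : measurable_fun [set: X] g) (g01 : forall x, 0 <= g x <= 1).

Definition target x := gamma * Num.max (g x) (at_policy f pi x).

Let bf' : bmeas f'. Proof. exact: bmeas01. Qed.

Lemma bmeas_target : bmeas target.
Proof.
apply: bmeasZ; apply: bmeas_max; first exact: bmeas01.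
by apply: bmeas_at_policy; exact: bmeas01.
Qed.

Lemma target01 x : 0 <= target x <= 1.
Proof.
have /andP[f0 f1] := at_policy01 pi x mf f01; have /andP[gg0 gg1] := g01 x.
have /andP[_ g1] := gamma01.
have m0 : 0 <= Num.max (g x) (at_policy f pi x) by rewrite le_max gg0.
have m1 : Num.max (g x) (at_policy f pi x) <= 1 by rewrite ge_max gg1.
by rewrite /target mulr_ge0//= mulr_ile1// ltW.
Qed.

Let tau := backup M gamma pi f g.

Lemma backupE z : tau z = (\int[trans M (z.1.1, z.2)]_s' target (s', z.1.2))%R.
Proof.
rewrite /tau /backup /bellman -bRintegralZ//; last first.
  apply: bmeas_state; apply: bmeas_at_policy.
  have bm : bmeas (fun x => Num.max (g x) (at_policy f pi x)).
    by apply: bmeas_max; [exact: bmeas01|apply: bmeas_at_policy; exact: bmeas01].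
  exact: (bmeas_comp (f := fun x => Num.max (g x) (at_policy f pi x))).
by apply: eq_Rintegral => s' _; rewrite at_policy_max.
Qed.

Lemma backup01 z : 0 <= tau z <= 1.
Proof.
rewrite backupE; apply: bRintegral01 => //.
  by case: (bmeas_state z.1.2 bmeas_target).
by move=> s'; exact: target01.
Qed.

Lemma bmeas_backup : bmeas tau.
Proof.
apply: bmeas_bellman.
have bm : bmeas (fun x => Num.max (g x) (at_policy f pi x)).
  by apply: bmeas_max; [exact: bmeas01|apply: bmeas_at_policy; exact: bmeas01].
exact: (bmeas_comp (f := fun x => Num.max (g x) (at_policy f pi x))).
Qed.

Definition in_ctx (z : Z) (y : X) : X * A := ((z.1.1, y.2), z.1.2).

Lemma measurable_in_ctx : measurable_fun [set: Z * X] (fun t => in_ctx t.1 t.2).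
Proof.
apply: measurable_fun_pair.
  apply: measurable_fun_pair; last exact: (measurableT_comp measurable_snd).
  apply: (measurableT_comp measurable_fst).
  by apply: (measurableT_comp measurable_fst).
apply: (measurableT_comp measurable_snd).
by apply: (measurableT_comp measurable_fst).
Qed.

Definition excess (t : Z * X) : R :=
  (f' (in_ctx t.1 t.2) - target (t.1.2, t.2.2)) ^+ 2 -
  (tau (in_ctx t.1 t.2) - target (t.1.2, t.2.2)) ^+ 2.

Definition gap2 (t : Z * X) : R := (f' (in_ctx t.1 t.2) - tau (in_ctx t.1 t.2)) ^+ 2.

Lemma bmeas_excess : bmeas excess.
Proof.
have bt : bmeas (fun t : Z * X => target (t.1.2, t.2.2)).
  apply: (bmeas_comp (f := target)) bmeas_target.
  apply: measurable_fun_pair; exact: (measurableT_comp measurable_snd).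
by apply: bmeasB; apply: bmeasX; apply: bmeasB => //;
  [apply: (bmeas_comp (f := f'))|apply: (bmeas_comp (f := tau))];
  (exact: measurable_in_ctx || exact: bmeas_backup || idtac).
Qed.

Lemma bmeas_gap2 : bmeas gap2.
Proof.
by apply: bmeasX; apply: bmeasB;
  [apply: (bmeas_comp (f := f'))|apply: (bmeas_comp (f := tau))];
  (exact: measurable_in_ctx || exact: bmeas_backup || idtac).
Qed.

Lemma norm_excess t : `|excess t| <= 3.
Proof.
rewrite /excess; have := f'01 (in_ctx t.1 t.2); have := backup01 (in_ctx t.1 t.2).
have := target01 (t.1.2, t.2.2).
move: (f' _) (tau _) (target _) => a b c /andP[c0 c1] /andP[b0 b1] /andP[a0 a1].
rewrite ler_norml; apply/andP; split; nra.
Qed.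

Lemma sqr_excess_le t : excess t ^+ 2 <= 9 * gap2 t.
Proof.
rewrite /excess /gap2.
have := f'01 (in_ctx t.1 t.2); have := backup01 (in_ctx t.1 t.2).
have := target01 (t.1.2, t.2.2).
move: (f' _) (tau _) (target _) => a b c /andP[c0 c1] /andP[b0 b1] /andP[a0 a1].
rewrite (_ : (a - c) ^+ 2 - (b - c) ^+ 2 = (a - b) * (a + b - 2 * c)); last by ring.
rewrite exprMn mulrC ler_wpM2r ?sqr_ge0//.
nra.
Qed.

Let slice (u : Z * X -> R) y : bmeas u -> bmeas (fun z => u (z, y)).
Proof. by move=> bu; apply: (bmeas_comp (f := u)) bu; exact: pair2_measurable. Qed.

(** Given (s, a), [tau] is the mean of the target, so integrating the expanded squares leaves only
    the squared distance to [tau]. The identity holds for each fixed context, as the exponential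
    moment bound demands. *)
Lemma mean_excess y :
  (\int[mudyn]_z excess (z, y) = \int[mudyn]_z gap2 (z, y))%R.
Proof.
rewrite Rintegral_dyn_law; last exact: slice bmeas_excess.
apply: eq_Rintegral => z _.
rewrite /excess /gap2 /in_ctx/=; set a := f' _; set b := tau _.
have bE : b = (\int[trans M z.1]_s' target (s', y.2))%R.
  by rewrite /b backupE/= -surjective_pairing.
have bt : bmeas (fun s' => target (s', y.2)) by apply: bmeas_state; exact: bmeas_target.
transitivity (\int[trans M z.1]_s' ((a ^+ 2 - b ^+ 2) - 2 * (a - b) * target (s', y.2)))%R.
  by apply: eq_Rintegral => s' _; ring.
rewrite bRintegralB//; [|exact: bmeas_cst|exact: bmeasZ].
by rewrite bRintegral_cst// bRintegralZ// -bE; ring.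
Qed.

Lemma excess_variance y :
  (\int[mudyn]_z (excess (z, y) ^+ 2) <= 9 * \int[mudyn]_z excess (z, y))%R.
Proof.
rewrite mean_excess -bRintegralZ//; last exact: slice bmeas_gap2.
apply: le_bRintegral => //.
- by apply: bmeasX; exact: slice bmeas_excess.
- by apply: bmeasZ; exact: slice bmeas_gap2.
- by move=> z; exact: sqr_excess_le.
Qed.

(** The context is integrated last, contrary to [sqnorm_dyn], because the inner integral is the
    function of the context whose sample average must be compared with its mean. *)
Definition risk : R := (\int[mugoal]_y \int[mudyn]_z gap2 (z, y))%R.

End one_regression.

End regression.

(** * Empirical excess for fixed functions, and its stability under perturbation *)

Section empirical.
Context (R : realType) (dS dA dC : measure_display) (S : measurableType dS)
  (A : measurableType dA) (C : measurableType dC).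
Let X : measurableType _ := (S * C)%type.
Let Z : measurableType _ := (S * A * S)%type.
Context (M : cgo R S A C) (gamma : R) (gamma01 : 0 <= gamma < 1)
  (mudyn : probability (S * A * S)%type R) (mugoal : probability (S * C)%type R).
Hypothesis mudyn_law : dyn_law M mudyn.
Context dO (Om : measurableType dO) (Pr : probability Om R) (n m : nat)
  (Ddyn : 'I_n -> {RV Pr >-> (S * A * S)%type})
  (Dgoal : 'I_m -> {RV Pr >-> (S * C)%type}).
Hypotheses (n0 : (0 < n)%N) (m0 : (0 < m)%N).
Hypothesis data : iid_data mudyn mugoal Ddyn Dgoal.

Let gamma0 : 0 <= gamma. Proof. by case/andP: gamma01. Qed.
Let gamma1 : gamma <= 1. Proof. by case/andP: gamma01 => _ /ltW. Qed.

Definition dyn_mean (u : Z * X -> R) om : R :=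
  (n * m)%:R^-1 * \sum_(i < n) \sum_(j < m) u (Ddyn i om, Dgoal j om).

Lemma dyn_mean_dist u v e om : (forall t, `|u t - v t| <= e) ->
  `|dyn_mean u om - dyn_mean v om| <= e.
Proof.
move=> uv; rewrite /dyn_mean -mulrBr -sumrB.
have nm0 : (0 : R) < (n * m)%:R by rewrite ltr0n muln_gt0 n0.
rewrite normrM ger0_norm ?invr_ge0// ler_pdivrMl//.
apply: le_trans (ler_norm_sum _ _ _) _.
apply: (@le_trans _ _ (\sum_(i < n) \sum_(j < m) e)).
  apply: ler_sum => i _; rewrite -sumrB; apply: le_trans (ler_norm_sum _ _ _) _.
  by apply: ler_sum => j _; exact: uv.
by rewrite !sumr_const !card_ord -mulrnA mulr_natl mulnC.
Qed.

Lemma loss_dynE (pi : R.-pker (S * C) ~> A) (f' f : X * A -> R) (g' g : X -> R) om :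
  loss_dyn gamma (aug_dyn R [seq Ddyn i om | i <- enum 'I_n] [seq Dgoal j om | j <- enum 'I_m])
    pi (f', g') (f, g) =
  dyn_mean (fun t => (f' (in_ctx t.1 t.2) - target gamma pi f g (t.1.2, t.2.2)) ^+ 2) om.
Proof.
rewrite /loss_dyn /dyn_mean /aug_dyn size_allpairs !size_map -!enumT !size_enum_ord.
congr (_ * _); rewrite big_allpairs_dep big_map big_enum/=; apply: eq_bigr => i _.
by rewrite big_map big_enum/=; apply: eq_bigr => j _.
Qed.

Lemma loss_dyn_excess (pi : R.-pker (S * C) ~> A) (f' f : X * A -> R) (g1 g2 g : X -> R) om :
  let D := aug_dyn R [seq Ddyn i om | i <- enum 'I_n] [seq Dgoal j om | j <- enum 'I_m] in
  loss_dyn gamma D pi (f', g1) (f, g) -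
    loss_dyn gamma D pi (backup M gamma pi f g, g2) (f, g) =
  dyn_mean (excess M gamma pi f' f g) om.
Proof.
rewrite /= !loss_dynE /dyn_mean -mulrBr -sumrB; congr (_ * _).
by apply: eq_bigr => i _; rewrite -sumrB.
Qed.

(** [two_sample_tail] is applied to [excess], and then with the two samples exchanged to [v], the
    mean over the dynamics as a function of the context. Each application keeps half of the mean,
    hence the factor 1 / 4; the error 36 L / m of the second one is halved by the first. *)
Lemma excess_tail (pi : R.-pker (S * C) ~> A) (f' f : X * A -> R) (g : X -> R) (L : R) :
  measurable_fun [set: X * A] f' -> (forall z, 0 <= f' z <= 1) ->
  measurable_fun [set: X * A] f -> (forall z, 0 <= f z <= 1) ->
  measurable_fun [set: X] g -> (forall x, 0 <= g x <= 1) ->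
  exists2 D : set Om, measurable D /\ (Pr D <= (2 * expR (- L))%:E)%E &
    forall om, ~ D om ->
      risk M gamma mudyn mugoal pi f' f g / 4 - 36 * L / n%:R - 18 * L / m%:R <=
      dyn_mean (excess M gamma pi f' f g) om.
Proof.
have arith (a V L' u t : R) : V / 2 - 36 * L' * t <= a ->
  V / 4 - 36 * L' * u - 18 * L' * t <= a / 2 - 36 * L' * u by lra.
move=> mf' f'01 mf f01 mg g01.
pose w := excess M gamma pi f' f g.
have bw : bmeas w by exact: bmeas_excess.
have [D1 [mD1 PD1] D1P] := two_sample_tail data L n0 m0 bw.1
  (norm_excess M gamma01 pi f'01 mf f01 mg g01)
  (excess_variance gamma01 mudyn_law pi mf' f'01 mf f01 mg g01).
pose v y := (\int[mudyn]_z gap2 M gamma pi f' f g (z, y))%R.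
have bgap : bmeas (gap2 M gamma pi f' f g) by exact: bmeas_gap2.
have bv : bmeas v.
  apply: (bmeas_Rintegral_snd mudyn (l := fun t => gap2 M gamma pi f' f g (t.2, t.1))).
  by apply: (bmeas_comp (f := gap2 M gamma pi f' f g)) bgap; exact: measurable_fun_pair.
have gap01 t : 0 <= gap2 M gamma pi f' f g t <= 1.
  rewrite /gap2 sqr_ge0/=.
  have := f'01 (in_ctx t.1 t.2).
  have := backup01 M gamma01 pi mf f01 mg g01 (in_ctx t.1 t.2).
  by move: (f' _) (backup _ _ _ _ _ _) => a b /andP[? ?] /andP[? ?]; nra.
have v01 y : 0 <= v y <= 1.
  apply: bRintegral01 => //.
  by case: (bmeas_comp (h := fun z => (z, y)) (pair2_measurable y) bgap).
have data' : forall (A0 : 'I_m -> set X) (B : 'I_n -> set Z),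
  (forall i, measurable (A0 i)) -> (forall j, measurable (B j)) ->
  Pr ((\bigcap_(i in [set: 'I_m]) (Dgoal i @^-1` A0 i)) `&`
      (\bigcap_(j in [set: 'I_n]) (Ddyn j @^-1` B j))) =
  ((\prod_(i < m) mugoal (A0 i)) * (\prod_(j < n) mudyn (B j)))%E.
  by move=> A0 B mA mB; rewrite setIC muleC data.
have mw2 : measurable_fun [set: X * Z] (fun t => v t.1).
  by case: (bmeas_comp (h := (fst : X * Z -> X)) measurable_fst bv).
have w23 (t : X * Z) : `|v t.1| <= 3.
  by rewrite ger0_norm; case/andP: (v01 t.1) => ? ?; lra.
have var2 (z : Z) : (\int[mugoal]_y (v y ^+ 2) <= 9 * \int[mugoal]_y v y)%R.
  rewrite -bRintegralZ//; apply: le_bRintegral => //; [exact: bmeasX|exact: bmeasZ|].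
  by move=> y; case/andP: (v01 y) => ? ?; nra.
have [D2 [mD2 PD2] D2P] := two_sample_tail (w := fun t => v t.1) data' L m0 n0 mw2 w23 var2.
exists (D1 `|` D2).
  split; first exact: measurableU.
  apply: le_trans (measureU2 _ mD1 mD2) _.
  by rewrite mulr2n mulrDl mul1r EFinD leeD.
move=> om /not_orP[/D1P h1 /D2P h2].
apply: le_trans h1; move: h2 => /=.
have -> : \int[mugoal]_y v y = risk M gamma mudyn mugoal pi f' f g by [].
set V := risk _ _ _ _ _ _ _ _.
have -> : n%:R^-1 * (\sum_(j < n) V / 2) = V / 2 :> R.
  by rewrite sumr_const card_ord -[(V / 2) *+ n]mulr_natl mulKf// pnatr_eq0 -lt0n.
have -> : (m * n)%:R^-1 * (\sum_(i < m) \sum_(j < n) v (Dgoal i om)) =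
    m%:R^-1 * \sum_(j < m) v (Dgoal j om).
  under eq_bigr do rewrite sumr_const card_ord -[v _ *+ n]mulr_natl.
  by rewrite -mulr_sumr natrM invfM -mulrA mulKf// pnatr_eq0 -lt0n.
rewrite -mulr_suml.
have -> : \sum_(i < m) (\int[mudyn]_x w (x, Dgoal i om))%R = \sum_(j < m) v (Dgoal j om).
  by apply: eq_bigr => j _; exact: mean_excess.
by rewrite mulrA; exact: arith.
Qed.

Section stability.
Variables (e : R) (pi pi' : R.-pker (S * C) ~> A) (f1 f1' f f' : X * A -> R) (g g' : X -> R).
Hypotheses (mf1 : measurable_fun [set: X * A] f1) (f1_01 : forall z, 0 <= f1 z <= 1).
Hypotheses (mf1' : measurable_fun [set: X * A] f1') (f1'_01 : forall z, 0 <= f1' z <= 1).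
Hypotheses (mf : measurable_fun [set: X * A] f) (f01 : forall z, 0 <= f z <= 1).
Hypotheses (mf' : measurable_fun [set: X * A] f') (f'01 : forall z, 0 <= f' z <= 1).
Hypotheses (mg : measurable_fun [set: X] g) (g01 : forall x, 0 <= g x <= 1).
Hypotheses (mg' : measurable_fun [set: X] g') (g'01 : forall x, 0 <= g' x <= 1).
Hypotheses (df1 : forall z, `|f1 z - f1' z| <= e) (df : forall z, `|f z - f' z| <= e)
  (dg : forall x, `|g x - g' x| <= e)
  (dpi : forall x, (dist_l1 (pi x) (pi' x) <= e%:E)%E).

Let e0 : 0 <= e. Proof. exact: le_trans (normr_ge0 _) (df (point)). Qed.

(** The maximum is 1-Lipschitz, and f(x, pi) moves by [e] for the change of f and by another [e] for
    the change of policy. *)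
Lemma target_dist x : `|target gamma pi f g x - target gamma pi' f' g' x| <= 2 * e.
Proof.
rewrite /target -mulrBr normrM (ger0_norm gamma0).
apply: (@le_trans _ _ `|Num.max (g x) (at_policy f pi x) -
    Num.max (g' x) (at_policy f' pi' x)|).
  by rewrite ler_piMl.
have bf : bmeas (fun a => f (x, a)) by apply: bmeas_act; exact: bmeas01.
have bf' : bmeas (fun a => f' (x, a)) by apply: bmeas_act; exact: bmeas01.
have h1 : `|at_policy f pi x - at_policy f' pi x| <= e.
  by apply: bRintegral_dist => // a; exact: df.
have h2 : `|at_policy f' pi x - at_policy f' pi' x| <= e.
  apply: (Rintegral_dist_l1 _ _ bf'.1) (dpi x) => //.
have := dg x; move: h1 h2 e0; rewrite /Num.max.
move: (at_policy _ _ _) (at_policy f' pi x) (at_policy f' pi' x) (g x) (g' x) => a b c u v.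
rewrite !ler_norml => /andP[? ?] /andP[? ?] ? /andP[? ?].
by case: (ltP u a) => ?; case: (ltP v c) => ?; apply/andP; split; lra.
Qed.

Lemma backup_dist z : `|backup M gamma pi f g z - backup M gamma pi' f' g' z| <= 2 * e.
Proof.
rewrite !backupE//; apply: bRintegral_dist => //.
- by apply: bmeas_state; exact: bmeas_target.
- by apply: bmeas_state; exact: bmeas_target.
- by move=> s'; exact: target_dist.
Qed.

(** Squaring is 2-Lipschitz on [-1, 1]. The two differences inside the squares move by e + 2 e and
    by 2 e + 2 e, hence 14 = 2 * 3 + 2 * 4. *)
Lemma excess_dist t :
  `|excess M gamma pi f1 f g t - excess M gamma pi' f1' f' g' t| <= 14 * e.
Proof.
rewrite /excess; set z := in_ctx _ _; set x := (_, _).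
have := f1_01 z; have := f1'_01 z; have := target01 gamma01 pi mf f01 g01 x.
have := target01 gamma01 pi' mf' f'01 g'01 x.
have := backup01 M gamma01 pi mf f01 mg g01 z.
have := backup01 M gamma01 pi' mf' f'01 mg' g'01 z.
have := df1 z; have := backup_dist z; have := target_dist x; have := e0.
move: (f1 z) (f1' z) (target _ _ _ _ _) (target _ pi' _ _ _)
  (backup _ _ _ _ _ _) (backup _ _ pi' _ _ _) => a a' c c' b b'.
rewrite !ler_norml => ? /andP[? ?] /andP[? ?] /andP[? ?].
move=> /andP[? ?] /andP[? ?] /andP[? ?] /andP[? ?] /andP[? ?] /andP[? ?].
apply/andP; split; nra.
Qed.

Lemma gap2_dist t :
  `|gap2 M gamma pi f1 f g t - gap2 M gamma pi' f1' f' g' t| <= 6 * e.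
Proof.
rewrite /gap2; set z := in_ctx _ _.
have := f1_01 z; have := f1'_01 z.
have := backup01 M gamma01 pi mf f01 mg g01 z.
have := backup01 M gamma01 pi' mf' f'01 mg' g'01 z.
have := df1 z; have := backup_dist z; have := e0.
move: (f1 z) (f1' z) (backup _ _ _ _ _ _) (backup _ _ pi' _ _ _) => a a' b b'.
rewrite !ler_norml => ? /andP[? ?] /andP[? ?].
move=> /andP[? ?] /andP[? ?] /andP[? ?] /andP[? ?].
apply/andP; split; nra.
Qed.

Lemma risk_dist :
  `|risk M gamma mudyn mugoal pi f1 f g - risk M gamma mudyn mugoal pi' f1' f' g'| <= 6 * e.
Proof.
have bgap p u v w : bmeas (gap2 M gamma p u v w) ->
    bmeas (fun y => (\int[mudyn]_z gap2 M gamma p u v w (z, y))%R).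
  move=> b; apply: (bmeas_Rintegral_snd mudyn (l := fun t => gap2 M gamma p u v w (t.2, t.1))).
  by apply: (bmeas_comp (f := gap2 M gamma p u v w)) b; exact: measurable_fun_pair.
have b1 : bmeas (gap2 M gamma pi f1 f g) by exact: bmeas_gap2.
have b2 : bmeas (gap2 M gamma pi' f1' f' g') by exact: bmeas_gap2.
apply: bRintegral_dist => //; try exact: bgap.
move=> y; apply: bRintegral_dist => //.
- by apply: (bmeas_comp (f := gap2 M gamma pi f1 f g)) b1; exact: pair2_measurable.
- by apply: (bmeas_comp (f := gap2 M gamma pi' f1' f' g')) b2; exact: pair2_measurable.
- by move=> z; exact: gap2_dist.
Qed.

End stability.

End empirical.

(** * Uniform bounds over the classes *)

Section uniform_event.
Context (R : realType) (dS dA dC : measure_display) (S : measurableType dS)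
  (A : measurableType dA) (C : measurableType dC).
Let X : measurableType _ := (S * C)%type.
Let Z : measurableType _ := (S * A * S)%type.
Context (M : cgo R S A C) (gamma : R) (gamma01 : 0 <= gamma < 1)
  (mudyn : probability (S * A * S)%type R) (mugoal : probability (S * C)%type R).
Hypotheses (mudyn_law : dyn_law M mudyn) (mugoal_law : goal_law M mugoal).
Context dO (Om : measurableType dO) (Pr : probability Om R) (n m : nat)
  (Ddyn : 'I_n -> {RV Pr >-> (S * A * S)%type})
  (Dgoal : 'I_m -> {RV Pr >-> (S * C)%type}).
Hypotheses (n0 : (0 < n)%N) (m0 : (0 < m)%N).
Hypothesis data : iid_data mudyn mugoal Ddyn Dgoal.
Context (F : set (X * A -> R)) (G : set (X -> R)) (Pi : set (R.-pker (S * C) ~> A)).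
Hypotheses (F01 : class01 F) (G01 : class01 G).

Lemma dist_supP (T : Type) (u v : T -> R) e : (dist_sup u v <= e%:E)%E ->
  forall x, `|u x - v x| <= e.
Proof.
by move=> uv x; rewrite -lee_fin; apply: le_trans uv; apply: ereal_sup_ubound; exists x.
Qed.

Lemma dist_policyP (p q : R.-pker (S * C) ~> A) e : (dist_policy p q <= e%:E)%E ->
  forall x, (dist_l1 (p x) (q x) <= e%:E)%E.
Proof. by move=> pq x; apply: le_trans pq; apply: ereal_sup_ubound; exists x. Qed.

(** [f'] and [f] vary separately, so the cover of [F] is counted twice. Passing from centres to the
    class costs 6 e / 4 for the risk and 14 e for the empirical mean, rounded up to 16 e. *)
Lemma dyn_event (e L : R) kF kG kP (cF : 'I_kF -> X * A -> R) (cG : 'I_kG -> X -> R)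
    (cP : 'I_kP -> R.-pker (S * C) ~> A) : 0 <= e ->
  (forall i, F (cF i)) -> (forall i, G (cG i)) ->
  (forall f, F f -> exists i, (dist_sup (cF i) f <= e%:E)%E) ->
  (forall g, G g -> exists i, (dist_sup (cG i) g <= e%:E)%E) ->
  (forall pi, Pi pi -> exists i, (dist_policy (cP i) pi <= e%:E)%E) ->
  exists2 B : set Om,
    measurable B /\ (Pr B <= ((kF * kF * kG * kP)%:R * (2 * expR (- L)))%:E)%E &
    forall om, ~ B om -> forall pi f' f g, Pi pi -> F f' -> F f -> G g ->
      risk M gamma mudyn mugoal pi f' f g / 4 - 36 * L / n%:R - 18 * L / m%:R - 16 * e <=
      dyn_mean Ddyn Dgoal (excess M gamma pi f' f g) om.
Proof.
have arith (r r' d d' a b e' : R) : 0 <= e' -> r / 4 - a - b <= d ->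
    `|r - r'| <= 6 * e' -> `|d - d'| <= 14 * e' -> r' / 4 - a - b - 16 * e' <= d'.
  by rewrite !ler_norml => e'0 h /andP[h1 h2] /andP[h3 h4]; lra.
move=> e0 FcF GcG covF covG covP.
pose D0 (t : 'I_kF * 'I_kF * 'I_kG * 'I_kP) :=
  excess_tail gamma01 mudyn_law n0 m0 data (cP t.2) L
    (F01 (FcF t.1.1.1)).1 (F01 (FcF t.1.1.1)).2
    (F01 (FcF t.1.1.2)).1 (F01 (FcF t.1.1.2)).2 (G01 (GcG t.1.2)).1 (G01 (GcG t.1.2)).2.
pose D t := sval (cid2 (D0 t)).
have DP t : measurable (D t) /\ (Pr (D t) <= (2 * expR (- L))%:E)%E.
  by rewrite /D; case: cid2.
have [B [mB PB] DB] := union_bound DP.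
exists B; first by rewrite !card_prod !card_ord in PB.
move=> om Bom pi f' f g Ppi Ff' Ff Gg.
have [i1 d1] := covF _ Ff'; have [i2 d2] := covF _ Ff.
have [i3 d3] := covG _ Gg; have [i4 d4] := covP _ Ppi.
have := DB om Bom (i1, i2, i3, i4); rewrite /D; case: cid2 => D' _ D'P /=.
move=> /D'P /arith; apply => //.
  exact: (risk_dist M gamma01 mudyn mugoal (F01 (FcF i1)).1 (F01 (FcF i1)).2
   (F01 Ff').1 (F01 Ff').2 (F01 (FcF i2)).1 (F01 (FcF i2)).2 (F01 Ff).1 (F01 Ff).2
   (G01 (GcG i3)).1 (G01 (GcG i3)).2 (G01 Gg).1 (G01 Gg).2
   (dist_supP d1) (dist_supP d2) (dist_supP d3) (dist_policyP d4)).
apply: dyn_mean_dist => // t.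
exact: (excess_dist M gamma01 (F01 (FcF i1)).2
   (F01 Ff').2 (F01 (FcF i2)).1 (F01 (FcF i2)).2 (F01 Ff).1 (F01 Ff).2
   (G01 (GcG i3)).1 (G01 (GcG i3)).2 (G01 Gg).1 (G01 Gg).2
   (dist_supP d1) (dist_supP d2) (dist_supP d3) (dist_policyP d4)).
Qed.

Let data' : forall (A0 : 'I_m -> set X) (B : 'I_n -> set Z),
  (forall i, measurable (A0 i)) -> (forall j, measurable (B j)) ->
  Pr ((\bigcap_(i in [set: 'I_m]) (Dgoal i @^-1` A0 i)) `&`
      (\bigcap_(j in [set: 'I_n]) (Ddyn j @^-1` B j))) =
  ((\prod_(i < m) mugoal (A0 i)) * (\prod_(j < n) mudyn (B j)))%E.
Proof. by move=> A0 B mA mB; rewrite setIC muleC data. Qed.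

(** If [g] is 1 on the goal data, its centre is within [e] of 1 there and has empirical loss at most
    [e]. Since [two_sample_tail] controls half of the mean, this becomes 2 e, and returning from the
    centre to [g] adds 2 e. *)
Lemma goal_event (e L : R) kG (cG : 'I_kG -> X -> R) : 0 <= e ->
  (forall i, G (cG i)) ->
  (forall g, G g -> exists i, (dist_sup (cG i) g <= e%:E)%E) ->
  exists2 B : set Om, measurable B /\ (Pr B <= (kG%:R * expR (- L))%:E)%E &
    forall om, ~ B om -> forall g, G g -> (forall j, g (Dgoal j om) = 1) ->
      (\int[mugoal]_y ((g y - 1) ^+ 2))%R <= 72 * L / m%:R + 4 * e.
Proof.
move=> e0 GcG covG.
have arith (u v a : R) : u / 2 - 36 * L * a <= e -> `|u - v| <= 2 * e ->
    v <= 72 * L * a + 4 * e.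
  by rewrite ler_norml => h /andP[h1 h2]; lra.
have bsq g : G g -> bmeas (fun y : X => (g y - 1) ^+ 2).
  move=> Gg; apply: bmeasX; apply: bmeasB; last exact: bmeas_cst.
  by apply: bmeas01; [exact: (G01 Gg).1|exact: (G01 Gg).2].
have sq01 g y : G g -> 0 <= (g y - 1) ^+ 2 <= 1.
  by move=> Gg; rewrite sqr_ge0/=; case/andP: ((G01 Gg).2 y) => ? ?; nra.
have tail i : exists2 D : set Om, measurable D /\ (Pr D <= (expR (- L))%:E)%E &
    forall om, ~ D om ->
      n%:R^-1 * \sum_(j < n) ((\int[mugoal]_y ((cG i y - 1) ^+ 2))%R / 2) - 36 * L / m%:R <=
      (m * n)%:R^-1 * \sum_(j < m) \sum_(l < n) (cG i (Dgoal j om) - 1) ^+ 2.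
  apply: (two_sample_tail (w := fun t : X * Z => (cG i t.1 - 1) ^+ 2) data' L m0 n0).
  - by have [] := bmeas_comp (h := (fst : X * Z -> X)) measurable_fst (bsq _ (GcG i)).
  - by move=> t; case/andP: (sq01 _ t.1 (GcG i)) => ? ?; rewrite ger0_norm//; lra.
  - move=> _ /=; rewrite -bRintegralZ//; last by apply: bsq; exact: GcG.
    apply: le_bRintegral => //=.
    + by apply: bmeasX; apply: bsq; exact: GcG.
    + by apply: bmeasZ; apply: bsq; exact: GcG.
    + by move=> y; case/andP: (sq01 _ y (GcG i)) => ? ?; nra.
pose D i := sval (cid2 (tail i)).
have DP i : measurable (D i) /\ (Pr (D i) <= (expR (- L))%:E)%E.
  by rewrite /D; case: cid2.
have [B [mB PB] DB] := union_bound DP.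
exists B; first by rewrite card_ord in PB.
move=> om Bom g Gg gD; have [i di] := covG _ Gg.
have := DB om Bom i; rewrite /D; case: cid2 => D' _ D'P /= /D'P h.
apply: (arith (\int[mugoal]_y ((cG i y - 1) ^+ 2))%R); last first.
  apply: bRintegral_dist => //; [exact: bsq|exact: bsq|].
  move=> y; have := dist_supP di y.
  case/andP: ((G01 Gg).2 y) => ? ?; case/andP: ((G01 (GcG i)).2 y) => ? ?.
  by rewrite !ler_norml => /andP[? ?]; apply/andP; split; nra.
have nn : (n%:R : R) != 0 by rewrite pnatr_eq0 -lt0n.
have mn : (0 : R) < (m * n)%:R by rewrite ltr0n muln_gt0 m0.
move: h; rewrite sumr_const card_ord.
set V := (\int[mugoal]_y _)%R.
rewrite -[(V / 2) *+ n]mulr_natl mulKf// => /le_trans; apply.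
rewrite ler_pdivrMl//.
apply: (@le_trans _ _ (\sum_(j < m) \sum_(l < n) e)).
  apply: ler_sum => j _; apply: ler_sum => l _.
  have := dist_supP di (Dgoal j om); rewrite gD.
  case/andP: ((G01 (GcG i)).2 (Dgoal j om)) => ? ?.
  by rewrite !ler_norml => /andP[? ?]; nra.
by rewrite !sumr_const !card_ord -mulrnA mulr_natl mulnC.
Qed.

(** Off this null event R has zero goal loss on the data, so a pair with second component R meets
    the exact constraint [loss_goal <= 0]. *)
Lemma goal_sample_event :
  exists2 B : set Om, measurable B /\ (Pr B <= 0)%E &
    forall om, ~ B om -> forall j, goal M (Dgoal j om).
Proof.
have mG : measurable (~` goal M) by apply: measurableC; exact: measurable_goal_set.
pose D j := Dgoal j @^-1` (~` goal M).
have DP j : measurable (D j) /\ (Pr (D j) <= 0%:E)%E.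
  split; first by rewrite -[X in measurable X]setTI; exact: measurable_funP.
  have -> : D j = (\bigcap_(i in [set: 'I_m]) (Dgoal i @^-1`
      (if i == j then ~` goal M else setT))) `&`
      (\bigcap_(i in [set: 'I_n]) (Ddyn i @^-1` setT)).
    apply/seteqP; split => om.
      by move=> Dom; split => // i _; rewrite /preimage/=; case: eqP => [->|].
    by move=> [/(_ j I)]; rewrite /preimage/= eqxx.
  rewrite data'//; last by move=> i; case: ifP.
  by rewrite (bigD1 j)//= eqxx [X in (X * _ * _)%E]mugoal_law !mul0e.
have [B [mB PB] DB] := union_bound DP.
exists B; first by rewrite mulr0 in PB.
by move=> om Bom j; apply: contrapT => nG; exact: (DB om Bom j).
Qed.

End uniform_event.

(** * Concentrability coefficients, and the optimal backup as a fixed point *)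

Section suboptimality.
Context (R : realType) (dS dA dC : measure_display) (S : measurableType dS)
  (A : measurableType dA) (C : measurableType dC).
Let X : measurableType _ := (S * C)%type.
Context (M : cgo R S A C) (gamma : R) (gamma01 : 0 <= gamma < 1)
  (mudyn : probability (S * A * S)%type R) (mugoal : probability (S * C)%type R).
Hypotheses (mugoal_law : goal_law M mugoal).
Context (F : set (X * A -> R)) (G : set (X -> R)) (Pi : set (R.-pker (S * C) ~> A)).
Hypotheses (F01 : class01 F) (G01 : class01 G).
Hypotheses (FGPi_real : realizability M gamma F G Pi)
  (FGPi_compl : completeness M gamma F G Pi).

Lemma measurable_reward : measurable_fun [set: X] (reward M).
Proof. by apply: (measurable_indicP R (goal M)).1; exact: measurable_goal_set. Qed.

Lemma reward01 x : 0 <= reward M x <= 1.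
Proof. by rewrite /reward indicE; case: (_ \in _); rewrite lexx ler01. Qed.

Let G_reward : G (reward M). Proof. exact: FGPi_real.2. Qed.

Lemma backup_class pi f g : Pi pi -> F f -> G g -> F (backup M gamma pi f g).
Proof.
move=> Ppi Ff Gg; have [Fm _] := FGPi_compl Ff Gg Ppi.
exact: (FGPi_compl Fm Gg Ppi).2.
Qed.

(** How a coefficient transfers an error bound from the data to an occupancy measure. In the case 0
    / 0 the numerator is zero anyway, and x / 0 with x > 0 is excluded by the finite bound [c]. *)
Lemma ratio_le (x y : \bar R) (c r : R) : 0 <= c -> (0 <= x)%E -> (0 <= y)%E ->
  (y <= r%:E)%E -> (ratio x y <= c%:E)%E -> (x <= (c * r)%:E)%E.
Proof.
move=> c0 x0 y0 yr; rewrite /ratio; case: ifPn => [/andP[/eqP-> /eqP ye] _|].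
  by rewrite lee_fin mulr_ge0// -lee_fin (le_trans y0).
move: y y0 yr => [y| |]// y0 yr; rewrite lee_fin in yr.
have [y00|yn0] := eqVneq y 0.
  rewrite y00 eqxx andbT => xn0; rewrite inve0 gt0_muley//.
  by rewrite lt_neqAle eq_sym xn0.
have yp : 0 < y by rewrite lt_neqAle eq_sym yn0 -lee_fin.
move=> _; rewrite inver (negPf yn0) lee_pdivrMr// => /le_trans; apply.
by rewrite -EFinM lee_fin ler_wpM2l.
Qed.

Let expect_traj0 pi t : expect_traj M pi t (fun=> 0%E) = 0%E.
Proof.
rewrite /expect_traj (eq_integral (cst 0%E)) ?integral0// => x _.
by rewrite (eq_integral (cst 0%E)) ?integral0// => a _; exact: expect_from0.
Qed.

(** The pair (T^pi q, q) has no error at all, and 0 / 0 counts as 1. *)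
Lemma Cdyn_ge1 pi : Pi pi -> (1 <= Cdyn M gamma F mudyn mugoal pi)%E.
Proof.
move=> Ppi; have [q Fq _] := FGPi_real.1 _ Ppi.
have Fb := (FGPi_compl Fq G_reward Ppi).2.
apply: ereal_sup_ubound; exists (bellman M gamma pi q, q) => //=.
have E0 : (fun z => (bellman M gamma pi q z - bellman M gamma pi q z) ^+ 2) = fun=> 0.
  by apply/funext => z; rewrite subrr expr0n.
rewrite /ratio E0.
rewrite [int_occ_notG _ _ _ _](_ : _ = 0%E); last first.
  apply: eseries0 => t _ _; rewrite [expect_traj _ _ _ _](_ : _ = 0%E) ?mule0//.
  rewrite -[RHS](expect_traj0 pi t); congr expect_traj; apply/funext => h.
  by case: ifP => // _; case: (last _ h).1 => -[].
rewrite [sqnorm_dyn _ _ _](_ : _ = 0%E) ?eqxx//.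
rewrite /sqnorm_dyn (eq_integral (cst 0%E)) ?integral0// => z _.
by rewrite (eq_integral (cst 0%E)) ?integral0// => y _; rewrite subrr expr0n.
Qed.

Lemma Cgoal_ge1 pi : (1 <= Cgoal M gamma G mugoal pi)%E.
Proof.
apply: ereal_sup_ubound; exists (reward M) => //=.
have E0 : (fun x => (reward M x - reward M x) ^+ 2) = fun=> 0.
  by apply/funext => z; rewrite subrr expr0n.
rewrite /ratio E0.
rewrite [int_occ_G _ _ _ _](_ : _ = 0%E); last first.
  apply: eseries0 => t _ _; rewrite [expect_traj _ _ _ _](_ : _ = 0%E) ?mule0//.
  rewrite -[RHS](expect_traj0 pi t); congr expect_traj; apply/funext => h.
  by case: ifP => // _; case: (last _ h).1 => -[].
rewrite [sqnorm_goal _ _](_ : _ = 0%E) ?eqxx//.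
by rewrite /sqnorm_goal (eq_integral (cst 0%E)) ?integral0// => y _; rewrite subrr expr0n.
Qed.

Lemma sqnorm_dyn_risk pi f' f g : F f' -> F f -> G g ->
  sqnorm_dyn mudyn mugoal (fun z => f' z - backup M gamma pi f g z) =
  (risk M gamma mudyn mugoal pi f' f g)%:E.
Proof.
move=> /F01[mf' f'01] /F01[mf f01] /G01[mg g01].
have bgap : bmeas (gap2 M gamma pi f' f g) by exact: bmeas_gap2.
transitivity (\int[mudyn]_z \int[mugoal]_y (EFin \o gap2 M gamma pi f' f g) (z, y))%E.
  by [].
rewrite fubini_tonelli; last 2 first.
- by apply/measurable_EFinP; case: bgap.
- by move=> t; rewrite /= lee_fin sqr_ge0.
rewrite /risk -integral_bmeas//; last first.
  apply: (bmeas_Rintegral_snd mudyn (l := fun t => gap2 M gamma pi f' f g (t.2, t.1))).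
  by apply: (bmeas_comp (f := gap2 M gamma pi f' f g)) bgap; exact: measurable_fun_pair.
apply: eq_integral => y _; rewrite integral_bmeas//.
by apply: (bmeas_comp (f := gap2 M gamma pi f' f g)) bgap; exact: pair2_measurable.
Qed.

(** By [goal_law], R is 1 almost everywhere for [mugoal]. *)
Lemma sqnorm_goalE g : G g ->
  sqnorm_goal mugoal (fun x => g x - reward M x) =
  (\int[mugoal]_y ((g y - 1) ^+ 2))%R%:E.
Proof.
move=> Gg; have [mg g01] := G01 Gg.
have bg : bmeas g by exact: bmeas01.
have br : bmeas (reward M) by apply: bmeas01; [exact: measurable_reward|exact: reward01].
have b1 : bmeas (fun y => (g y - 1) ^+ 2).
  by apply: bmeasX; apply: bmeasB => //; exact: bmeas_cst.
have b2 : bmeas (fun y => (g y - reward M y) ^+ 2) by apply: bmeasX; exact: bmeasB.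
rewrite -integral_bmeas//; apply: ae_eq_integral => //.
- by apply/measurable_EFinP; case: b2.
- by apply/measurable_EFinP; case: b1.
exists (~` goal M); split => //.
  by apply: measurableC; exact: measurable_goal_set.
move=> y /= ny Gy; apply: ny => _; rewrite /reward indicE.
by rewrite mem_set.
Qed.

Lemma Jval_at_policy pi q : F q -> (forall x a, Qfun M gamma pi x a = (q (x, a))%:E) ->
  Jval M gamma pi = (\int[init M]_x at_policy q pi x)%R%:E.
Proof.
move=> /F01[mq q01] qE; have bq : bmeas q by exact: bmeas01.
rewrite -integral_bmeas//; last exact: bmeas_at_policy.
apply: eq_integral => x _; rewrite -integral_bmeas//; last exact: bmeas_act.
by apply: eq_integral => a _; exact: qE.
Qed.

Section optimal_backup.
Variables (pi : R.-pker (S * C) ~> A) (q : X * A -> R).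
Hypotheses (Ppi : Pi pi) (Fq : F q).
Hypothesis qE : forall x a, Qfun M gamma pi x a = (q (x, a))%:E.

Let bq : bmeas q. Proof. by apply: bmeas01; [exact: (F01 Fq).1|exact: (F01 Fq).2]. Qed.

Let qf := backup M gamma pi q (reward M).

Let q_goal x a : x \in goal M -> q (x, a) = 1.
Proof.
move=> xG; have := Qfun_rec M gamma01 pi x a.
by rewrite qE xG => -[].
Qed.

Let at_policy_goal (f : X * A -> R) x : F f -> x \in goal M ->
  Num.max (reward M x) (at_policy f pi x) = 1.
Proof.
move=> /F01[mf f01] xG; rewrite /reward indicE xG.
apply/eqP; rewrite eq_le le_max lexx ge_max lexx/= andbT.
by case/andP: (at_policy01 pi x mf f01).
Qed.

Let max_reward_q x : Num.max (reward M x) (at_policy q pi x) = at_policy q pi x.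
Proof.
case xG : (x \in goal M).
  rewrite at_policy_goal// /at_policy; under eq_Rintegral do rewrite q_goal//.
  by rewrite bRintegral_cst.
rewrite /reward indicE xG; apply/max_idPr.
by case/andP: (at_policy01 pi x (F01 Fq).1 (F01 Fq).2).
Qed.

Lemma backup_off_goal x a : x \notin goal M -> qf (x, a) = q (x, a).
Proof.
move=> xG; have := Qfun_rec M gamma01 pi x a; rewrite qE (negPf xG).
rewrite (_ : (fun z => _) = fun z => (q z)%:E); last first.
  by apply/funext => -[y b]; exact: qE.
rewrite next_mean_bellman//; last by move=> z; case/andP: ((F01 Fq).2 z).
move=> -[->]; rewrite /qf /backup /bellman; congr (_ * _).
by apply: eq_Rintegral => s' _; rewrite at_policy_max max_reward_q.
Qed.

Lemma backup_fixpoint : backup M gamma pi qf (reward M) = qf.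
Proof.
rewrite /qf [in RHS]/backup [in LHS]/backup; congr bellman; apply/funext => -[x a] /=.
case xG : (x \in goal M).
  by rewrite !at_policy_goal//; exact: backup_class.
congr Num.max; apply: eq_Rintegral => b _.
by apply: backup_off_goal; rewrite xG.
Qed.

Lemma objective_backup : objective M pi (qf, reward M) = Jval M gamma pi.
Proof.
apply: eq_integral => -[s c] _; rewrite /expect_pibar /fbar; cbn [fst snd].
case xG : ((s, c) \in goal M).
  rewrite (eq_integral (cst 1%E)); last by move=> a _; rewrite qE q_goal.
  by rewrite integral_cst// prob_kernel mule1 /reward indicE xG.
apply: eq_integral => a _; rewrite qE; congr (_ %:E).
by apply: backup_off_goal; rewrite xG.
Qed.

End optimal_backup.

End suboptimality.

(** With [l1] the loss of f, [l2] that of its backup and [i] the least loss: r / 4 <= e + t <= 2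
    e. *)
Lemma excess_to_risk (R : realType) (e t r l1 l2 i : R) :
  l1 - i <= e -> i <= l2 -> t <= e -> r / 4 - t <= l1 - l2 -> r <= 8 * e.
Proof. lra. Qed.

(** With [l2] the loss of the fixed point and [l1] that of a competitor: the risk is nonnegative, so
    sampling noise cannot bring the empirical excess below - e. *)
Lemma risk_to_excess (R : realType) (e t r l1 l2 : R) :
  t <= e -> 0 <= r -> r / 4 - t <= l1 - l2 -> l2 - e <= l1.
Proof. lra. Qed.

(** Here coefficients of at least 1 absorb the additive constants [x] and [y] of the error
    splitting. *)
Lemma coefficients_ge1_le (R : realType) (a b x y cd cg : R) :
  1 <= cd -> 1 <= cg -> 0 <= x -> 0 <= y ->
  a * cd + b * cg + (x + y) <= cd * (a + x) + cg * (b + y).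
Proof. by move=> *; nra. Qed.

(** * Suboptimality on the good event, a deterministic statement *)

Section good_event.
Context (R : realType) (dS dA dC : measure_display) (S : measurableType dS)
  (A : measurableType dA) (C : measurableType dC).
Let X : measurableType _ := (S * C)%type.
Let Z : measurableType _ := (S * A * S)%type.
Context (M : cgo R S A C) (gamma : R) (gamma01 : 0 <= gamma < 1)
  (mudyn : probability (S * A * S)%type R) (mugoal : probability (S * C)%type R).
Hypothesis mugoal_law : goal_law M mugoal.
Context dO (Om : measurableType dO) (Pr : probability Om R) (n m : nat)
  (Ddyn : 'I_n -> {RV Pr >-> (S * A * S)%type})
  (Dgoal : 'I_m -> {RV Pr >-> (S * C)%type}).
Hypothesis m0 : (0 < m)%N.
Context (F : set (X * A -> R)) (G : set (X -> R)) (Pi : set (R.-pker S * C ~> A)).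
Hypotheses (F01 : class01 F) (G01 : class01 G).
Hypotheses (FGPi_real : realizability M gamma F G Pi)
  (FGPi_compl : completeness M gamma F G Pi).
Context (om : Om) (e t u c2 c4 : R).
Hypotheses (c2_gt0 : 0 < c2) (c4_gt0 : 0 < c4) (e0 : 0 <= e) (te : t <= e) (u0 : 0 <= u).
Hypothesis risk_dyn_mean : forall pi f' f g, Pi pi -> F f' -> F f -> G g ->
  risk M gamma mudyn mugoal pi f' f g / 4 - t <=
  dyn_mean Ddyn Dgoal (excess M gamma pi f' f g) om.
Hypothesis risk_goal : forall g, G g -> (forall j, g (Dgoal j om) = 1) ->
  (\int[mugoal]_y ((g y - 1) ^+ 2))%R <= u.
Hypothesis Dgoal_goal : forall j, goal M (Dgoal j om).

Let Dd := [seq Ddyn i om | i <- enum 'I_n].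
Let Dg := [seq Dgoal j om | j <- enum 'I_m].
Let G_reward : G (reward M). Proof. exact: FGPi_real.2. Qed.

Let losses_lbound (pi : R.-pker S * C ~> A) (p : (X * A -> R) * (X -> R)) :
  has_lbound [set loss_dyn gamma (aug_dyn R Dd Dg) pi p' p | p' in F `*` G].
Proof.
exists 0 => _ [[f' g'] _ <-]; rewrite /loss_dyn mulr_ge0 ?invr_ge0// sumr_ge0//.
by move=> [[[x a] r] x'] _; exact: sqr_ge0.
Qed.

Let risk_ge0 pi f' f g : 0 <= risk M gamma mudyn mugoal pi f' f g.
Proof. by apply: Rintegral_ge0 => y _; apply: Rintegral_ge0 => z _; exact: sqr_ge0. Qed.

Lemma feasible_risk pi f g : Pi pi -> feasible gamma F G Dd Dg e%:E pi (f, g) ->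
  [/\ F f, G g, risk M gamma mudyn mugoal pi f f g <= 8 * e &
      (\int[mugoal]_y ((g y - 1) ^+ 2))%R <= u].
Proof.
move=> Ppi [[/= Ff Gg] ]; rewrite lee_fin => loss_f loss_g; split => //.
- have Fb := backup_class FGPi_compl Ppi Ff Gg.
  have inf_le : inf [set loss_dyn gamma (aug_dyn R Dd Dg) pi p' (f, g) | p' in F `*` G] <=
      loss_dyn gamma (aug_dyn R Dd Dg) pi (backup M gamma pi f g, g) (f, g).
    by apply: ge_inf => //; exists (backup M gamma pi f g, g).
  have := risk_dyn_mean Ppi Ff Ff Gg.
  rewrite -(loss_dyn_excess M gamma Ddyn Dgoal pi f f g g g om) -/Dd -/Dg.
  exact: excess_to_risk loss_f inf_le te.
- apply: risk_goal => // j.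
  have m0' : (0 : R) < m%:R by rewrite ltr0n.
  move: loss_g; rewrite /loss_goal /aug_goal !size_map -enumT size_enum_ord.
  rewrite big_map big_map big_enum/= ler_pdivrMl// mulr0 => loss_g.
  have : \sum_(j < m) (g (Dgoal j om) - 1) ^+ 2 == 0.
    by rewrite eq_le loss_g sumr_ge0// => i _; exact: sqr_ge0.
  rewrite psumr_eq0; last by move=> i _; exact: sqr_ge0.
  move=> /allP/(_ j); rewrite mem_index_enum => /(_ isT)/=.
  by rewrite sqrf_eq0 subr_eq0 => /eqP.
Qed.

Lemma backup_feasible pi q : Pi pi -> F q ->
  (forall x a, Qfun M gamma pi x a = (q (x, a))%:E) ->
  feasible gamma F G Dd Dg e%:E pi (backup M gamma pi q (reward M), reward M).
Proof.
move=> Ppi Fq qE; set qf := backup _ _ _ _ _.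
have Fqf : F qf by exact: (backup_class FGPi_compl).
split => //.
- rewrite lee_fin lerBlDr -lerBlDl.
  apply: lb_le_inf; first by exists (loss_dyn gamma (aug_dyn R Dd Dg) pi
    (qf, reward M) (qf, reward M)), (qf, reward M).
  move=> _ [[f' g'] [/= Ff' Gg'] <-].
  have := risk_dyn_mean Ppi Ff' Fqf G_reward; have := risk_ge0 pi f' qf (reward M).
  rewrite -(loss_dyn_excess M gamma Ddyn Dgoal pi f' qf g' (reward M) (reward M) om) -/Dd -/Dg.
  rewrite (backup_fixpoint gamma01 F01 FGPi_real FGPi_compl Ppi Fq qE) -/qf.
  by move=> r0; exact: risk_to_excess te r0.
- rewrite /loss_goal /aug_goal big_map big_map big_enum/= big1 ?mulr0// => j _.
  by rewrite /reward indicE mem_set// subrr expr0n.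
Qed.

(** The chain is J(pi) - err <= [pess_value] of pi <= [pess_value] of pid <= J(pid). The left link
    bounds the objective of every feasible pair from below, the right one evaluates it at the fixed
    point for pid; concentrability is needed for pi alone. *)
Lemma suboptimality_le pi pid : Pi pi -> coda_pspi M gamma F G Pi Dd Dg e%:E pid ->
  (Jval M gamma pi - Jval M gamma pid <=
   Cdyn M gamma F mudyn mugoal pi *
     (((4 * c2)^-1 * (8 * e)) + c2 / (1 - gamma))%:E +
   Cgoal M gamma G mugoal pi * (((4 * c4)^-1 * u) + c4 / (1 - gamma))%:E)%E.
Proof.
move=> Ppi [Ppid opt].
have g1 : 0 < 1 - gamma by case/andP: gamma01 => _; rewrite subr_gt0.
have [q Fq qE] := FGPi_real.1 _ Ppi.
have [qd Fqd qdE] := FGPi_real.1 _ Ppid.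
set K2 := (4 * c2)^-1 * _ + _; set K4 := (4 * c4)^-1 * _ + _.
have K2_gt0 : 0 < K2.
  by rewrite ltr_wpDl ?divr_gt0// mulr_ge0// ?invr_ge0 mulr_ge0// ltW.
have K4_gt0 : 0 < K4.
  by rewrite ltr_wpDl ?divr_gt0// mulr_ge0// ?invr_ge0 mulr_ge0// ltW.
have Cd1 := Cdyn_ge1 mudyn mugoal FGPi_real FGPi_compl Ppi.
have Cg1 := Cgoal_ge1 mugoal FGPi_real pi.
have Cd_ub p : (F `*` F) p -> (ratio
      (int_occ_notG M gamma pi (fun z => (p.1 z - bellman M gamma pi p.2 z) ^+ 2)%R)
      (sqnorm_dyn mudyn mugoal (fun z => p.1 z - bellman M gamma pi p.2 z)%R) <=
    Cdyn M gamma F mudyn mugoal pi)%E.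
  by move=> Fp; apply: ereal_sup_ubound; exists p.
have Cg_ub g : G g -> (ratio
      (int_occ_G M gamma pi (fun x => (g x - reward M x) ^+ 2)%R)
      (sqnorm_goal mugoal (fun x => g x - reward M x)%R) <=
    Cgoal M gamma G mugoal pi)%E.
  by move=> Gg; apply: ereal_sup_ubound; exists g.
have JpE := Jval_at_policy F01 Fq qE.
have JdE := Jval_at_policy F01 Fqd qdE.
move: Cd1 Cg1 Cd_ub Cg_ub.
case: (Cdyn _ _ _ _ _ _) => [cd| |]//; case: (Cgoal _ _ _ _ _) => [cg| |]//.
(* An infinite coefficient makes the right-hand side +oo: [K2] and [K4] are positive and both
   coefficients are at least 1. *)
2: by rewrite gt0_mulye// => *; rewrite addey// leey.
2: by rewrite gt0_mulye// => *; rewrite addye// leey.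
2: by rewrite !gt0_mulye// => *; rewrite leey.
rewrite !lee_fin => Cd1 Cg1 Cd_ub Cg_ub.
have cd0 : 0 <= cd by exact: le_trans Cd1.
have cg0 : 0 <= cg by exact: le_trans Cg1.
have [m_q q01] := F01 Fq.
set err := (cd%:E * _ + _)%E.
have gap p : feasible gamma F G Dd Dg e%:E pi p -> (Jval M gamma pi <= objective M pi p + err)%E.
  case: p => f g /(feasible_risk Ppi)[Ff Gg risk_f risk_g].
  have [mf f01] := F01 Ff; have [mg g01] := G01 Gg.
  apply: le_trans (value_gap gamma01 m_q q01 mf f01 mg g01 qE c2_gt0 c4_gt0) _.
  have bf : bmeas f by exact: bmeas01.
  have bh : bmeas (fun z => (f z - backup M gamma pi f g z) ^+ 2).
    by apply: bmeasX; apply: bmeasB => //; exact: bmeas_backup.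
  have bk : bmeas (fun x => (g x - reward M x) ^+ 2).
    apply: bmeasX; apply: bmeasB; apply: bmeas01 => //.
      exact: measurable_reward.
    exact: reward01.
  have occN : (int_occ_notG M gamma pi (fun z => (f z - backup M gamma pi f g z) ^+ 2)%R <=
      (cd * (8 * e))%:E)%E.
    (* By completeness max (g, f(., pi)) belongs to [F], so f - backup is one of the Bellman errors
       over which [Cdyn] is a supremum. *)
    apply: (ratio_le cd0 _ _ _ (Cd_ub (f, fun z => Num.max (g z.1) (at_policy f pi z.1)) _)).
    - rewrite (int_occ_notGE M gamma01 pi bh.1 (fun=> sqr_ge0 _)).
      apply: xa_mean_ge0; apply: nnmeas_discounted => //.
      exact: nnmeas_off_goal bh.1 (fun=> sqr_ge0 _).
    - by apply: integral_ge0 => z _; apply: integral_ge0 => y _; rewrite lee_fin sqr_ge0.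
    - rewrite (_ : sqnorm_dyn _ _ _ = (risk M gamma mudyn mugoal pi f f g)%:E) ?lee_fin//.
      exact: (sqnorm_dyn_risk M gamma mudyn mugoal F01 G01 pi Ff Ff Gg).
    - by split => //; have [] := FGPi_compl Ff Gg Ppi.
  have occG : (int_occ_G M gamma pi (fun x => (g x - reward M x) ^+ 2)%R <=
      (cg * u)%:E)%E.
    apply: (ratio_le cg0 _ _ _ (Cg_ub g Gg)).
    - rewrite (int_occ_GE M gamma01 pi bk.1 (fun=> sqr_ge0 _)).
      apply: xa_mean_ge0; apply: nnmeas_discounted => //.
      exact: nnmeas_on_goal bk.1 (fun=> sqr_ge0 _).
    - by apply: integral_ge0 => y _; rewrite lee_fin sqr_ge0.
    - by rewrite (sqnorm_goalE mugoal_law G01 Gg) lee_fin.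
  rewrite -addeA leeD2l//.
  apply: (@le_trans _ _ (((4 * c2)^-1 * (cd * (8 * e)) + (4 * c4)^-1 * (cg * u) +
      (c2 + c4) / (1 - gamma))%:E)).
    rewrite !EFinD; apply: leeD => //; apply: leeD; rewrite EFinM.
      by rewrite lee_wpmul2l// lee_fin invr_ge0 mulr_ge0// ltW.
    by rewrite lee_wpmul2l// lee_fin invr_ge0 mulr_ge0// ltW.
  rewrite /err -!EFinM -EFinD lee_fin.
  have xc : 0 <= c2 / (1 - gamma) by rewrite divr_ge0// ltW.
  have yc : 0 <= c4 / (1 - gamma) by rewrite divr_ge0// ltW.
  have := coefficients_ge1_le ((4 * c2)^-1 * (8 * e)) ((4 * c4)^-1 * u) Cd1 Cg1 xc yc.
  apply: le_trans; rewrite -mulrDl (mulrC cd) (mulrC cg) !mulrA.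
  exact: lexx.
have := opt _ Ppi.
have le1 : (Jval M gamma pi - err <= pess_value M gamma F G Dd Dg e%:E pi)%E.
  apply: le_ereal_inf_tmp => _ [p fp <-].
  by rewrite leeBlDr//; exact: gap.
have le2 : (pess_value M gamma F G Dd Dg e%:E pid <= Jval M gamma pid)%E.
  rewrite -(objective_backup gamma01 F01 Fqd qdE).
  by apply: ereal_inf_lbound; exists (backup M gamma pid qd (reward M), reward M) => //;
    exact: backup_feasible.
move=> /(le_trans le1)/le_trans/(_ le2).
by rewrite JpE JdE leeBlDr// => h; rewrite leeBlDr// addeC.
Qed.

End good_event.

Lemma covering_number_ge1 (R : realType) (T : Type) (dist : T -> T -> \bar R)
    (F : set T) (eps : R) : F !=set0 -> (1 <= covering_number dist F eps)%E.
Proof.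
move=> [f Ff]; apply: le_ereal_inf_tmp => _ [k [c [_ /(_ f Ff)[i _]]] <-].
by rewrite lee_fin ler1n (leq_ltn_trans _ (ltn_ord i)).
Qed.

(** * Confidence level and numerical constants *)

Section confidence.
Context (R : realType) (delta0 delta : R).
Hypotheses (hdelta0 : 0 < delta0 < 1) (hdelta : 0 < delta <= delta0).

Let b0 := - ln delta0.
(** The 2 pays for a union bound over B^2 events. Since ln (B / delta) >= [b0], the part 2 / b0
    yields a further factor expR (-2), which is below 1 / 3. *)
Let c0 := 2 + 2 / b0.

Lemma b0_gt0 : 0 < b0.
Proof. by rewrite oppr_gt0 ln_lt0. Qed.

Let delta_gt0 : 0 < delta. Proof. by case/andP: hdelta. Qed.

Lemma ln_confidence_ge (B : nat) : (0 < B)%N -> b0 <= ln (B%:R / delta).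
Proof.
move=> B0; have B0' : (0 : R) < B%:R by rewrite ltr0n.
rewrite lnM ?posrE ?invr_gt0// lnV ?posrE//.
have l1 : 0 <= ln (B%:R : R) by rewrite ln_ge0// ler1n.
have l2 : ln delta <= ln delta0.
  by rewrite ler_ln ?posrE//; [case/andP: hdelta|case/andP: hdelta0].
by rewrite /b0; lra.
Qed.

(** The exponential is at most (delta / B)^2 / 3, so multiplying by N leaves delta^2 / 3. Allowing N
    up to B^2 accommodates the doubled cover of [F]. *)
Lemma tail_mass (N B : nat) : (0 < B)%N -> (N <= B * B)%N ->
  N%:R * expR (- (c0 * ln (B%:R / delta))) <= delta / 3.
Proof.
move=> B0 NB; set x := ln _; have xb : b0 <= x by exact: ln_confidence_ge.
have B0' : (0 : R) < B%:R by rewrite ltr0n.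
have Bd : 0 < B%:R / delta by rewrite divr_gt0.
have e2 : expR (-2 : R) <= 1 / 3.
  rewrite expRN div1r lef_pV2 ?posrE ?expR_gt0//.
  by have := expR_ge1Dx (2 : R); lra.
have L2 : - (c0 * x) <= (- x - x) + (-2).
  have : 2 / b0 * b0 <= 2 / b0 * x.
    by rewrite ler_pM2l// divr_gt0// b0_gt0.
  rewrite divfK ?gt_eqF ?b0_gt0// /c0 mulrDl => h.
  by rewrite -opprD -opprD lerN2; lra.
have : expR (- (c0 * x)) <= delta ^+ 2 / B%:R ^+ 2 * (1 / 3).
  apply: le_trans (_ : expR ((- x - x) + (-2)) <= _); first by rewrite ler_expR.
  rewrite expRD expRB expRN /x lnK ?posrE//.
  have -> : (B%:R / delta)^-1 / (B%:R / delta) = delta ^+ 2 / B%:R ^+ 2.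
    by field; rewrite !gt_eqF.
  by rewrite ler_pM2l// divr_gt0// exprn_gt0.
have NB' : (N%:R : R) <= B%:R ^+ 2 by rewrite -natrX ler_nat expnS expn1.
move=> h; apply: (@le_trans _ _ (B%:R ^+ 2 * (delta ^+ 2 / B%:R ^+ 2 * (1 / 3)))).
  by apply: ler_pM => //; exact: expR_ge0.
have -> : B%:R ^+ 2 * (delta ^+ 2 / B%:R ^+ 2 * (1 / 3)) = delta * delta / 3.
  by field; rewrite gt_eqF.
have d1 : delta <= 1.
  case/andP: hdelta => _ /le_trans; apply; case/andP: hdelta0 => _ ?; exact: ltW.
by rewrite ler_pM2r// ler_piMr// ltW.
Qed.

End confidence.

Lemma sum_sqrt_ge (R : realType) (x y : R) : 0 <= x -> 0 <= y ->
  x + y <= (Num.sqrt x + Num.sqrt y) ^+ 2.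
Proof.
move=> x0 y0; rewrite sqrrD !sqr_sqrtr// [X in _ <= X]addrAC lerDl.
by rewrite mulrn_wge0// mulr_ge0// sqrtr_ge0.
Qed.

Lemma thirds_le (R : realType) (a b d : R) :
  a <= d / 3 -> b <= d / 3 -> 2 * a + b <= d.
Proof. lra. Qed.

Lemma sample_error_le (R : realType) (c b L u v e : R) :
  0 <= c -> 0 <= b -> 0 <= L -> 0 <= u -> 0 <= v -> e <= L * b * u ->
  36 * (c * L) * u + 18 * (c * L) * v + 16 * e <= (36 * c + 16 * b) * (L * u + L * v).
Proof.
move=> c0 b0 L0 u0 v0 eb.
have : 0 <= c * (L * v) by rewrite !mulr_ge0.
have : 0 <= b * (L * v) by rewrite !mulr_ge0.
by lra.
Qed.

Theorem theoremA11 (R : realType) (delta0 : R) (hdelta0 : 0 < delta0 < 1) :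
  exists2 kappa0 : R, 0 < kappa0 &
  forall (kappa : R), kappa0 <= kappa ->
  forall (gamma : R), 0 <= gamma < 1 ->
  exists2 K : R, 0 < K &
  forall (dS dA dC : measure_display) (S : measurableType dS)
    (A : measurableType dA) (C : measurableType dC) (M : cgo R S A C)
    (mudyn : probability (S * A * S)%type R)
    (mugoal : probability (S * C)%type R),
    dyn_law M mudyn -> goal_law M mugoal ->
  forall (F : set (S * C * A -> R)) (G : set (S * C -> R))
    (Pi : set (R.-pker (S * C) ~> A)),
    class01 F -> class01 G ->
    realizability M gamma F G Pi -> completeness M gamma F G Pi ->
  forall (dO : measure_display) (Om : measurableType dO)
    (Pr : probability Om R) (n m : nat)
    (Ddyn : 'I_n -> {RV Pr >-> (S * A * S)%type})
    (Dgoal : 'I_m -> {RV Pr >-> (S * C)%type}),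
    (0 < n)%N -> (0 < m)%N -> iid_data mudyn mugoal Ddyn Dgoal ->
  forall (delta : R), 0 < delta <= delta0 ->
  exists E : set Om, [/\ measurable E, ((1 - delta)%:E <= Pr E)%E &
    forall w : Om, E w ->
    forall pid : R.-pker (S * C) ~> A,
      coda_pspi M gamma F G Pi
        [seq Ddyn i w | i <- enum 'I_n] [seq Dgoal j w | j <- enum 'I_m]
        (kappa%:E * rate_dyn F G Pi n m delta ^+ 2)%E pid ->
    forall pi : R.-pker (S * C) ~> A, Pi pi ->
      (Jval M gamma pi - Jval M gamma pid <=
       K%:E * (Cdyn M gamma F mudyn mugoal pi * rate_dyn F G Pi n m delta +
               Cgoal M gamma G mugoal pi * rate_goal G m delta))%E].
Proof.
pose b0 := - ln delta0; pose c0 := 2 + 2 / b0.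
have b00 : 0 < b0 by exact: b0_gt0.
have c00 : 0 < c0 by rewrite addr_gt0// divr_gt0.
(* The errors of the dynamics and of the goal event, as multiples of L0 (1 / n + 1 / m) and of Lg /
   m. The terms in 1 / b0 come from the cover radii, converted by 1 <= L / b0. *)
pose k0 := 36 * c0 + 16 / b0; pose Kg := 72 * c0 + 4 / b0.
have k00 : 0 < k0 by rewrite addr_gt0// ?divr_gt0// mulr_gt0.
have Kg0 : 0 < Kg by rewrite addr_gt0// ?divr_gt0// mulr_gt0.
exists k0 => // kappa k0k gamma gamma01.
have kappa0 : 0 < kappa by exact: lt_le_trans k0k.
have g1 : 0 < 1 - gamma by case/andP: gamma01 => _; rewrite subr_gt0.
(* With c equal to the rate, (4 rd)^-1 * 8 kappa rd^2 = 2 kappa rd and (4 rg)^-1 * Kg rg^2 = (Kg /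
   4) rg; the splitting constants add rd / (1 - gamma) and rg / (1 - gamma). *)
pose K := 2 * kappa + Kg / 4 + (1 - gamma)^-1.
have K0 : 0 < K by rewrite !addr_gt0// ?divr_gt0// ?mulr_gt0// invr_gt0.
exists K => // dS dA dC S A C M mudyn mugoal dynl goall F G Pi F01 G01 real compl.
move=> dO Om Pr n m Ddyn Dgoal n0 m0 data delta hdelta.
have d0 : 0 < delta by case/andP: hdelta.
(* If a covering number is infinite then so is a rate, and coefficients of at least 1 keep the
   right-hand side at +oo; the sure event then serves. The same event serves when [Pi] is empty. *)
have trivial_event : (forall pi, Pi pi ->
    rate_dyn F G Pi n m delta = +oo%E \/ rate_goal G m delta = +oo%E) ->
  exists E : set Om, [/\ measurable E, ((1 - delta)%:E <= Pr E)%E &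
    forall w : Om, E w -> forall pid : R.-pker (S * C) ~> A,
      coda_pspi M gamma F G Pi
        [seq Ddyn i w | i <- enum 'I_n] [seq Dgoal j w | j <- enum 'I_m]
        (kappa%:E * rate_dyn F G Pi n m delta ^+ 2)%E pid ->
    forall pi : R.-pker (S * C) ~> A, Pi pi ->
      (Jval M gamma pi - Jval M gamma pid <=
       K%:E * (Cdyn M gamma F mudyn mugoal pi * rate_dyn F G Pi n m delta +
               Cgoal M gamma G mugoal pi * rate_goal G m delta))%E].
  move=> infinite; exists setT; split => //.
    by rewrite probability_setT lee_fin; lra.
  move=> w _ pid _ pi Ppi.
  have Cd1 := Cdyn_ge1 mudyn mugoal real compl Ppi.
  have Cg1 := Cgoal_ge1 mugoal real pi.
  have rd0 : (0 <= rate_dyn F G Pi n m delta)%E by rewrite adde_ge0// sqrte_ge0.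
  have rg0 : (0 <= rate_goal G m delta)%E by exact: sqrte_ge0.
  have Cd0 := lt_le_trans lte01 Cd1; have Cg0 := lt_le_trans lte01 Cg1.
  suff -> : (Cdyn M gamma F mudyn mugoal pi * rate_dyn F G Pi n m delta +
               Cgoal M gamma G mugoal pi * rate_goal G m delta = +oo)%E.
    by rewrite gt0_muley ?lte_fin// leey.
  have noNy (x : \bar R) : (0 <= x -> x != -oo)%E by case: x.
  case: (infinite pi Ppi) => ->.
    by rewrite gt0_muley// addye// noNy// mule_ge0// ltW.
  by rewrite gt0_muley// addey// noNy// mule_ge0// ltW.
(* A policy makes all three classes nonempty, through realizability for [F] and [G], so the covering
   numbers are at least 1. *)
have [[pi0 Ppi0]|noPi] := pselect (Pi !=set0); last first.
  by apply: trivial_event => pi Ppi; exfalso; apply: noPi; exists pi.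
have [q0 Fq0 _] := real.1 _ Ppi0.
have NF1 := covering_number_ge1 (@dist_sup R _) (n * m)%:R^-1 (ex_intro F _ Fq0).
have NG1 := covering_number_ge1 (@dist_sup R _) (n * m)%:R^-1 (ex_intro G _ real.2).
have NP1 := covering_number_ge1 (@dist_policy R _ _ _ _) (n * m)%:R^-1 (ex_intro Pi _ Ppi0).
have Ng1 := covering_number_ge1 (@dist_sup R _) m%:R^-1 (ex_intro G _ real.2).
have dV0 : (0 < (delta^-1)%:E)%E by rewrite lte_fin invr_gt0.
have nV0 : (0 < (n%:R^-1 : R)%:E)%E by rewrite lte_fin invr_gt0 ltr0n.
have mV0 : (0 < (m%:R^-1 : R)%:E)%E by rewrite lte_fin invr_gt0 ltr0n.
have infinite_rate : (covering_number (@dist_sup R _) F (n * m)%:R^-1 *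
    covering_number (@dist_sup R _) G (n * m)%:R^-1 *
    covering_number (@dist_policy R _ _ _ _) Pi (n * m)%:R^-1 = +oo)%E ->
    rate_dyn F G Pi n m delta = +oo%E.
  move=> oo; rewrite /rate_dyn /logcov oo gt0_mulye// /lne.
  by rewrite !gt0_mulye.
have lt0 x : (1 <= x -> 0 < x :> \bar R)%E by exact: lt_le_trans.
have [ltF|] := ltP (covering_number (@dist_sup R _) F (n * m)%:R^-1) +oo%E; last first.
  rewrite leye_eq => /eqP ooF; apply: trivial_event => _ _; left.
  by apply: infinite_rate; rewrite ooF !gt0_mulye ?lt0.
have [ltG|] := ltP (covering_number (@dist_sup R _) G (n * m)%:R^-1) +oo%E; last first.
  rewrite leye_eq => /eqP ooG; apply: trivial_event => _ _; left.
  by apply: infinite_rate; rewrite ooG gt0_muley ?gt0_mulye ?lt0.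
have [ltPi|] := ltP (covering_number (@dist_policy R _ _ _ _) Pi (n * m)%:R^-1) +oo%E; last first.
  rewrite leye_eq => /eqP ooP; apply: trivial_event => _ _; left.
  by apply: infinite_rate; rewrite ooP gt0_muley ?mule_gt0 ?lt0.
have [ltg|] := ltP (covering_number (@dist_sup R _) G m%:R^-1) +oo%E; last first.
  rewrite leye_eq => /eqP oog; apply: trivial_event => _ _; right.
  by rewrite /rate_goal oog gt0_mulye// /lne gt0_mulye.
have [kF [cF [NF FcF covF]]] := covering_numberP ltF.
have [kG [cG [NG GcG covG]]] := covering_numberP ltG.
have [kP [cP [NP PcP covP]]] := covering_numberP ltPi.
have [kg [cg [Ng Gcg covg]]] := covering_numberP ltg.
have kF0 : (0 < kF)%N by move: NF1; rewrite NF lee_fin ler1n.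
have kG0 : (0 < kG)%N by move: NG1; rewrite NG lee_fin ler1n.
have kP0 : (0 < kP)%N by move: NP1; rewrite NP lee_fin ler1n.
have kg0 : (0 < kg)%N by move: Ng1; rewrite Ng lee_fin ler1n.
pose B := (kF * kG * kP)%N.
have B0 : (0 < B)%N by rewrite !muln_gt0 kF0 kG0.
pose L0 := ln (B%:R / delta); pose Lg := ln (kg%:R / delta).
have L0b : b0 <= L0 by exact: ln_confidence_ge.
have Lgb : b0 <= Lg by exact: ln_confidence_ge.
have L00 : 0 < L0 by exact: lt_le_trans L0b.
have Lg0 : 0 < Lg by exact: lt_le_trans Lgb.
have n0' : (0 : R) < n%:R by rewrite ltr0n.
have m0' : (0 : R) < m%:R by rewrite ltr0n.
have logcovE : logcov F G Pi n m delta = L0%:E.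
  rewrite /logcov NF NG NP -!EFinM lne_EFin; last first.
    by rewrite -!natrM divr_gt0// ltr0n.
  by rewrite -!natrM.
pose rd := Num.sqrt (L0 / n%:R) + Num.sqrt (L0 / m%:R).
have rdE : rate_dyn F G Pi n m delta = rd%:E by rewrite /rate_dyn logcovE -!EFinM.
pose rg := Num.sqrt (Lg / m%:R).
have rgE : rate_goal G m delta = rg%:E.
  rewrite /rate_goal Ng -EFinM lne_EFin; last by rewrite divr_gt0// ltr0n.
  by rewrite -EFinM.
have rd0 : 0 < rd by rewrite addr_gt0// sqrtr_gt0 divr_gt0.
have rg0 : 0 < rg by rewrite sqrtr_gt0 divr_gt0.
have rd2 : L0 / n%:R + L0 / m%:R <= rd ^+ 2.
  by apply: sum_sqrt_ge; rewrite divr_ge0// ltW.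
have rg2 : rg ^+ 2 = Lg / m%:R by rewrite sqr_sqrtr// divr_ge0// ltW.
pose eps : R := (n * m)%:R^-1.
have eps0 : 0 <= eps by rewrite invr_ge0.
have em0 : 0 <= (m%:R^-1 : R) by rewrite invr_ge0.
have [B1 [mB1 PB1] B1P] := dyn_event gamma01 dynl n0 m0 data F01 G01 (c0 * L0) eps0
  FcF GcG covF covG covP.
have [B2 [mB2 PB2] B2P] := goal_event n0 m0 data G01 (c0 * Lg) em0 Gcg covg.
have [B3 [mB3 PB3] B3P] := goal_sample_event goall data.
exists (~` (B1 `|` B2 `|` B3)); split.
- by apply: measurableC; apply: measurableU => //; exact: measurableU.
- rewrite probability_setC; last by apply: measurableU => //; exact: measurableU.
  have : (Pr (B1 `|` B2 `|` B3) <= delta%:E)%E.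
    apply: le_trans (measureU2 _ (measurableU _ _ mB1 mB2) mB3) _.
    apply: (@le_trans _ _ (delta%:E + 0)%E); last by rewrite adde0.
    apply: leeD => //; apply: le_trans (measureU2 _ mB1 mB2) _.
    apply: le_trans (leeD PB1 PB2) _; rewrite -EFinD lee_fin.
    (* The budget: two thirds of delta for the dynamics event, whose tail carries a factor 2, one
       third for the goal event, and nothing for the null event. *)
    have t1 : (kF * kF * kG * kP)%:R * expR (- (c0 * L0)) <= delta / 3.
      apply: (tail_mass hdelta0 hdelta B0).
      have -> : (kF * kF * kG * kP = B * kF)%N.
        by rewrite /B -!mulnA [(kF * (kG * kP))%N in LHS]mulnC -mulnA.
      by rewrite leq_mul2l /B -mulnA leq_pmulr ?orbT// muln_gt0 kG0.
    have t2 : kg%:R * expR (- (c0 * Lg)) <= delta / 3.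
      by apply: (tail_mass hdelta0 hdelta kg0); exact: leq_pmulr.
    by rewrite mulrCA; exact: thirds_le t1 t2.
  set p := Pr _ => pd.
  have pfin : p \is a fin_num by apply: fin_num_measure; apply: measurableU => //; exact: measurableU.
  by move: pd; rewrite -(fineK pfin) -EFinB !lee_fin lerD2l lerN2.
move=> w; rewrite !setCU => -[[nB1 nB2] nB3] pid copt pi Ppi.
pose t := 36 * (c0 * L0) / n%:R + 18 * (c0 * L0) / m%:R + 16 * eps.
(* The cover radius 1 / (n m) is at most 1 / n, and the margin L0 >= b0 makes it a multiple of the
   statistical error. *)
have epsn : eps <= L0 / b0 / n%:R.
  apply: (@le_trans _ _ n%:R^-1).
    by rewrite lef_pV2 ?posrE ?ltr0n ?muln_gt0 ?n0// ler_nat leq_pmulr.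
  have r1 : 1 <= L0 / b0 by rewrite ler_pdivlMr// mul1r.
  by rewrite ler_peMl// invr_ge0 ltW.
have te : t <= kappa * rd ^+ 2.
  apply: le_trans (_ : k0 * rd ^+ 2 <= _); last by rewrite ler_wpM2r// sqr_ge0.
  apply: le_trans (_ : k0 * (L0 / n%:R + L0 / m%:R) <= _); last by rewrite ler_wpM2l// ltW.
  by apply: sample_error_le; rewrite // ?invr_ge0 ltW.
have uE : 72 * (c0 * Lg) / m%:R + 4 * m%:R^-1 <= Kg * rg ^+ 2.
  rewrite rg2 /Kg (mulrDl (72 * c0)); apply: lerD; first by rewrite !mulrA.
  have r1 : 1 <= b0^-1 * Lg by rewrite mulrC ler_pdivlMr// mul1r.
  by rewrite -[leRHS]mulrA ler_pM2l// mulrA ler_peMl.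
have optE : (kappa%:E * rate_dyn F G Pi n m delta ^+ 2 = (kappa * rd ^+ 2)%:E)%E.
  by rewrite rdE -EFin_expe -EFinM.
rewrite optE in copt.
have e1 : 0 <= kappa * rd ^+ 2 by rewrite mulr_ge0 ?sqr_ge0// ltW.
have e2 : 0 <= Kg * rg ^+ 2 by rewrite mulr_ge0 ?sqr_ge0// ltW.
have hdyn pi' f' f g : Pi pi' -> F f' -> F f -> G g ->
    risk M gamma mudyn mugoal pi' f' f g / 4 - t <=
    dyn_mean Ddyn Dgoal (excess M gamma pi' f' f g) w.
  move=> Ppi' Ff' Ff Gg; apply: le_trans (B1P w nB1 pi' f' f g Ppi' Ff' Ff Gg).
  by rewrite /t !opprD !addrA.
have hgoal g : G g -> (forall j, g (Dgoal j w) = 1) ->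
    (\int[mugoal]_y ((g y - 1) ^+ 2))%R <= Kg * rg ^+ 2.
  by move=> Gg gD; exact: le_trans (B2P w nB2 g Gg gD) uE.
have sub := suboptimality_le gamma01 goall m0 F01 G01 real compl rd0 rg0
  e1 te e2 hdyn hgoal (B3P w nB3) Ppi copt.
apply: le_trans sub _.
rewrite rdE rgE.
have Cd0 := lt0 _ (Cdyn_ge1 mudyn mugoal real compl Ppi).
have Cg0 := lt0 _ (Cgoal_ge1 mugoal real pi).
have rd0E : (0 <= rd%:E)%E by rewrite lee_fin ltW.
have rg0E : (0 <= rg%:E)%E by rewrite lee_fin ltW.
rewrite ge0_muleDr; last 2 first.
- by rewrite mule_ge0// ltW.
- by rewrite mule_ge0// ltW.
rewrite [X in (_ <= X + _)%E]muleCA [X in (_ <= _ + X)%E]muleCA -!EFinM.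
have G10 : 0 < (1 - gamma)^-1 by rewrite invr_gt0.
apply: leeD; (apply: lee_wpmul2l; first exact: ltW); rewrite lee_fin.
  have -> : (4 * rd)^-1 * (8 * (kappa * rd ^+ 2)) + rd / (1 - gamma) =
      (2 * kappa + (1 - gamma)^-1) * rd by field; rewrite !gt_eqF.
  by rewrite ler_pM2r// lerD2r lerDl divr_ge0// ltW.
have -> : (4 * rg)^-1 * (Kg * rg ^+ 2) + rg / (1 - gamma) =
    (Kg / 4 + (1 - gamma)^-1) * rg by field; rewrite !gt_eqF.
by rewrite ler_pM2r// lerD2r lerDr mulr_ge0// ltW.
Qed.
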